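(* Let $\varphi$ be a function analytic in $\mathbb{D}$ with $\varphi'\in H^\infty$ and let $\Phi$ be the function on $\mathbb{T}\times\mathbb{T}$ defined by $$ \Phi(\zeta,\tau)=\frac{\varphi(\zeta)-\varphi(\tau)}{\zeta-\tau}\quad\text{for }\zeta\ne\tau,\qquad \Phi(\zeta,\zeta)=0,\quad \zeta,\tau\in\mathbb{T}. $$ If $T$ and $R$ are contractions on a Hilbert space such that $T-R\in\boldsymbol{S}_2$, then $$ \varphi(T)-\varphi(R)=\iint\limits_{\mathbb{T}\times\mathbb{T}}\Phi(\zeta,\tau)\,d\mathcal{E}_T(\zeta)\,(T-R)\,d\mathcal{E}_R(\tau), $$ where $\mathcal{E}_T$ and $\mathcal{E}_R$ are semi-spectral measures of $T$ and $R$.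
   Context: $\mathbb{D}$ is the open unit disk, $\mathbb{T}$ the unit circle; $H^\infty$ is the space of bounded analytic functions in $\mathbb{D}$; $\boldsymbol{S}_2$ is the Hilbert–Schmidt class. A contraction is an operator of norm at most $1$. $C_A$ is the disk-algebra (functions analytic in $\mathbb{D}$ and continuous on the closed disk); if $\varphi'\in H^\infty$ then $\varphi\in C_A$. For $f\in C_A$ and a contraction $T$, $f(T)$ is defined by extending the polynomial calculus by continuity using von Neumann's inequality. Semi-spectral measures: for a measurable space $(\mathcal{X},\mathcal{B})$ and a Hilbert space $\mathcal{H}$, a semi-spectral measure is a map $\mathcal{E}$ from $\mathcal{B}$ to the bounded operators on $\mathcal{H}$ with $\mathcal{E}(\Delta)\ge0$, $\mathcal{E}(\varnothing)=0$, $\mathcal{E}(\mathcal{X})=I$, countably additive in the weak operator topology. By Naimark's theorem it has a spectral dilation, i.e., a spectral measure $E$ on a Hilbert space $\mathcal{K}\supset\mathcal{H}$ with $\mathcal{E}(\Delta)=P_{\mathcal{H}}E(\Delta)|\mathcal{H}$, and $\int f\,d\mathcal{E}:=P_{\mathcal{H}}\left(\int f\,dE\right)\big|\mathcal{H}$ for bounded measurable $f$ (independent of the dilation). A semi-spectral measure of a contraction $T$ on $\mathcal{H}$ is $\mathcal{E}_T(\Delta)=P_{\mathcal{H}}E_U(\Delta)|\mathcal{H}$, $\Delta\subset\mathbb{T}$ Borel, where $E_U$ is the spectral measure of a unitary dilation $U$ of $T$ (a unitary operator on some $\mathcal{K}\supset\mathcal{H}$ with $T^n=P_{\mathcal{H}}U^n|\mathcal{H}$,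 $n\ge0$); thus $T^n=\int_{\mathbb{T}}\zeta^n\,d\mathcal{E}_T(\zeta)$, $n\ge0$. Double operator integrals with Hilbert–Schmidt $Q$: for semi-spectral measures $\mathcal{E}_1,\mathcal{E}_2$ (on $\mathcal{X}_1,\mathcal{X}_2$) there is a semi-spectral measure $\mathcal{F}$ on $\mathcal{X}_1\times\mathcal{X}_2$, with values in the bounded operators on the Hilbert space of Hilbert–Schmidt operators, such that $\mathcal{F}(\Delta_1\times\Delta_2)Q=\mathcal{E}_1(\Delta_1)Q\,\mathcal{E}_2(\Delta_2)$; for bounded measurable $\Phi$ on $\mathcal{X}_1\times\mathcal{X}_2$ and $Q\in\boldsymbol{S}_2$, $\iint\Phi\,d\mathcal{E}_1\,Q\,d\mathcal{E}_2:=\left(\int\Phi\,d\mathcal{F}\right)Q$. *)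

(* Defs.v *)
From HB Require Import structures.
From mathcomp Require Import all_boot all_order all_algebra.
From mathcomp Require Import all_classical all_reals all_analysis.
From mathcomp Require Import finmap complex.
From mathcomp Require Import ring lra.

Set Implicit Arguments.
Unset Strict Implicit.
Unset Printing Implicit Defensive.

Import Order.TTheory GRing.Theory Num.Theory.
Import numFieldNormedType.Exports.

Local Open Scope classical_set_scope.
Local Open Scope ring_scope.

Section PreHilbert.
Variables (R : realType) (V : lmodType R[i]) (ip : V -> V -> R[i]).
Hypothesis ip_linear : forall y a x z, ip (a *: x + z) y = a * ip x y + ip z y.
Hypothesis ip_conj : forall x y, ip x y = (ip y x)^*.
Hypothesis ip_ge0 : forall x, 0 <= ip x x.
Hypothesis ip_eq0 : forall x, ip x x = 0 -> x = 0.

Lemma ip0l y : ip 0 y = 0.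
Proof.
have := ip_linear y 1 0 0; rewrite scaler0 addr0 mul1r => h.
by apply: (addrI (ip 0 y)); rewrite addr0 -h.
Qed.

Lemma ipDl x z y : ip (x + z) y = ip x y + ip z y.
Proof. by have := ip_linear y 1 x z; rewrite scale1r mul1r. Qed.

Lemma ipZl a x y : ip (a *: x) y = a * ip x y.
Proof. by have := ip_linear y a x 0; rewrite !addr0 ip0l addr0. Qed.

Lemma ipDr x y z : ip x (y + z) = ip x y + ip x z.
Proof. by rewrite ip_conj ipDl rmorphD /= -!ip_conj. Qed.

Lemma ipZr a x y : ip x (a *: y) = a^* * ip x y.
Proof. by rewrite ip_conj ipZl rmorphM /= -ip_conj. Qed.

Lemma ip0r x : ip x 0 = 0.
Proof. by rewrite ip_conj ip0l conjC0. Qed.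

Lemma ip_cauchy_schwarz x y : `|ip x y| ^+ 2 <= ip x x * ip y y.
Proof.
have [->|y0] := eqVneq y 0; first by rewrite !ip0r normr0 expr0n /= mulr0.
have yy0 : 0 < ip y y.
  by rewrite lt_neqAle ip_ge0 andbT eq_sym; apply: contra_neq y0; exact: ip_eq0.
have : 0 <= ip (ip y y *: x + (- ip x y) *: y) (ip y y *: x + (- ip x y) *: y).
  exact: ip_ge0.
rewrite !(ipDl, ipDr, ipZl, ipZr).
rewrite rmorphN /= -(ip_conj y y) -(ip_conj y x) normCK -(ip_conj y x).
set a := ip x y; set b := ip y y; set c := ip y x; set d := ip x x.
rewrite (_ : _ + _ = b * (d * b - a * c)); last by ring.
by rewrite pmulr_rge0// subr_ge0.
Qed.

Definition ip_norm x : R[i] := sqrtC (ip x x).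

Lemma ip_normD x y : ip_norm (x + y) <= ip_norm x + ip_norm y.
Proof.
rewrite -(@ler_pXn2r _ 2)// ?nnegrE ?addr_ge0 ?sqrtC_ge0 ?ip_ge0//.
rewrite sqrrD !sqrtCK ipDl !ipDr -!addrA lerD2l !addrA lerD2r.
rewrite (ip_conj y x) -mulr2n -mulr_natl.
have -> : ip x y + (ip x y)^* = 2 * 'Re (ip x y).
  by rewrite ReE mulrCA divff ?pnatr_eq0// mulr1.
rewrite ler_pM2l ?ltr0n//.
apply: le_trans (_ : `|ip x y| <= _).
  by apply: le_trans (leif_normC_Re_Creal _); rewrite real_ler_norm ?Creal_Re.
rewrite -(@ler_pXn2r _ 2)// ?nnegrE ?mulr_ge0 ?sqrtC_ge0 ?ip_ge0//.
by rewrite exprMn !sqrtCK ip_cauchy_schwarz.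
Qed.

Lemma ip_normZ a x : ip_norm (a *: x) = `|a| * ip_norm x.
Proof.
rewrite /ip_norm ipZl ipZr mulrA -normCK rootCMl ?exprn_ge0// sqrCK//.
Qed.

Lemma ip_norm_eq0 x : ip_norm x = 0 -> x = 0.
Proof. by move/eqP; rewrite sqrtC_eq0 => /eqP; exact: ip_eq0. Qed.

End PreHilbert.

(* inner is linear in its first argument *)
HB.mixin Record isHilbert (R : realType) H & CompleteNormedModule R[i] H := {
  inner : H -> H -> R[i] ;
  inner_linear : forall y a x z,
    inner (a *: x + z) y = a * inner x y + inner z y ;
  inner_conj : forall x y, inner x y = (inner y x)^* ;
  inner_norm : forall x, inner x x = `|x| ^+ 2
}.

#[short(type="hilbertType")]
HB.structure Definition Hilbert (R : realType) :=
  {H of isHilbert R H & CompleteNormedModule R[i] H}.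

Section HilbertTheory.
Variables (R : realType) (H : hilbertType R).
Implicit Types (x y z e : H) (a : R[i]) (B : set H) (J : {fset H}).

Let lin := @inner_linear R H.
Let con := @inner_conj R H.

Lemma inner_ge0 x : 0 <= inner x x.
Proof. by rewrite inner_norm exprn_ge0. Qed.

Lemma inner_eq0 x : inner x x = 0 -> x = 0.
Proof. by rewrite inner_norm => /eqP; rewrite sqrf_eq0 normr_eq0 => /eqP. Qed.

Lemma innerDl x y z : inner (x + y) z = inner x z + inner y z.
Proof. exact: ipDl lin x y z. Qed.

Lemma innerDr x y z : inner x (y + z) = inner x y + inner x z.
Proof. exact: ipDr lin con x y z. Qed.

Lemma innerZl a x y : inner (a *: x) y = a * inner x y.
Proof. exact: ipZl lin a x y. Qed.

Lemma innerZr a x y : inner x (a *: y) = a^* * inner x y.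
Proof. exact: ipZr lin con a x y. Qed.

Lemma inner0l y : inner 0 y = 0.
Proof. exact: ip0l lin y. Qed.

Lemma inner0r x : inner x 0 = 0.
Proof. exact: ip0r lin con x. Qed.

Lemma innerNl x y : inner (- x) y = - inner x y.
Proof. by rewrite -scaleN1r innerZl mulN1r. Qed.

Lemma innerNr x y : inner x (- y) = - inner x y.
Proof. by rewrite -scaleN1r innerZr rmorphN1 mulN1r. Qed.

Lemma innerBl x y z : inner (x - y) z = inner x z - inner y z.
Proof. by rewrite innerDl innerNl. Qed.

Lemma innerBr x y z : inner x (y - z) = inner x y - inner x z.
Proof. by rewrite innerDr innerNr. Qed.

Lemma inner_suml (I : Type) (r : seq I) (F : I -> H) y :
  inner (\sum_(i <- r) F i) y = \sum_(i <- r) inner (F i) y.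
Proof.
by apply: (big_morph (fun x => inner x y)) => [u v|]; rewrite ?innerDl ?inner0l.
Qed.

Lemma inner_sumr (I : Type) (r : seq I) (F : I -> H) x :
  inner x (\sum_(i <- r) F i) = \sum_(i <- r) inner x (F i).
Proof.
by apply: (big_morph (inner x)) => [u v|]; rewrite ?innerDr ?inner0r.
Qed.

Lemma cauchy_schwarz x y : `|inner x y| <= `|x| * `|y|.
Proof.
rewrite -(@ler_pXn2r _ 2)// ?nnegrE ?mulr_ge0// exprMn -!inner_norm.
exact: ip_cauchy_schwarz lin con inner_ge0 inner_eq0 x y.
Qed.

Definition normsq x : R := complex.Re (`|x| ^+ 2).

Lemma normsqE x : (normsq x)%:C%C = `|x| ^+ 2.
Proof. by apply: RRe_real; rewrite ger0_real// exprn_ge0. Qed.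

Lemma normsq_ge0 x : 0 <= normsq x.
Proof. by rewrite -ler0c normsqE exprn_ge0. Qed.

Lemma normsq0 : normsq 0 = 0.
Proof. by rewrite /normsq normr0 expr0n. Qed.

Definition orthonormal_set B :=
  forall e f, B e -> B f -> inner e f = (e == f)%:R.

Definition orthonormal_basis B :=
  orthonormal_set B /\ forall x, (forall e, B e -> inner x e = 0) -> x = 0.

Lemma orthonormal_basis_exists : exists B, orthonormal_basis B.
Proof.
have [|B [oB mB]] := @Zorn_bigcup H orthonormal_set.
  move=> F FP tF e f [X FX Xe] [Y FY Yf].
  have [XY|YX] := tF _ _ FX FY.
    by apply: (FP _ FY) => //; exact: XY.
  by apply: (FP _ FX) => //; exact: YX.
exists B; split=> // x xB; apply: contrapT => /eqP x0.
pose u := `|x|^-1 *: x.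
have nx : `|x| != 0 by rewrite normr_eq0.
have uB e : B e -> inner u e = 0 by move=> Be; rewrite innerZl xB// mulr0.
have uu : inner u u = 1.
  by rewrite inner_norm normrZ normfV normr_id mulVf// expr1n.
have Bu : ~ B u by move=> /uB/eqP; rewrite uu oner_eq0.
apply: (mB (B `|` [set u])).
  split; first exact: subsetUl.
  by move=> /(_ u)/(_ (or_intror erefl)).
move=> e f [Be|->] [Bf|->]; first exact: oB.
- rewrite inner_conj uB// conjC0; case: eqP => // eu.
  by case: Bu; rewrite -eu.
- rewrite uB//; case: eqP => // eu.
  by case: Bu; rewrite eu.
- by rewrite uu eqxx.
Qed.

Section Finite.
Variable B : set H.
Hypothesis oB : orthonormal_set B.

Lemma inner_fsum J (c : H -> R[i]) f : [set` J] `<=` B -> B f ->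
  inner (\sum_(e <- J) c e *: e) f = if f \in J then c f else 0.
Proof.
move=> JB Bf; rewrite inner_suml.
have h e : e \in J -> inner (c e *: e) f = if e == f then c f else 0.
  move=> eJ; rewrite innerZl (oB (JB _ eJ) Bf).
  by case: eqP => [->|_]; rewrite ?mulr1 ?mulr0.
rewrite big_seq (eq_bigr (fun e => if e == f then c f else 0)); last first.
  by move=> e /h.
rewrite -big_seq.
have [fJ|fJ] := boolP (f \in J).
  rewrite (big_fsetD1 f)//= eqxx big_seq big1 ?addr0// => e.
  by rewrite !inE => /andP[/negbTE ->].
rewrite big_seq big1// => e eJ; case: eqP => // ef.
by rewrite -ef eJ in fJ.
Qed.

Lemma norm_fsum J (c : H -> R[i]) : [set` J] `<=` B ->
  `|\sum_(e <- J) c e *: e| ^+ 2 = \sum_(e <- J) `|c e| ^+ 2.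
Proof.
move=> JB; rewrite -inner_norm inner_sumr big_seq [RHS]big_seq.
apply: eq_bigr => e eJ; rewrite innerZr inner_fsum//; last exact: JB.
by rewrite eJ mulrC -normCK.
Qed.

Definition fproj J x : H := \sum_(e <- J) inner x e *: e.

Lemma norm_sub_fproj J x : [set` J] `<=` B ->
  `|x - fproj J x| ^+ 2 = `|x| ^+ 2 - \sum_(e <- J) `|inner x e| ^+ 2.
Proof.
move=> JB; rewrite -!inner_norm innerBr !innerBl.
have -> : inner x (fproj J x) = \sum_(e <- J) `|inner x e| ^+ 2.
  by rewrite inner_sumr; apply: eq_bigr => e _; rewrite innerZr mulrC -normCK.
have -> : inner (fproj J x) x = \sum_(e <- J) `|inner x e| ^+ 2.
  rewrite inner_suml; apply: eq_bigr => e _.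
  by rewrite innerZl (inner_conj e x) -normCK.
by rewrite [inner (fproj _ _) _]inner_norm norm_fsum// subrr subr0.
Qed.

Lemma bessel J x : [set` J] `<=` B ->
  \sum_(e <- J) `|inner x e| ^+ 2 <= `|x| ^+ 2.
Proof. by move=> JB; rewrite -subr_ge0 -norm_sub_fproj// exprn_ge0. Qed.

Lemma norm_fproj_sub J K x : [set` K] `<=` B -> (J `<=` K)%fset ->
  `|fproj K x - fproj J x| ^+ 2 =
  \sum_(e <- K) `|inner x e| ^+ 2 - \sum_(e <- J) `|inner x e| ^+ 2.
Proof.
move=> KB JK.
have E (V : nmodType) (F : H -> V) :
    \sum_(e <- K) F e = \sum_(e <- J) F e + \sum_(e <- (K `\` J)%fset) F e.
  rewrite (big_fsetID _ (mem J))/=; congr (_ + _); apply: eq_fbigl => e.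
    by rewrite !inE/=; apply/andP/idP => [[]//|eJ]; rewrite (fsubsetP JK).
  by rewrite !inE/= andbC.
rewrite /fproj !E !(addrC (\sum_(e <- J) _)) !addrK norm_fsum// => e /=.
by rewrite !inE => /andP[_]; exact: KB.
Qed.

End Finite.

Lemma inner_basis_dense B x (eps : R[i]) : orthonormal_basis B -> 0 < eps ->
  exists2 J : {fset H}, [set` J] `<=` B & `|x - fproj J x| < eps.
Proof.
move=> [oB mB] eps0.
pose T J : R := \sum_(e <- J) complex.Re (`|inner x e| ^+ 2).
have TE J : (T J)%:C%C = \sum_(e <- J) `|inner x e| ^+ 2.
  rewrite /T rmorph_sum; apply: eq_bigr => e _.
  by apply: RRe_real; rewrite ger0_real// exprn_ge0.
pose S := [set T J | J in [set J : {fset H} | [set` J] `<=` B]].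
have Tle J : [set` J] `<=` B -> T J <= normsq x.
  by move=> JB; rewrite -lecR TE normsqE (bessel oB).
have hS : has_sup S.
  split; first by exists (T fset0), fset0.
  by exists (normsq x) => _ [J JB <-]; exact: Tle.
have Tsup J : [set` J] `<=` B -> T J <= sup S.
  by move=> JB; apply: sup_upper_bound => //; exists J.
pose d n : R := n.+1%:R^-1.
have d0 n : 0 < d n by rewrite invr_gt0.
have /choice[J JP] : forall n, exists J : {fset H}, [set` J] `<=` B /\ sup S - d n ^+ 2 < T J.
  move=> n; have [_ [J JB <-] TJ] := sup_adherent (exprn_gt0 2 (d0 n)) hS.
  by exists J.
have JB n := (JP n).1.
have step n K : [set` K] `<=` B -> (J n `<=` K)%fset ->
    `|fproj K x - fproj (J n) x| <= (d n)%:C%C.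
  move=> KB JK; rewrite -(@ler_pXn2r _ 2)// ?nnegrE ?ler0c ?(ltW (d0 n))//.
  rewrite (norm_fproj_sub oB)// -!TE -rmorphB -rmorphXn lecR.
  by rewrite lerBlDl (le_trans (Tsup _ KB))// -lerBlDr ltW// (JP n).2.
have far n m : `|fproj (J n) x - fproj (J m) x| <= (d n + d m)%:C%C.
  have KB : [set` (J n `|` J m)%fset] `<=` B.
    by move=> e /=; rewrite inE => /orP[]; exact: JB.
  rewrite rmorphD (le_trans (ler_distD (fproj (J n `|` J m)%fset x) _ _))//.
  apply: lerD; first by rewrite distrC; apply: step => //; exact: fsubsetUl.
  by apply: step => //; exact: fsubsetUr.
have near_d (a : R) : 0 < a -> \forall n \near \oo, d n < a.
  by move=> a0; exact: near_infty_natSinv_lt (PosNum a0).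
have dC (a : R[i]) : 0 < a -> \forall n \near \oo, (d n)%:C%C < a.
  move=> a0; have aE : (complex.Re a)%:C%C = a by rewrite RRe_real// gtr0_real.
  have /near_d : 0 < complex.Re a by rewrite -ltcR aE.
  by apply: filterS => n; rewrite -ltcR aE.
pose u n : H := fproj (J n) x.
have cu : cvg (u @ \oo).
  apply/cauchy_cvgP/cauchy_ballP => a a0; near_simpl.
  have a20 : 0 < a / 2 by rewrite divr_gt0.
  have := dC _ a20 => -[N _ hN].
  exists ([set n | (N <= n)%N], [set n | (N <= n)%N]) => /=.
    by split; exists N.
  move=> [n m] /= [Nn Nm]; rewrite -ball_normE/= (le_lt_trans (far _ _))//.
  by rewrite rmorphD [ltRHS]splitr ltrD//; exact: hN.
have xl : x - lim (u @ \oo) = 0.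
  apply: mB => e Be; apply/eqP; rewrite -normr_le0.
  have ortho n : `|inner (x - u n) e| <= (d n)%:C%C.
    rewrite innerBl (inner_fsum oB)//; case: ifPn => eJ.
      by rewrite subrr normr0 ler0c ltW.
    have KB : [set` (e |` J n)%fset] `<=` B.
      by move=> f /=; rewrite !inE => /orP[/eqP->//|]; exact: JB.
    rewrite subr0 -(@ler_pXn2r _ 2)// ?nnegrE ?ler0c ?(ltW (d0 n))//.
    have := Tsup _ KB; rewrite -lecR TE big_fsetU1//= -TE.
    rewrite -lerBrDr => /le_trans; apply.
    by rewrite -rmorphB -rmorphXn lecR lerBlDl -lerBlDr ltW// (JP n).2.
  have ne : `|e| = 1.
    apply/eqP; rewrite -(@eqrXn2 _ 2)// expr1n -inner_norm.
    by rewrite (oB _ _ Be Be) eqxx.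
  apply/ler_addgt0Pr => a a0; rewrite add0r.
  have a20 : 0 < a / 2 by rewrite divr_gt0.
  have /cvgrPdist_lt/(_ _ a20) := cu => hn; near \oo => n.
  rewrite (_ : x - _ = (x - u n) - (lim (u @ \oo) - u n)); last first.
    by rewrite opprB addrA subrK.
  rewrite innerBl (le_trans (ler_normB _ _))// [leRHS]splitr lerD//.
    by rewrite (le_trans (ortho n))// ltW//; near: n; exact: dC.
  rewrite (le_trans (cauchy_schwarz _ _))// ne mulr1 ltW//.
  by near: n; exact: hn.
have : \forall n \near \oo, `|lim (u @ \oo) - u n| < eps.
  by have /cvgrPdist_lt/(_ _ eps0) := cu.
rewrite -(subr0_eq xl) => -[n _ /(_ n (leqnn n)) hn].
by exists (J n).
Unshelve. all: by end_near. Qed.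

End HilbertTheory.

Section EsumFset.
Variables (R : realType) (T : choiceType).
Implicit Types (B : set T) (f : T -> R).

Lemma esum_ge_fset B f (J : {fset T}) : [set` J] `<=` B ->
  ((\sum_(e <- J) f e)%:E <= \esum_(e in B) (f e)%:E)%E.
Proof.
move=> JB; apply: esum_ge; exists [set` J].
  by split=> //; exact: finite_fset.
by rewrite fsbig_finite ?set_fsetK//= sumEFin.
Qed.

Lemma esum_le_fset B f (r : \bar R) :
  (forall J : {fset T}, [set` J] `<=` B -> ((\sum_(e <- J) f e)%:E <= r)%E) ->
  (\esum_(e in B) (f e)%:E <= r)%E.
Proof.
move=> h; apply: ge_ereal_sup => _ [X [finX XB] <-].
rewrite fsbig_finite//= sumEFin h//.
by move=> e /=; rewrite in_fset_set// => /set_mem/XB.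
Qed.

Lemma esumZ B f (c : R) : 0 <= c -> (forall e, 0 <= f e) ->
  \esum_(e in B) (c * f e)%:E = (c%:E * \esum_(e in B) (f e)%:E)%E.
Proof.
have le (d : R) (g : T -> R) : 0 <= d -> (forall e, 0 <= g e) ->
    (\esum_(e in B) (d * g e)%:E <= d%:E * \esum_(e in B) (g e)%:E)%E.
  move=> d0 g0; apply: esum_le_fset => J JB.
  by rewrite -mulr_sumr EFinM lee_wpmul2l ?lee_fin// esum_ge_fset.
move=> c0 f0; apply/eqP; rewrite eq_le le//=.
have [<-|cn0] := eqVneq 0 c.
  by rewrite mul0e esum_ge0// => e _; rewrite mul0r.
have cp : 0 < c by rewrite lt_neqAle cn0.
have ci0 : 0 <= c^-1 by rewrite invr_ge0.
rewrite -lee_pdivlMl//; have := le c^-1 (fun e => c * f e) ci0.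
rewrite (eq_esum (b := fun e => (f e)%:E)); last first.
  by move=> e _; rewrite mulKf// gt_eqF.
by apply => e; rewrite mulr_ge0.
Qed.

End EsumFset.

Section BasisIndependence.
Variables (R : realType) (H : hilbertType R).
Implicit Types (x y : H) (B : set H).

Definition sqnorm (z : R[i]) : R := complex.Re (`|z| ^+ 2).

Lemma sqnormE z : (sqnorm z)%:C%C = `|z| ^+ 2.
Proof. by apply: RRe_real; rewrite ger0_real// exprn_ge0. Qed.

Lemma sqnorm_ge0 z : 0 <= sqnorm z.
Proof. by rewrite -ler0c sqnormE exprn_ge0. Qed.

Lemma sum_sqnormE (T : Type) (J : seq T) (l : T -> R[i]) :
  (\sum_(e <- J) sqnorm (l e))%:C%C = \sum_(e <- J) `|l e| ^+ 2.
Proof. by rewrite rmorph_sum; apply: eq_bigr => e _; exact: sqnormE. Qed.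

Lemma parseval B x : orthonormal_basis B ->
  \esum_(e in B) (sqnorm (inner x e))%:E = (normsq x)%:E.
Proof.
move=> bB; have [oB _] := bB; apply/eqP; rewrite eq_le; apply/andP; split.
  apply: esum_le_fset => J JB.
  by rewrite lee_fin -lecR sum_sqnormE normsqE (bessel oB).
apply/lee_addgt0Pr => d d0.
have rd0 : 0 < (Num.sqrt d)%:C%C by rewrite ltcR sqrtr_gt0.
have [J JB] := inner_basis_dense x bB rd0.
rewrite -(@ltr_pXn2r _ 2)// ?nnegrE ?(ltW rd0)//.
rewrite (norm_sub_fproj oB)// -rmorphXn sqr_sqrtr ?(ltW d0)//.
rewrite -normsqE -sum_sqnormE -rmorphB ltcR ltrBlDr => /ltW h.
apply: (@le_trans _ _ (d + \sum_(e <- J) sqnorm (inner x e))%:E).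
  by rewrite lee_fin.
by rewrite EFinD addeC leeD2r// esum_ge_fset.
Qed.

Section Functional.
Variable l : H -> R[i].
Hypothesis l_linear : forall a x y, l (a *: x + y) = a * l x + l y.
Variable M : R[i].
Hypothesis l_bound : forall x, `|l x| <= M * `|x|.

Let l0 : l 0 = 0.
Proof.
have := l_linear 1 0 0; rewrite scaler0 addr0 mul1r => h.
by apply: (addrI (l 0)); rewrite addr0 -h.
Qed.

Let lD x y : l (x + y) = l x + l y.
Proof. by have := l_linear 1 x y; rewrite scale1r mul1r. Qed.

Let lsum (J : seq H) (c : H -> R[i]) :
  l (\sum_(e <- J) c e *: e) = \sum_(e <- J) c e * l e.
Proof.
rewrite (big_morph l lD l0); apply: eq_bigr => e _.
by have := l_linear (c e) e 0; rewrite !addr0 l0 addr0.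
Qed.

Lemma functional_le B t x : orthonormal_basis B -> 0 <= t ->
  (forall J : {fset H}, [set` J] `<=` B ->
    \sum_(e <- J) `|l e| ^+ 2 <= t ^+ 2) ->
  `|l x| <= `|x| * t.
Proof.
move=> bB t0 h; have [oB _] := bB; apply/ler_addgt0Pr => a a0.
pose d := a / (`|M| + 1).
have M1 : 0 < `|M| + 1 by rewrite ltr_wpDl.
have d0 : 0 < d by rewrite divr_gt0.
have [J JB hJ] := inner_basis_dense x bB d0.
rewrite -[in leLHS](subrK (fproj J x) x) lD addrC.
rewrite (le_trans (ler_normD _ _))// lerD//.
  pose w := \sum_(e <- J) (l e)^* *: e.
  have -> : l (fproj J x) = inner x w.
    rewrite lsum inner_sumr; apply: eq_bigr => e _.
    by rewrite innerZr conjCK mulrC.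
  rewrite (le_trans (cauchy_schwarz _ _))// ler_wpM2l//.
  rewrite -(@ler_pXn2r _ 2)// ?nnegrE// (norm_fsum oB)//.
  rewrite (le_trans _ (h J JB))//; apply: ler_sum => e _.
  by rewrite norm_conjC.
rewrite (le_trans (l_bound _))//.
apply: (@le_trans _ _ ((`|M| + 1) * `|x - fproj J x|)).
  have [->|xn0] := eqVneq (x - fproj J x) 0; first by rewrite normr0 !mulr0.
  have np : 0 < `|x - fproj J x| by rewrite normr_gt0.
  have M0 : 0 <= M.
    by rewrite -(pmulr_lge0 _ np) (le_trans _ (l_bound _)).
  by rewrite ler_pM2r// ger0_norm// lerDl.
by rewrite -ler_pdivlMl// mulrC ltW.
Qed.

Lemma functional_esum_le B B' : orthonormal_basis B -> orthonormal_basis B' ->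
  (\esum_(e in B) (sqnorm (l e))%:E <= \esum_(e in B') (sqnorm (l e))%:E)%E.
Proof.
move=> [oB _] bB'.
have [->|] := eqVneq (\esum_(e in B') (sqnorm (l e))%:E)%E +oo%E.
  by rewrite leey.
set s := \esum_(e in B') _ => sfin.
have s0 : (0 <= s)%E by apply: esum_ge0 => e _; rewrite lee_fin sqnorm_ge0.
have sE : s = (fine s)%:E by rewrite fineK// ge0_fin_numE// ltey.
rewrite sE; apply: esum_le_fset => J JB; rewrite lee_fin.
pose t : R[i] := (Num.sqrt (fine s))%:C%C.
have t2 : t ^+ 2 = (fine s)%:C%C.
  by rewrite -rmorphXn sqr_sqrtr// fine_ge0.
have t0 : 0 <= t by rewrite ler0c sqrtr_ge0.
pose x := \sum_(e <- J) (l e)^* *: e.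
have lx : l x = `|x| ^+ 2.
  rewrite lsum (norm_fsum oB)//; apply: eq_bigr => e _.
  by rewrite norm_conjC mulrC -normCK.
have : `|l x| <= `|x| * t.
  apply: (functional_le _ bB') => // K KB'.
  by rewrite -sum_sqnormE t2 lecR -lee_fin -sE esum_ge_fset.
rewrite lx ger0_norm ?exprn_ge0// expr2 => h.
have xt : `|x| <= t.
  have [->|xn0] := eqVneq x 0; first by rewrite normr0.
  by rewrite -(ler_pM2l (_ : 0 < `|x|))// normr_gt0.
rewrite -lecR sum_sqnormE -t2.
have -> : \sum_(e <- J) `|l e| ^+ 2 = `|x| ^+ 2.
  by rewrite (norm_fsum oB)//; apply: eq_bigr => e _; rewrite norm_conjC.
by rewrite ler_pXn2r ?nnegrE.
Qed.

End Functional.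
End BasisIndependence.

Section HilbertSchmidt.
Variables (R : realType) (U V : hilbertType R).
Implicit Types (A : U -> V) (B : set U).

Definition bounded_operator A : Prop :=
  linear A /\ exists M : R[i], forall x, `|A x| <= M * `|x|.

Definition hs_sumsq B A : \bar R := \esum_(e in B) (normsq (A e))%:E.

Lemma hs_sumsq_basis A B B' : bounded_operator A ->
  orthonormal_basis B -> orthonormal_basis B' -> hs_sumsq B A = hs_sumsq B' A.
Proof.
move=> [lA [M bA]] bB bB'.
have [D bD] := orthonormal_basis_exists V.
have sw (C : set U) : hs_sumsq C A =
    \esum_(f in D) \esum_(e in C) (sqnorm (inner (A e) f))%:E.
  have ge0 i j : (0 <= (sqnorm (inner (A i) j))%:E)%E.
    by rewrite lee_fin sqnorm_ge0.
  rewrite /hs_sumsq (eq_esum (fun e _ => esym (parseval (A e) bD))).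
  rewrite esum_esum// esum_esum//.
  rewrite (@reindex_esum _ _ _ (D `*`` (fun=> C)) _ (fun x => (x.2, x.1)))//.
  split=> [[x y] [? ?]|[x y] [x' y'] _ _ [-> ->]|[x y] [? ?]]//.
  by exists (y, x).
rewrite !sw; apply: eq_esum => f _; apply/eqP; rewrite eq_le.
have ll a x y : inner (A (a *: x + y)) f = a * inner (A x) f + inner (A y) f.
  by rewrite lA innerDl innerZl.
have lb x : `|inner (A x) f| <= M * `|f| * `|x|.
  rewrite (le_trans (cauchy_schwarz _ _))// mulrAC.
  by rewrite ler_wpM2r.
by rewrite !(functional_esum_le ll lb).
Qed.

End HilbertSchmidt.

Section HilbertSchmidtSpace.
Variables (R : realType) (U V : hilbertType R).
Implicit Types (A : U -> V).

Definition std_basis : set U := xget set0 (@orthonormal_basis R U).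

Lemma std_basisP : orthonormal_basis std_basis.
Proof.
rewrite /std_basis; case: xgetP => [B -> //|h].
by have [B /h] := orthonormal_basis_exists U.
Qed.

(* the sum does not depend on the basis, see hs_sumsq_basis *)
Definition hilbert_schmidt A : Prop :=
  bounded_operator A /\
  exists2 B, orthonormal_basis B & (hs_sumsq B A < +oo)%E.

Lemma hilbert_schmidtP A :
  hilbert_schmidt A <-> bounded_operator A /\ (hs_sumsq std_basis A < +oo)%E.
Proof.
split=> [[bA [B bB]]|[bA hA]]; last first.
  by split=> //; exists std_basis => //; exact: std_basisP.
by rewrite (hs_sumsq_basis bA bB std_basisP).
Qed.

Definition hs_pred : {pred U -> V} := fun A => `[< hilbert_schmidt A >].

Let bounded_addZ a A A' : bounded_operator A -> bounded_operator A' ->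
  bounded_operator (a *: A + A').
Proof.
move=> [lA [M bA]] [lA' [M' bA']]; split.
  have E z : (a *: A + A') z = a *: A z + A' z by [].
  move=> b x y; rewrite !E lA lA' !scalerDr !scalerA.
  by rewrite addrACA (mulrC a b).
exists (`|a| * M + M') => x.
rewrite mulrDl (le_trans (ler_normD _ _))// lerD// normrZ -mulrA.
by rewrite ler_wpM2l.
Qed.

Lemma normsqD (x y : V) :
  normsq (x + y) = normsq x + normsq y + 2 * complex.Re (inner x y).
Proof.
apply: complexI; rewrite !rmorphD rmorphM/= !normsqE -!inner_norm.
rewrite innerDl !innerDr (inner_conj y x).
have -> : (2 : R)%:C%C = 2 by rewrite rmorph_nat.
by rewrite -addcJ -[conjc _]/(_ ^*); ring.
Qed.

Lemma normsqZ (a : R[i]) (x : V) : normsq (a *: x) = sqnorm a * normsq x.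
Proof.
by apply: complexI; rewrite rmorphM/= !normsqE sqnormE normrZ exprMn.
Qed.

Lemma normsqN (x : V) : normsq (- x) = normsq x.
Proof. by rewrite /normsq normrN. Qed.

Lemma normsqD_le (x y : V) : normsq (x + y) <= 2 * normsq x + 2 * normsq y.
Proof.
have := normsq_ge0 (x - y); have := normsqD x (- y); have := normsqD x y.
by rewrite normsqN innerNr raddfN/=; lra.
Qed.

Lemma hs_submod_closed : submod_closed hs_pred.
Proof.
split.
  apply/asboolP/hilbert_schmidtP; split.
    split; last by exists 0 => x; rewrite normr0 mul0r.
    by move=> a x y; rewrite /= scaler0 addr0.
  by rewrite /hs_sumsq esum1// => e _; rewrite normsq0.
move=> a A A' /asboolP/hilbert_schmidtP[bA hA] /asboolP/hilbert_schmidtP[bA' hA'].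
apply/asboolP/hilbert_schmidtP; split; first exact: bounded_addZ.
have c0 : 0 <= 2 * sqnorm a by rewrite mulr_ge0// sqnorm_ge0.
apply: (@le_lt_trans _ _
    (\esum_(e in std_basis) ((2 * sqnorm a * normsq (A e))%:E +
                             (2 * normsq (A' e))%:E)%E)).
  apply: le_esum => e _; rewrite -EFinD lee_fin.
  by rewrite (le_trans (normsqD_le _ _))// normsqZ mulrA.
rewrite esumD; [|by move=> e _; rewrite lee_fin mulr_ge0 ?normsq_ge0..].
rewrite !esumZ//; [|by move=> e; exact: normsq_ge0..].
by rewrite lte_add_pinfty// lte_mul_pinfty.
Qed.

HB.instance Definition _ := GRing.isSubmodClosed.Build _ _ hs_pred
  hs_submod_closed.

Record hs_operator := HSOperator {
  hs_fun :> U -> V ;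
  hs_funP : hs_fun \in hs_pred }.

HB.instance Definition _ := [isSub for hs_fun].
HB.instance Definition _ := gen_eqMixin hs_operator.
HB.instance Definition _ := gen_choiceMixin hs_operator.
HB.instance Definition _ := [SubChoice_isSubLmodule of hs_operator by <:].

Implicit Types (S T W : hs_operator) (c : R).

Lemma hs_funD S T x : (S + T) x = S x + T x. Proof. by []. Qed.

Lemma hs_funN S x : (- S) x = - S x. Proof. by []. Qed.

Lemma hs_funZ (a : R[i]) S x : (a *: S) x = a *: S x. Proof. by []. Qed.

Lemma hs_operatorP S : hilbert_schmidt S.
Proof. by case: S => A /= /asboolP. Qed.

Lemma hs_operator_fin S : (hs_sumsq std_basis S < +oo)%E.
Proof. by have /hilbert_schmidtP[] := hs_operatorP S. Qed.

Lemma hs_operator_linear S : linear S.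
Proof. by have [[]] := hs_operatorP S. Qed.

Definition hs_normsq S : R := fine (hs_sumsq std_basis S).

Lemma hs_sumsq_ge0 B A : (0 <= hs_sumsq B A)%E.
Proof. by apply: esum_ge0 => e _; rewrite lee_fin normsq_ge0. Qed.

Lemma hs_normsqE S : (hs_normsq S)%:E = hs_sumsq std_basis S.
Proof. by rewrite fineK// ge0_fin_numE ?hs_sumsq_ge0 ?hs_operator_fin. Qed.

Lemma hs_normsq_ge0 S : 0 <= hs_normsq S.
Proof. by rewrite fine_ge0// hs_sumsq_ge0. Qed.

Lemma hs_normsq_eq c (X Y Z X' Y' Z' : hs_operator) : 0 <= c ->
  (forall e, normsq (X e) + normsq (Y e) + c * normsq (Z e) =
             normsq (X' e) + normsq (Y' e) + c * normsq (Z' e)) ->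
  hs_normsq X + hs_normsq Y + c * hs_normsq Z =
  hs_normsq X' + hs_normsq Y' + c * hs_normsq Z'.
Proof.
move=> c0 h.
have comb X1 Y1 Z1 : (hs_normsq X1 + hs_normsq Y1 + c * hs_normsq Z1)%:E =
    \esum_(e in std_basis)
      (normsq (X1 e) + normsq (Y1 e) + c * normsq (Z1 e))%:E.
  rewrite !EFinD EFinM !hs_normsqE -esumZ//; last first.
    by move=> e; exact: normsq_ge0.
  rewrite -esumD; [|by move=> e _; rewrite lee_fin normsq_ge0..].
  rewrite -esumD//.
    by move=> e _; rewrite -EFinD lee_fin addr_ge0 ?normsq_ge0.
  by move=> e _; rewrite lee_fin mulr_ge0 ?normsq_ge0.
by apply: EFin_inj; rewrite !comb; apply: eq_esum => e _; rewrite h.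
Qed.

Let aux1 (a b c d e f : R) : a + b + c = d + e + f ->
  a - d = (e - b) + (f - c).
Proof. by lra. Qed.

Let aux2 (a b c d e z : R) : a + z + c * b = d + z + c * e ->
  a - d = c * (e - b).
Proof. by lra. Qed.

Let P S T : R := hs_normsq (S + T) - hs_normsq (S - T).

Lemma hs_normsqN S : hs_normsq (- S) = hs_normsq S.
Proof.
by congr fine; apply: eq_esum => e _; rewrite hs_funN normsqN.
Qed.

Lemma hs_normsqZ (a : R[i]) S : hs_normsq (a *: S) = sqnorm a * hs_normsq S.
Proof.
apply: EFin_inj; rewrite EFinM !hs_normsqE -esumZ ?sqnorm_ge0//; last first.
  by move=> e; exact: normsq_ge0.
by apply: eq_esum => e _; rewrite hs_funZ normsqZ.
Qed.

Let PC S T : P S T = P T S.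
Proof. by rewrite /P (addrC S T) -(hs_normsqN (S - T)) opprB. Qed.

Let PDl S T W : P (S + T) W = P S W + P T W.
Proof.
have := @hs_normsq_eq 1 (S + T + W) (S - W) (T - W) (S + T - W) (S + W) (T + W).
rewrite !mul1r => H.
suff : hs_normsq (S + T + W) + hs_normsq (S - W) + hs_normsq (T - W) =
  hs_normsq (S + T - W) + hs_normsq (S + W) + hs_normsq (T + W).
  exact: aux1.
apply: H => // e.
have -> : (S + T + W) e = S e + T e + W e by [].
have -> : (S + T - W) e = S e + T e - W e by [].
have -> : (S - W) e = S e - W e by [].
have -> : (T - W) e = T e - W e by [].
have -> : (S + W) e = S e + W e by [].
have -> : (T + W) e = T e + W e by [].
rewrite !normsqD !normsqN !innerDl !innerNr !raddfD/= !raddfN/=.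
by ring.
Qed.

Let PNl S T : P (- S) T = - P S T.
Proof.
by rewrite /P opprB -(hs_normsqN (- S + T)) -(hs_normsqN (- S - T)) !opprD
  !opprK.
Qed.

Let PZl c S T : P (c%:C%C *: S) T = c * P S T.
Proof.
wlog c0 : c / 0 <= c => [hw|].
  have [/hw//|c0] := leP 0 c.
  apply: oppr_inj; rewrite -mulNr -hw ?oppr_ge0 ?(ltW c0)//.
  by rewrite rmorphN scaleNr PNl.
have := @hs_normsq_eq c (c%:C%C *: S + T) 0 (S - T) (c%:C%C *: S - T) 0 (S + T).
move=> H.
suff : hs_normsq (c%:C%C *: S + T) + hs_normsq 0 + c * hs_normsq (S - T) =
  hs_normsq (c%:C%C *: S - T) + hs_normsq 0 + c * hs_normsq (S + T).
  exact: aux2.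
apply: H => // e.
have -> : (c%:C%C *: S + T) e = c%:C%C *: S e + T e by [].
have -> : (c%:C%C *: S - T) e = c%:C%C *: S e - T e by [].
have -> : (S - T) e = S e - T e by [].
have -> : (S + T) e = S e + T e by [].
rewrite !normsqD !normsqN !innerNr !innerZl !raddfN/=.
rewrite (_ : complex.Re (c%:C%C * _) = c * complex.Re (inner (S e) (T e))).
  by ring.
by case: (inner _ _) => u v /=; rewrite mul0r subr0.
Qed.

Let normi : sqnorm 'i%C = 1 :> R.
Proof.
by apply: complexI; rewrite sqnormE -add_Re2_Im2/= expr0n expr1n add0r.
Qed.

Let PiNi S T : P ('i%C *: S) T = - P S ('i%C *: T).
Proof.
have h X : hs_normsq ('i%C *: X) = hs_normsq X by rewrite hs_normsqZ normi mul1r.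
rewrite /P -(h (_ + T)) -(h (_ - T)) !scalerDr scalerN scalerA.
by rewrite -expr2 sqr_i scaleN1r -/(P (- S) ('i%C *: T)) PNl.
Qed.

(* The inner product \sum_(e in B) inner (S e) (T e), obtained from the norm by
   polarization *)
Definition hs_inner S T : R[i] :=
  ((hs_normsq (S + T) - hs_normsq (S - T)) / 4 +i*
   ((hs_normsq (S + 'i%C *: T) - hs_normsq (S - 'i%C *: T)) / 4))%C.

Let hs_innerE S T : hs_inner S T = (P S T / 4 +i* (P S ('i%C *: T) / 4))%C.
Proof. by []. Qed.

Lemma hs_inner_linear T (a : R[i]) S W :
  hs_inner (a *: S + W) T = a * hs_inner S T + hs_inner W T.
Proof.
have aE : a *: S = (complex.Re a)%:C%C *: S + (complex.Im a)%:C%C *: ('i%C *: S).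
  by rewrite [in LHS](complexE a) scalerDl scalerA (mulrC 'i%C).
rewrite !hs_innerE aE !PDl !PZl !PiNi.
rewrite scalerA -expr2 sqr_i scaleN1r (PC S (- T)) PNl (PC T).
move: (P S T) (P S ('i%C *: T)) (P W T) (P W _) => p q r s.
case: a {aE} => u v; apply/eqP; rewrite eq_complex/=; apply/andP; split; apply/eqP.
  by field.
by field.
Qed.

Lemma hs_inner_conj S T : hs_inner S T = (hs_inner T S)^*.
Proof.
rewrite !hs_innerE (PC T S) (PC T) PiNi.
move: (P S T) (P S ('i%C *: T)) => p q.
by rewrite -[RHS]/((p / 4 +i* (- q / 4))^*)%C/= mulNr opprK.
Qed.

Lemma hs_inner_normsq S : hs_inner S S = (hs_normsq S)%:C%C.
Proof.
rewrite hs_innerE; have -> : P S ('i%C *: S) = 0.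
  have := PiNi S S; rewrite (PC _ S); move: (P _ _) => p.
  by lra.
have -> : P S S = 4 * hs_normsq S.
  have E : hs_normsq 0 = 0 by rewrite -(scale0r S) hs_normsqZ /sqnorm normr0 expr0n mul0r.
  rewrite /P subrr E subr0 -mulr2n -scaler_nat hs_normsqZ; congr (_ * _).
  apply: complexI; rewrite sqnormE ger0_norm ?ler0n// -natrX.
  by rewrite rmorph_nat.
by rewrite mulrC mulKf// mul0r.
Qed.

Lemma hs_inner_ge0 S : 0 <= hs_inner S S.
Proof. by rewrite hs_inner_normsq ler0c hs_normsq_ge0. Qed.

Lemma hs_apply_le S (x : U) :
  `|S x| <= (Num.sqrt (hs_normsq S))%:C%C * `|x|.
Proof.
have [[lS [M bS]] _] := hs_operatorP S.
have [->|Sx0] := eqVneq (S x) 0.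
  by rewrite normr0 mulr_ge0// ler0c sqrtr_ge0.
have np : 0 < `|S x| by rewrite normr_gt0.
rewrite -(ler_pM2r np) -expr2 -inner_norm.
pose l z := inner (S z) (S x).
have ll a y z : l (a *: y + z) = a * l y + l z.
  by rewrite /l lS innerDl innerZl.
have lb y : `|l y| <= M * `|S x| * `|y|.
  by rewrite (le_trans (cauchy_schwarz _ _))// mulrAC ler_wpM2r.
have := @functional_le _ _ l ll _ lb std_basis
  ((Num.sqrt (hs_normsq S))%:C%C * `|S x|) x std_basisP.
rewrite ger0_norm ?inner_ge0// mulrCA mulrA; apply.
  by rewrite mulr_ge0// ler0c sqrtr_ge0.
move=> J JB; apply: (@le_trans _ _ (\sum_(e <- J) `|S e| ^+ 2 * `|S x| ^+ 2)).
  apply: ler_sum => e _; rewrite -exprMn ler_pXn2r ?nnegrE ?mulr_ge0//.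
  exact: cauchy_schwarz.
rewrite -mulr_suml exprMn ler_wpM2r ?exprn_ge0//.
rewrite -rmorphXn sqr_sqrtr ?hs_normsq_ge0//.
rewrite (eq_bigr (fun e => (normsq (S e))%:C%C)); last first.
  by move=> e _; rewrite normsqE.
by rewrite -rmorph_sum lecR -lee_fin hs_normsqE esum_ge_fset.
Qed.

Lemma hs_inner_eq0 S : hs_inner S S = 0 -> S = 0.
Proof.
rewrite hs_inner_normsq => /complexI S0; apply: val_inj; apply/funext => x /=.
by apply/eqP; rewrite -normr_le0 (le_trans (hs_apply_le S x))// S0 sqrtr0 mul0r.
Qed.

Definition hs_norm : hs_operator -> R[i] := ip_norm hs_inner.

Lemma hs_normE S : hs_norm S = (Num.sqrt (hs_normsq S))%:C%C.
Proof.
apply/eqP; rewrite -(@eqrXn2 _ 2)//.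
- by rewrite sqrtCK hs_inner_normsq -rmorphXn sqr_sqrtr// hs_normsq_ge0.
- by rewrite sqrtC_ge0 hs_inner_ge0.
- by rewrite ler0c sqrtr_ge0.
Qed.

Lemma hs_normD S T : hs_norm (S + T) <= hs_norm S + hs_norm T.
Proof.
exact: (ip_normD hs_inner_linear hs_inner_conj hs_inner_ge0 hs_inner_eq0).
Qed.

Lemma hs_normZ (a : R[i]) S : hs_norm (a *: S) = `|a| * hs_norm S.
Proof. exact: (ip_normZ hs_inner_linear hs_inner_conj). Qed.

Lemma hs_norm_eq0 S : hs_norm S = 0 -> S = 0.
Proof. exact: (ip_norm_eq0 hs_inner_eq0). Qed.

HB.instance Definition _ := @Lmodule_isNormed.Build R[i] hs_operator
  hs_norm hs_normD hs_normZ hs_norm_eq0.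

Lemma hs_norm_apply S x : `|S x| <= `|S| * `|x|.
Proof. by rewrite -[ `|S| ]/(hs_norm S) hs_normE hs_apply_le. Qed.

Lemma hs_norm_le S (r : R) : 0 <= r ->
  (forall J : {fset U}, [set` J] `<=` std_basis ->
     \sum_(e <- J) normsq (S e) <= r ^+ 2) -> `|S| <= r%:C%C.
Proof.
move=> r0 h; rewrite -[ `|S| ]/(hs_norm S) hs_normE lecR.
rewrite -(@ler_pXn2r _ 2) ?nnegrE ?sqrtr_ge0// sqr_sqrtr ?hs_normsq_ge0//.
by rewrite -lee_fin hs_normsqE esum_le_fset.
Qed.

Lemma hs_sum_le S (J : {fset U}) : [set` J] `<=` std_basis ->
  (\sum_(e <- J) normsq (S e))%:C%C <= `|S| ^+ 2.
Proof.
move=> JB; rewrite -[ `|S| ]/(hs_norm S) hs_normE -rmorphXn lecR.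
by rewrite sqr_sqrtr ?hs_normsq_ge0// -lee_fin hs_normsqE esum_ge_fset.
Qed.

End HilbertSchmidtSpace.

Section HilbertSchmidtComplete.
Variables (R : realType) (U V : hilbertType R).
Notation hs := (hs_operator U V).

Lemma hs_complete (F : set_system hs) : ProperFilter F -> cauchy F -> cvg F.
Proof.
move=> FF cF.
have hex (r : R[i]) : 0 < r -> exists A0 : hs, F [set A : hs | `|A0 - A| < r].
  move=> r0; have /cauchyP/(_ _ r0)[A0] := cF.
  by rewrite -ball_normE; exists A0.
have hcv (x : U) : cvg ((fun A : hs => A x) @ F).
  apply/cauchy_cvgP/cauchyP => r r0.
  have x1 : 0 < `|x| + 1 by rewrite ltr_wpDl.
  have [A0 FA0] := hex _ (divr_gt0 r0 x1).
  exists (A0 x); rewrite -ball_normE.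
  suff : F [set A : hs | `|A0 x - A x| < r] by [].
  apply: filterS FA0 => A /= hA; rewrite -hs_funN -hs_funD (le_lt_trans (hs_norm_apply _ _))//.
  apply: (@le_lt_trans _ _ (`|A0 - A| * (`|x| + 1))).
    by rewrite ler_wpM2l// lerDl.
  by rewrite -ltr_pdivlMr.
pose L (x : U) : V := lim ((fun A : hs => A x) @ F).
have hL x (r : R[i]) : 0 < r -> F [set A : hs | `|L x - A x| < r].
  by move=> r0; have /cvgrPdist_lt/(_ _ r0) := hcv x.
have lL : linear L.
  move=> a x y; apply/eqP; rewrite -subr_eq0 -normr_le0; apply/ler_addgt0Pr => r r0.
  have a1 : 0 < `|a| + 2 by rewrite ltr_wpDl.
  have d0 := divr_gt0 r0 a1; set d := r / _ in d0.
  have [A [[/= h1 h2] h3]] := filter_ex (filterI (filterI (hL (a *: x + y) _ d0)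
    (hL x _ d0)) (hL y _ d0)).
  have -> : L (a *: x + y) - (a *: L x + L y) =
      (L (a *: x + y) - A (a *: x + y)) - (a *: (L x - A x) + (L y - A y)).
    rewrite hs_operator_linear scalerBr.
    by rewrite [X in _ = _ - X]addrACA -opprD opprB addrA subrK.
  rewrite add0r (le_trans (ler_normB _ _))//.
  have -> : r = d + (`|a| * d + d).
    have -> : r = (`|a| + 2) * d by rewrite mulrC divfK// gt_eqF.
    by ring.
  rewrite lerD ?(ltW h1)// (le_trans (ler_normD _ _))// lerD ?(ltW h3)//.
  by rewrite normrZ ler_wpM2l// ltW.
have hseq (s : seq U) (r : R[i]) : 0 < r ->
    F [set A : hs | forall e, e \in s -> `|L e - A e| < r].
  move=> r0; elim: s => [|x s IH]; first by apply: filterS filterT.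
  apply: filterS (filterI (hL x _ r0) IH) => A /= [hx hs'] e.
  by rewrite in_cons => /orP[/eqP->|/hs'].
have key (A0 : hs) (r : R) (J : {fset U}) : 0 < r ->
    F [set A : hs | `|A0 - A| < r%:C%C] -> [set` J] `<=` @std_basis R U ->
    \sum_(e <- J) normsq (L e - A0 e) <= (2 * r) ^+ 2.
  move=> r0 FA0 JB; pose n : R := (size J)%:R + 1.
  have n0 : 0 < n by rewrite ltr_wpDl.
  have rn : 0 < (r / n)%:C%C by rewrite ltcR divr_gt0.
  have [A [/= h1 h2]] := filter_ex (filterI FA0 (hseq J _ rn)).
  have s1 : \sum_(e <- J) normsq (L e - A e) <= r ^+ 2.
    apply: (@le_trans _ _ (\sum_(e <- J) (r / n) ^+ 2)).
      rewrite big_seq [leRHS]big_seq; apply: ler_sum => e /h2 he.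
      by rewrite -lecR normsqE rmorphXn ler_pXn2r ?nnegrE// ltW.
    rewrite big_const_seq count_predT iter_addr_0 -mulr_natl.
    rewrite exprMn mulrCA ler_piMr ?sqr_ge0// exprVn ler_pdivrMr ?exprn_gt0//.
    rewrite mul1r expr2 (@le_trans _ _ n)//; first by rewrite lerDl.
    by rewrite ler_peMr ?(ltW n0)// lerDr.
  have s2 : \sum_(e <- J) normsq (A e - A0 e) <= r ^+ 2.
    rewrite -lecR (le_trans (hs_sum_le (A - A0) JB))//.
    by rewrite rmorphXn ler_pXn2r ?nnegrE ?ler0c ?(ltW r0)// distrC ltW.
  have -> : (2 * r) ^+ 2 = 2 * r ^+ 2 + 2 * r ^+ 2 by ring.
  apply: (@le_trans _ _ (\sum_(e <- J) (2 * normsq (L e - A e) +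
                                        2 * normsq (A e - A0 e)))).
    apply: ler_sum => e _; apply: le_trans (normsqD_le _ _).
    by rewrite addrA subrK.
  by rewrite big_split/= -!mulr_sumr lerD// ler_wpM2l.
have [A1 FA1] := hex 1 ltr01.
have bL : bounded_operator (L - A1 : U -> V).
  have E x : (L - A1 : U -> V) x = L x - A1 x by [].
  split.
    move=> a x y; rewrite !E lL hs_operator_linear.
    by rewrite scalerBr opprD addrACA.
  exists 2 => x; rewrite E.
  have [x0|xn0] := eqVneq x 0.
    have L0 : L 0 = 0.
      by have := lL (-1) 0 0; rewrite scaleN1r oppr0 addr0 scaleN1r addNr.
    have A0 : A1 0 = 0.
      have := hs_operator_linear A1 (-1) 0 0.
      by rewrite scaleN1r oppr0 addr0 scaleN1r addNr.
    by rewrite x0 L0 A0 subr0 !normr0 mulr0.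
  have x0 : 0 < `|x| by rewrite normr_gt0.
  have [A [/= h1 h2]] := filter_ex (filterI FA1 (hL x _ x0)).
  rewrite (le_trans (ler_distD (A x) _ _))// mulr_natl mulr2n lerD ?(ltW h2)//.
  rewrite -hs_funN -hs_funD (le_trans (hs_norm_apply _ _))//.
  by rewrite -[leRHS]mul1r ler_wpM2r// distrC ltW.
have hD : (L - A1 : U -> V) \in @hs_pred R U V.
  apply/asboolP/hilbert_schmidtP; split=> //.
  apply: (@le_lt_trans _ _ ((2 * 1 : R) ^+ 2)%:E); last exact: ltry.
  by apply: esum_le_fset => J JB; rewrite lee_fin; exact: key.
pose S : hs := HSOperator hD + A1.
have SE x : S x = L x by rewrite hs_funD/= subrK.
suff : F --> S by move=> h; apply/cvg_ex; exists S.
apply/cvgrPdist_lt => r r0.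
pose d := complex.Re r / 4.
have rE : (complex.Re r)%:C%C = r by rewrite RRe_real// gtr0_real.
have d0 : 0 < d by rewrite divr_gt0// -ltcR rE.
have [A0 FA0] := hex d%:C%C (etrans (ltcR 0 d) d0).
have SA0 : `|S - A0| <= (2 * d)%:C%C.
  apply: hs_norm_le; first by rewrite mulr_ge0// ltW.
  move=> J JB; apply: le_trans (key A0 d J d0 FA0 JB).
  by apply: ler_sum => e _; rewrite hs_funD hs_funN SE.
apply: filterS FA0 => A /= hA.
rewrite (le_lt_trans (ler_distD A0 _ _))//.
apply: lt_le_trans (ler_ltD SA0 hA) _.
rewrite -rmorphD -rE lecR.
have -> : complex.Re r = 4 * d by rewrite mulrC divfK.
by lra.
Qed.

HB.instance Definition _ := Uniform_isComplete.Build hs hs_complete.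

Lemma hs_inner_norm (S : hs) : hs_inner S S = `|S| ^+ 2.
Proof. by rewrite -[ `|S| ]/(hs_norm S) sqrtCK. Qed.

HB.instance Definition _ := isHilbert.Build R hs
  (fun T a S W => hs_inner_linear T a S W) (@hs_inner_conj R U V) hs_inner_norm.

End HilbertSchmidtComplete.


Definition hs_of (R : realType) (U V : hilbertType R) (A : U -> V)
  (hA : hilbert_schmidt A) : hs_operator U V := HSOperator (asboolT hA).

Section Dilation.
Variables (R : realType) (H K : hilbertType R).

Definition contraction_operator (T : H -> H) : Prop :=
  linear T /\ forall x, `|T x| <= `|x|.

Definition unitary_operator (U : H -> H) : Prop :=
  [/\ linear U, forall x, `|U x| = `|x| & forall y, exists x, U x = y].

(* K contains H by means of an isometric embedding J *)
Definition isometric_embedding (J : H -> K) : Prop :=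
  linear J /\ forall x, `|J x| = `|x|.

(* B = P_H A | H : J (B x) is the orthogonal projection of A (J x) on J (H) *)
Definition compression (J : H -> K) (A : K -> K) (B : H -> H) : Prop :=
  forall x y, inner (A (J x) - J (B x)) (J y) = 0.

End Dilation.

Definition unitary_dilation (R : realType) (H K : hilbertType R)
    (T : H -> H) (J : H -> K) (U : K -> K) : Prop :=
  [/\ isometric_embedding J, unitary_operator U
    & forall n, compression J (iter n U) (iter n T)].

Section SemiSpectralMeasure.
Variables (d : measure_display) (X : measurableType d) (R : realType).

Definition semispectral_measure (H : hilbertType R) (E : set X -> H -> H)
    : Prop :=
  [/\ forall D, measurable D ->
        bounded_operator (E D) /\ forall x, 0 <= inner (E D x) x,
      E set0 = 0,
      E setT = id
    & forall D : (set X)^nat, (forall n, measurable (D n)) ->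
        trivIset setT D -> forall x y,
        (fun n => \sum_(k < n) inner (E (D k) x) y : R[i]^o) @ \oo -->
          (inner (E (\bigcup_n D n) x) y : R[i]^o)].

(* a positive idempotent is an orthogonal projection *)
Definition spectral_measure (H : hilbertType R) (E : set X -> H -> H) : Prop :=
  semispectral_measure E /\
  forall D, measurable D -> E D \o E D = E D.

Definition spectral_dilation (H K : hilbertType R)
    (E : set X -> H -> H) (J : H -> K) (F : set X -> K -> K) : Prop :=
  [/\ isometric_embedding J, spectral_measure F
    & forall D, measurable D -> compression J (F D) (E D)].

(* A is the limit in operator norm of integrals of simple functions that
   converge uniformly to f *)
Definition is_spectral_integral (K : hilbertType R) (F : set X -> K -> K)
    (f : X -> R[i]) (A : K -> K) : Prop :=
  forall eps : R[i], 0 < eps ->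
  exists n (D : 'I_n -> set X) (c : 'I_n -> R[i]),
    [/\ forall i, measurable (D i),
        trivIset setT D,
        forall t, exists i, D i t,
        forall i t, D i t -> `|f t - c i| <= eps
      & forall v, `|A v - \sum_(i < n) c i *: F (D i) v| <= eps * `|v|].

Definition is_semispectral_integral (H : hilbertType R) (E : set X -> H -> H)
    (f : X -> R[i]) (A : H -> H) : Prop :=
  exists (K : hilbertType R) (J : H -> K) (F : set X -> K -> K) (B : K -> K),
    [/\ spectral_dilation E J F, is_spectral_integral F f B
      & compression J B A].

(* the zero operator when there is no integral *)
Definition semispectral_integral (H : hilbertType R) (E : set X -> H -> H)
    (f : X -> R[i]) : H -> H :=
  xget 0 [set A | is_semispectral_integral E f A].

End SemiSpectralMeasure.

Section DoubleOperatorIntegral.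
Variables (d1 d2 : measure_display).
Variables (X1 : measurableType d1) (X2 : measurableType d2).
Variables (R : realType) (H1 H2 : hilbertType R).
Variables (E1 : set X1 -> H1 -> H1) (E2 : set X2 -> H2 -> H2).

Definition is_product_measure
    (F : set (X1 * X2) -> hs_operator H2 H1 -> hs_operator H2 H1) : Prop :=
  semispectral_measure F /\
  forall D1 D2, measurable D1 -> measurable D2 -> forall Q x,
    F (D1 `*` D2) Q x = E1 D1 (Q (E2 D2 x)).

Definition product_measure :
    set (X1 * X2) -> hs_operator H2 H1 -> hs_operator H2 H1 :=
  xget (fun=> 0) [set F | is_product_measure F].

Definition double_operator_integral (Phi : X1 * X2 -> R[i])
    (Q : hs_operator H2 H1) : hs_operator H2 H1 :=
  semispectral_integral product_measure Phi Q.

End DoubleOperatorIntegral.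

Section Circle.
Variable R : realType.

Definition circle : Type := {z : R[i] | `|z| == 1}.

HB.instance Definition _ := Choice.on circle.

Lemma circle1_subproof : `|1 : R[i]| == 1.
Proof. by rewrite normr1. Qed.

HB.instance Definition _ := isPointed.Build circle (exist _ 1 circle1_subproof).

Definition circle_val (z : circle) : R[i] := sval z.

Definition circle_open : set (set circle) :=
  [set circle_val @^-1` A | A in (@open R[i]^o : set (set R[i]))].

Definition borel_circle := g_sigma_algebraType circle_open.

Definition divided_difference (f : R[i] -> R[i]) (p : borel_circle * borel_circle)
    : R[i] :=
  let z := circle_val p.1 in let t := circle_val p.2 in
  if z == t then 0 else (f z - f t) / (z - t).

Definition is_semispectral_measure_of (H : hilbertType R) (T : H -> H)
    (E : set borel_circle -> H -> H) : Prop :=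
  exists (K : hilbertType R) (J : H -> K) (U : K -> K)
    (F : set borel_circle -> K -> K),
    [/\ unitary_dilation T J U, spectral_measure F,
        is_spectral_integral F circle_val U
      & forall D, measurable D -> compression J (F D) (E D)].

End Circle.

Section Disk.
Variable R : realType.
Implicit Types f : R[i]^o -> R[i]^o.

Definition unit_disk : set R[i]^o := [set z | `|z| < 1].

Definition analytic_on_disk f : Prop :=
  forall z, unit_disk z -> derivable f z 1.

Definition Hinfty f : Prop :=
  analytic_on_disk f /\
  exists M : R[i], forall z, unit_disk z -> `|f z| <= M.

(* For f in the disk-algebra this is f in the open disk and gives the boundary
   values of f on the circle; it is unspecified outside the closed disk *)
Definition closed_disk_extension f (z : R[i]^o) : R[i]^o :=
  lim (f @ within unit_disk (nbhs z)).

Definition poly_operator (H : hilbertType R) (p : {poly R[i]}) (T : H -> H)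
    (x : H) : H := \sum_(i < size p) p`_i *: iter i T x.

Definition is_disk_calculus (H : hilbertType R) (f : R[i] -> R[i]) (T : H -> H)
    (A : H -> H) : Prop :=
  exists p : nat -> {poly R[i]},
    (forall eps : R[i], 0 < eps -> \forall n \near \oo,
       forall z, `|z| <= 1 -> `|(p n).[z] - f z| <= eps) /\
    (forall eps : R[i], 0 < eps -> \forall n \near \oo,
       forall x, `|poly_operator (p n) T x - A x| <= eps * `|x|).

Definition disk_calculus (H : hilbertType R) (f : R[i] -> R[i]) (T : H -> H)
    : H -> H := xget 0 [set A | is_disk_calculus f T A].

End Disk.

(* Main.v *)
(* Let f be the boundary extension of phi and L a bound of |phi'|. The Fejer means of the Taylor
   series of phi, taken on slightly smaller disks, are polynomials p_n that converge to f uniformly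
   on the closed disk and are all L-Lipschitz there. No integration is used: Taylor coefficients are
   ultralimits of averages over the roots of unity of order 2^j, and they are monomials in z because
   they solve the Euler equation z h' = n h.

   Unitary dilations of T and S on K1 and K2 have spectral measures F1 and F2. Their product F, a
   spectral measure on the Hilbert-Schmidt operators from K2 to K1, is the limit of the sums
   Q |-> sum_i F1(D^{t_i}) Q F2(C_i) over tagged partitions (C_i) of the second circle, D^t being
   the section of D at t; it dilates the product of the semi-spectral measures of T and S.

   For a polynomial p the integral of (p(z) - p(t)) / (z - t), extended by p' to the diagonal, is
   p(T) - p(S) by telescoping T^n - S^n. The diagonal contributes nothing: on rank one operators F
   lives there on the atoms (t, t) only, and E_T{t} (T - S) E_S{t} = 0, because the mean ergodic
   theorem gives E_T{t} T = t E_T{t} and S E_S{t} = t E_S{t}. So the diagonal values may be replaced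
   by 0. The quotients for p_n are bounded by L and converge to Phi uniformly off the sets
   0 < |z - t| < del, whose spectral projections tend strongly to 0 with del. *)

Require Import Defs.
From HB Require Import structures.
From mathcomp Require Import all_boot all_order all_algebra.
From mathcomp Require Import all_classical all_reals all_analysis.
From mathcomp Require Import finmap complex.
From mathcomp Require Import ring lra measurable_realfun.

Set Implicit Arguments.
Unset Strict Implicit.
Unset Printing Implicit Defensive.

Import Order.TTheory GRing.Theory Num.Theory.
Import numFieldNormedType.Exports.

Local Open Scope classical_set_scope.
Local Open Scope ring_scope.

(** * Real-valued norms and ultralimits *)

(** The quotients cannot be expected to converge uniformly: [phi'] need not extend continuously to
    the circle, and then the quotient does not extend continuously to the diagonal. Only bounded
    convergence, uniform away from a small set, is available, so the approximants must share one
    Lipschitz constant. Taylor partial sums need not; Fejer means do, their kernel being positive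
    with average 1. The value 0 on the diagonal is not a limit of nearby values, so the projection
    of the diagonal needs an argument of its own. It need not vanish, and E_T{t} need not be a
    projection; it disappears only after compression and only against T - S. In the construction of
    F the obstacle is countable additivity. On rank one operators it reduces to scalar functions of
    t integrated against F2. Weak limits of projections are a priori only positive contractions, so
    idempotence is proved afterwards, again on rank one operators, and self-adjointness carries it
    to all operators. Ultralimits take the place of subsequences, and the order 2^j is chosen
    because such roots of unity come from square roots alone. *)

Section RealNorm.
Variable R : realType.

(** The norm takes values in [R[i]], whose order is only partial; [cabs], and [rn] for vectors, are
    the same norms as elements of [R]. *)
Definition cabs (z : R[i]) : R := complex.Re `|z|.

Lemma cabsE z : (cabs z)%:C%C = `|z|.
Proof. by apply: RRe_real; rewrite ger0_real. Qed.

Lemma cabs_ge0 z : 0 <= cabs z.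
Proof. by rewrite -ler0c cabsE. Qed.

Lemma cabs0 : cabs 0 = 0.
Proof. by rewrite /cabs normr0. Qed.

Lemma cabs1 : cabs 1 = 1.
Proof. by rewrite /cabs normr1. Qed.

Lemma cabs_eq0 z : cabs z = 0 -> z = 0.
Proof. by move=> z0; apply/eqP; rewrite -normr_eq0 -cabsE z0. Qed.

Lemma cabs_gt0 z : (0 < cabs z) = (z != 0).
Proof.
rewrite lt_neqAle cabs_ge0 andbT eq_sym; congr negb.
by apply/eqP/eqP => [/cabs_eq0|->]; rewrite ?cabs0.
Qed.

Lemma cabsN z : cabs (- z) = cabs z.
Proof. by rewrite /cabs normrN. Qed.

Lemma cabsC z w : cabs (z - w) = cabs (w - z).
Proof. by rewrite /cabs distrC. Qed.

Lemma cabsM z w : cabs (z * w) = cabs z * cabs w.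
Proof. by apply: complexI; rewrite rmorphM/= !cabsE normrM. Qed.

Lemma cabsX z n : cabs (z ^+ n) = cabs z ^+ n.
Proof. by apply: complexI; rewrite rmorphXn/= !cabsE normrX. Qed.

Lemma cabsV z : cabs z^-1 = (cabs z)^-1.
Proof. by apply: complexI; rewrite cabsE fmorphV/= cabsE normfV. Qed.

Lemma cabsD z w : cabs (z + w) <= cabs z + cabs w.
Proof. by rewrite -lecR rmorphD/= !cabsE ler_normD. Qed.

Lemma cabsB z w : cabs (z - w) <= cabs z + cabs w.
Proof. by rewrite (le_trans (cabsD _ _))// cabsN. Qed.

Lemma cabs_dist v z w : cabs (z - w) <= cabs (z - v) + cabs (v - w).
Proof. by rewrite -lecR rmorphD/= !cabsE ler_distD. Qed.

Lemma cabs_real (r : R) : cabs r%:C%C = `|r|.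
Proof. by apply: complexI; rewrite cabsE normc_def/= expr0n/= addr0 sqrtr_sqr. Qed.

Lemma cabs_nat n : cabs n%:R = n%:R.
Proof. by rewrite -(rmorph_nat (real_complex R)) cabs_real ger0_norm. Qed.

Lemma cabs_conj z : cabs z^* = cabs z.
Proof. by rewrite /cabs norm_conjC. Qed.

Lemma cabs_sum (I : Type) (r : seq I) (P : pred I) (F : I -> R[i]) :
  cabs (\sum_(i <- r | P i) F i) <= \sum_(i <- r | P i) cabs (F i).
Proof.
by rewrite -lecR cabsE rmorph_sum/= (eq_bigr _ (fun i _ => cabsE (F i))) ler_norm_sum.
Qed.

Lemma cabs_sqr z : (cabs z ^+ 2)%:C%C = z * z^*.
Proof. by rewrite rmorphXn/= cabsE normCK. Qed.

Lemma Re_le_cabs z : `|complex.Re z| <= cabs z.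
Proof. by rewrite -lecR cabsE; exact: normc_ge_Re. Qed.

Lemma Im_le_cabs z : `|complex.Im z| <= cabs z.
Proof.
have := Re_le_cabs (z * 'i%C); rewrite ReiNIm normrN cabsM.
suff -> : cabs 'i%C = 1 :> R by rewrite mulr1.
apply/eqP; rewrite -(@eqrXn2 _ 2)// ?cabs_ge0// expr1n; apply/eqP/complexI.
by rewrite cabs_sqr complexiE conjCi mulrN -expr2 sqrCi opprK.
Qed.

Lemma cabs_le z : cabs z <= `|complex.Re z| + `|complex.Im z|.
Proof.
rewrite [in leLHS](complexE z) (le_trans (cabsD _ _))// cabsM !cabs_real.
suff -> : cabs 'i%C = 1 :> R by rewrite mul1r.
apply/eqP; rewrite -(@eqrXn2 _ 2)// ?cabs_ge0// expr1n; apply/eqP/complexI.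
by rewrite cabs_sqr complexiE conjCi mulrN -expr2 sqrCi opprK.
Qed.

(** In the order of [R[i]] positive numbers are real, so every epsilon of a limit over [R[i]] may be
    taken in [R]. *)
Lemma posC_ex (e : R[i]) : 0 < e -> exists2 r : R, 0 < r & e = r%:C%C.
Proof.
move=> e0; have E : (complex.Re e)%:C%C = e by rewrite RRe_real// gtr0_real.
by exists (complex.Re e); rewrite // -ltcR E.
Qed.

Lemma eq_cabs_small (z w : R[i]) : (forall e : R, 0 < e -> cabs (z - w) <= e) -> z = w.
Proof.
move=> h; apply/eqP; rewrite -subr_eq0; apply/eqP/cabs_eq0/eqP.
by rewrite eq_le cabs_ge0 andbT; apply/ler_addgt0Pr => e /h; rewrite add0r.
Qed.

Section Normed.
Variable V : normedModType R[i].
Implicit Types x y z : V.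

Definition rn x : R := complex.Re `|x|.

Lemma rnE x : (rn x)%:C%C = `|x|.
Proof. by apply: RRe_real; rewrite ger0_real. Qed.

Lemma rn_ge0 x : 0 <= rn x.
Proof. by rewrite -ler0c rnE. Qed.

Lemma rn0 : rn 0 = 0.
Proof. by rewrite /rn normr0. Qed.

Lemma rnN x : rn (- x) = rn x.
Proof. by rewrite /rn normrN. Qed.

Lemma rn_eq0 x : rn x = 0 -> x = 0.
Proof. by move=> x0; apply/eqP; rewrite -normr_eq0 -rnE x0. Qed.

Lemma rnC x y : rn (x - y) = rn (y - x).
Proof. by rewrite -rnN opprB. Qed.

Lemma rnZ a x : rn (a *: x) = cabs a * rn x.
Proof. by apply: complexI; rewrite rmorphM/= cabsE !rnE normrZ. Qed.

Lemma rnD x y : rn (x + y) <= rn x + rn y.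
Proof. by rewrite -lecR rmorphD/= !rnE ler_normD. Qed.

Lemma rnB x y : rn (x - y) <= rn x + rn y.
Proof. by rewrite (le_trans (rnD _ _))// rnN. Qed.

Lemma rn_dist y x z : rn (x - z) <= rn (x - y) + rn (y - z).
Proof. by rewrite -lecR rmorphD/= !rnE ler_distD. Qed.

Lemma eq_rn_small x y : (forall e : R, 0 < e -> rn (x - y) <= e) -> x = y.
Proof.
move=> h; apply/eqP; rewrite -subr_eq0; apply/eqP/rn_eq0/eqP.
by rewrite eq_le rn_ge0 andbT; apply/ler_addgt0Pr => e /h; rewrite add0r.
Qed.

Lemma cvg_rnP (T : Type) (F : set_system T) {FF : Filter F} (u : T -> V) (l : V) :
  u @ F --> l <-> forall e : R, 0 < e -> F [set t | rn (l - u t) < e].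
Proof.
split.
  move=> /cvgrPdist_lt h e e0; have /h : 0 < e%:C%C by rewrite ltcR.
  by apply: filterS => t /=; rewrite -rnE ltcR.
move=> h; apply/cvgrPdist_lt => _ /posC_ex[e e0 ->].
by have := h e e0; apply: filterS => t /=; rewrite -rnE ltcR.
Qed.

End Normed.

Lemma cvg_cabsP (T : Type) (F : set_system T) {FF : Filter F} (u : T -> R[i]^o) (l : R[i]^o) :
  u @ F --> l <-> forall e : R, 0 < e -> F [set t | cabs (l - u t) < e].
Proof. exact: cvg_rnP. Qed.

Lemma complete_seq (V : completeNormedModType R[i]) (u : nat -> V) :
  (forall e : R, 0 < e -> exists N, forall n m, (N <= n)%N -> (N <= m)%N -> rn (u n - u m) <= e) ->
  exists l, forall e : R, 0 < e -> exists N, forall n, (N <= n)%N -> rn (l - u n) <= e.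
Proof.
move=> h; have cu : cvg (u @ \oo).
  apply/cauchy_cvgP/cauchy_ballP => a /posC_ex[e e0 ->]; near_simpl.
  have e2 : 0 < e / 2 by rewrite divr_gt0.
  have [N hN] := h _ e2.
  exists ([set n | (N <= n)%N], [set n | (N <= n)%N]) => /=.
    by split; exists N.
  move=> [n m] /= [Nn Nm]; rewrite -ball_normE/= -rnE ltcR.
  by rewrite (le_lt_trans (hN _ _ Nn Nm))// ltr_pdivrMr// ltr_pMr// ltr1n.
exists (lim (u @ \oo)) => e e0.
have /cvg_rnP/(_ _ e0)[N _ hN] : u @ \oo --> lim (u @ \oo) by exact: cu.
by exists N => n /hN/= /ltW.
Qed.

Section UltraLimit.
Variables (I : Type) (F : set_system I).
Hypothesis UF : UltraFilter F.

(** The image of [F] under [u] is an ultrafilter on the compact segment from [- M] to [M], so it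
    converges. *)
Lemma ultra_lim_real (u : I -> R) (M : R) : (forall i, `|u i| <= M) ->
  exists l, forall e : R, 0 < e -> F [set i | `|l - u i| < e].
Proof.
move=> uM; have PF : ProperFilter F := @ultra_proper _ F UF.
have UuF : UltraFilter (u @ F).
  split; first exact: fmap_proper_filter.
  move=> G PG FG; rewrite predeqE => A; split=> [GA|]; last exact: FG.
  have [//|FnA] := in_ultra_setVsetC (u @^-1` A) UF.
  have GnA : G (~` A) by exact: FG.
  have FG' : Filter G := @filter_filter _ _ PG.
  by have [? []] := @filter_ex _ _ PG _ (filterI GA GnA).
have := @segment_compact R (- M) M; rewrite compact_ultra => /(_ _ UuF).
case.
  apply: (@filterS _ F _ setT); last exact: filterT.
  by move=> i _ /=; rewrite in_itv/= -ler_norml.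
move=> l [_ ul]; exists l => e e0.
by move: ul => /cvgrPdist_lt/(_ _ e0).
Qed.

Lemma ultra_lim (u : I -> R[i]) (M : R) : (forall i, cabs (u i) <= M) ->
  exists l : R[i], forall e : R, 0 < e -> F [set i | cabs (l - u i) <= e].
Proof.
move=> uM.
have [a ha] := @ultra_lim_real (fun i => complex.Re (u i)) M
  (fun i => le_trans (Re_le_cabs _) (uM i)).
have [b hb] := @ultra_lim_real (fun i => complex.Im (u i)) M
  (fun i => le_trans (Im_le_cabs _) (uM i)).
exists (Complex a b) => e e0; have e2 : 0 < e / 2 by rewrite divr_gt0.
apply: filterS (filterI (ha _ e2) (hb _ e2)) => i /= [h1 h2].
rewrite (le_trans (cabs_le _))// (_ : e = e / 2 + e / 2); last by rewrite -splitr.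
by case: (u i) h1 h2 => x y /= h1 h2; rewrite lerD// ltW.
Qed.

End UltraLimit.

End RealNorm.

(** * Polynomial approximation on the closed disk *)

Section ComplexDifferentiation.
Variable R : realType.
Implicit Types (f g : R[i] -> R[i]) (z d : R[i]).

(** Differentiability with the increment multiplied out, so that [h = 0] needs no exception. *)
Definition cdiff f z d := forall e : R, 0 < e -> exists2 del : R, 0 < del &
  forall h, cabs h < del -> cabs (f (z + h) - f z - h * d) <= e * cabs h.

Lemma derivable_cdiff (f : R[i]^o -> R[i]^o) (z : R[i]^o) :
  derivable f z 1 -> cdiff f z (derive1 f z).
Proof.
move=> df e e0.
have : (fun h : R[i]^o => h^-1 *: (f (h + z) - f z)) @ 0^' --> derive1 f z.
  rewrite /derive1; move: df; rewrite /derivable.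
  by under eq_fun do rewrite [_ *: 1]mulr1.
move=> /cvgrPdist_le/(_ e%:C%C); rewrite ltcR => /(_ e0).
rewrite /dnbhs /within/= -filter_from_ballE => -[_ /= /posC_ex[del del0 ->]] hd.
exists del => // h hdel.
have [->|h0] := eqVneq h 0; first by rewrite addr0 subrr mul0r subrr cabs0 mulr0.
have := hd h; rewrite -ball_normE/= sub0r normrN -cabsE ltcR => /(_ hdel h0).
rewrite -cabsE lecR => hh.
have -> : f (z + h) - f z - h * f^`()%classic z =
    - (h * (f^`()%classic z - h^-1 *: (f (h + z) - f z))).
  rewrite mulrBr -[h^-1 *: _]/(h^-1 * _) mulrA divff// mul1r opprB.
  by rewrite (addrC z h).
by rewrite cabsN cabsM mulrC ler_wpM2r// cabs_ge0.
Qed.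

Lemma cdiff_cst c z : cdiff (fun=> c) z 0.
Proof.
by move=> e e0; exists 1 => // h _; rewrite subrr mulr0 subrr cabs0 mulr_ge0 ?cabs_ge0// ltW.
Qed.

Lemma cdiff_id z : cdiff id z 1.
Proof.
move=> e e0; exists 1 => // h _.
rewrite (_ : _ - _ = 0); first by rewrite cabs0 mulr_ge0 ?cabs_ge0// ltW.
by rewrite mulr1; ring.
Qed.

Lemma cdiff_cont f z d : cdiff f z d -> forall e : R, 0 < e ->
  exists2 del : R, 0 < del & forall h, cabs h < del -> cabs (f (z + h) - f z) <= e.
Proof.
move=> df e e0; have [del del0 hd] := df 1 ltr01.
have D0 : 0 < 1 + cabs d by rewrite ltr_pwDl// cabs_ge0.
exists (Num.min del (e / (1 + cabs d))); first by rewrite lt_min del0 divr_gt0.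
move=> h; rewrite lt_min => /andP[/hd h1 h2].
rewrite -[X in cabs X](subrK (h * d)) (le_trans (cabsD _ _))// cabsM.
rewrite (@le_trans _ _ (cabs h * (1 + cabs d)))//.
  by rewrite mulrDr mulr1 lerD2r -[leRHS]mul1r.
by rewrite -ler_pdivlMr// ltW.
Qed.

Lemma cdiffB f g z d d' : cdiff f z d -> cdiff g z d' ->
  cdiff (fun x => f x - g x) z (d - d').
Proof.
move=> df dg e e0; have e2 : 0 < e / 2 by rewrite divr_gt0.
have [a a0 ha] := df _ e2; have [b b0 hb] := dg _ e2.
exists (Num.min a b); first by rewrite lt_min a0.
move=> h; rewrite lt_min => /andP[/ha h1 /hb h2].
rewrite (_ : _ - _ = (f (z + h) - f z - h * d) - (g (z + h) - g z - h * d')); last by ring.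
rewrite (le_trans (cabsB _ _))// (le_trans (lerD h1 h2))//.
by rewrite -mulrDl -splitr.
Qed.

Lemma cdiffM f g z d d' : cdiff f z d -> cdiff g z d' ->
  cdiff (fun x => f x * g x) z (d * g z + f z * d').
Proof.
move=> df dg e e0.
(* [m] bounds [g (z + h)], [f z] and [d], the summand [e] covering the variation of [g]; each of the
   three terms of the expansion then gets a third of [e]. *)
pose m := 1 + cabs (g z) + cabs (f z) + cabs d + e.
have m0 : 0 < m by rewrite /m ltr_wpDl// !addr_ge0 ?cabs_ge0.
have c0 : 0 < e / (3 * m) by rewrite divr_gt0// mulr_gt0.
have [a a0 ha] := df _ c0; have [b b0 hb] := dg _ c0.
have [c c0' hc] := cdiff_cont dg c0.
exists (Num.min a (Num.min b c)); first by rewrite !lt_min a0 b0.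
move=> h; rewrite !lt_min => /andP[/ha h1 /andP[/hb h2 /hc h3]].
set t := e / (3 * m) in h1 h2 h3.
rewrite (_ : _ - _ = (f (z + h) - f z - h * d) * g (z + h)
   + f z * (g (z + h) - g z - h * d') + h * d * (g (z + h) - g z)); last by ring.
have G : cabs (g (z + h)) <= m.
  rewrite -(subrK (g z) (g (z + h))) (le_trans (cabsD _ _))//.
  have t1 : t <= e.
    rewrite /t ler_pdivrMr ?mulr_gt0// ler_peMr ?(ltW e0)// /m.
    have := cabs_ge0 (g z); have := cabs_ge0 (f z); have := cabs_ge0 d; lra.
  rewrite /m; have := cabs_ge0 (f z); have := cabs_ge0 d; lra.
have F : cabs (f z) <= m.
  rewrite /m; have := cabs_ge0 (g z); have := cabs_ge0 d; lra.
have D : cabs d <= m.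
  rewrite /m; have := cabs_ge0 (g z); have := cabs_ge0 (f z); lra.
have tm : t * m = e / 3 by rewrite /t; field; rewrite gt_eqF.
have H0 := cabs_ge0 h.
have t0 : 0 <= t by exact: ltW.
rewrite (le_trans (cabsD _ _))// (_ : e * cabs h = t * m * cabs h + t * m * cabs h + t * m * cabs h); last by rewrite tm; field.
rewrite lerD//.
  rewrite (le_trans (cabsD _ _))// !cabsM lerD//.
    by rewrite mulrAC ler_pM ?cabs_ge0.
  by rewrite mulrC mulrAC ler_pM ?cabs_ge0.
rewrite !cabsM (_ : t * m * cabs h = cabs h * m * t); last by ring.
by rewrite ler_pM ?mulr_ge0 ?cabs_ge0// ler_wpM2l.
Qed.

Lemma cdiffV z : z != 0 -> cdiff (fun x => x^-1) z (- (z ^- 2)).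
Proof.
move=> z0 e e0.
have Z : 0 < cabs z by rewrite lt_neqAle cabs_ge0 andbT eq_sym; apply: contra_neq z0 => /cabs_eq0.
(* The first bound keeps [cabs (z + h)] above [cabs z / 2]; the second then makes the remainder
   [h ^+ 2 / (z ^+ 2 * (z + h))] at most [e * cabs h]. *)
exists (Num.min (cabs z / 2) (e * cabs z ^+ 3 / 2)).
  by rewrite lt_min !divr_gt0 ?mulr_gt0 ?exprn_gt0.
move=> h; rewrite lt_min => /andP[h1 h2].
have hz : cabs z / 2 <= cabs (z + h).
  have := cabsB (z + h) h; rewrite addrK; lra.
have zh0 : z + h != 0.
  by apply/eqP => E; move: hz; rewrite E cabs0; lra.
rewrite (_ : _ - _ = h * (h / (z ^+ 2 * (z + h)))); last by field; rewrite z0 zh0.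
rewrite cabsM mulrC ler_wpM2r ?cabs_ge0// !cabsM cabsV cabsM cabsX.
have zp : 0 < cabs (z + h) by lra.
rewrite ler_pdivrMr ?mulr_gt0 ?exprn_gt0//.
apply: (le_trans (ltW h2)).
rewrite (_ : e * cabs z ^+ 3 / 2 = e * (cabs z ^+ 2 * (cabs z / 2))); last by field.
by rewrite ler_pM2l// ler_pM2l ?exprn_gt0.
Qed.

Lemma cdiff_ext f g z d : f =1 g -> cdiff f z d -> cdiff g z d.
Proof. by move=> /funext ->. Qed.

Lemma cdiffX z n : cdiff (fun x => x ^+ n) z (n%:R * z ^+ n.-1).
Proof.
elim: n => [|n IH]; first by rewrite mul0r; exact: cdiff_cst.
have := cdiffM (@cdiff_id z) IH.
rewrite mul1r (_ : z ^+ n + _ = n.+1%:R * z ^+ n).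
  by apply: cdiff_ext => x; rewrite exprS.
case: n {IH} => [|n]/=; first by rewrite !expr0; ring.
by rewrite !exprS -!natr1; ring.
Qed.

(** Continuous induction: the supremum of the points reached from 0 is itself reached, and cannot be
    less than 1. It serves [mean_value_le], since Rolle's theorem fails for complex values. *)
Lemma interval_additive (Q : R -> R -> Prop) :
  (forall a b c, a <= b -> b <= c -> Q a b -> Q b c -> Q a c) ->
  (forall c, 0 <= c <= 1 -> exists2 del : R, 0 < del &
     forall t, 0 <= t <= 1 -> (c - del < t -> t <= c -> Q t c) /\ (c <= t -> t < c + del -> Q c t)) ->
  Q 0 1.
Proof.
move=> Qadd Qloc; pose S := [set t : R | 0 <= t <= 1 /\ Q 0 t].
have Q00 : Q 0 0.
  have /Qloc[del del0 /(_ 0)[]] : 0 <= (0 : R) <= 1 by rewrite lexx ler01.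
    by rewrite lexx ler01.
  by move=> h _; apply: h => //; rewrite sub0r oppr_lt0.
have hS : has_sup S.
  split; first by exists 0; split => //; rewrite lexx ler01.
  by exists 1 => t [/andP[]].
set c := sup S; have c0 : 0 <= c by apply: sup_upper_bound => //; split => //; rewrite lexx ler01.
have c1 : c <= 1 by apply: sup_le_ub => [|t [/andP[]]//]; case: hS.
have c01 : 0 <= c <= 1 by rewrite c0.
have [del del0 hd] := Qloc c c01.
have Q0c : Q 0 c.
  have [t [t01 Q0t] tc] := sup_adherent del0 hS.
  have [t0 _] := andP t01.
  have tlec : t <= c by apply: sup_upper_bound.
  by apply: (Qadd 0 t c) => //; apply: (hd t t01).1.
have [->|cn1] := eqVneq 1 c; first exact: Q0c.
have cl1 : c < 1 by rewrite lt_neqAle eq_sym cn1.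
pose u := Num.min 1 (c + del / 2).
have cu : c < u by rewrite lt_min cl1/=; lra.
have u01 : 0 <= u <= 1 by rewrite ge_min lexx andbT; lra.
have ud : u < c + del by rewrite gt_min; apply/orP; right; lra.
have Su : S u by split => //; apply: (Qadd 0 c u) => //; [exact: ltW|apply: (hd u u01).2 => //; exact: ltW].
by have := sup_upper_bound hS Su; rewrite leNgt cu.
Qed.

(** With [M + e'] in place of [M] the estimate holds near every point of the segment, and it adds up
    over adjacent intervals. *)
Lemma mean_value_le f (a b : R[i]) (M : R) :
  (forall t : R, 0 <= t <= 1 -> exists2 d, cdiff f (a + t%:C%C * (b - a)) d & cabs d <= M) ->
  cabs (f b - f a) <= M * cabs (b - a).
Proof.
move=> hf; apply/ler_addgt0Pr => e e0.
pose B := cabs (b - a); have B0 : 0 <= B by exact: cabs_ge0.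
pose e' := e / (B + 1).
have B1 : 0 < B + 1 by rewrite ltr_wpDl.
have e'0 : 0 < e' by rewrite divr_gt0.
pose g (t : R) := f (a + t%:C%C * (b - a)).
pose Q (s t : R) : Prop := cabs (g t - g s) <= (M + e') * B * (t - s).
suff : Q 0 1.
  rewrite /Q /g rmorph0 rmorph1 mul0r mul1r addr0 subr0 mulr1 (_ : a + (b - a) = b); last by ring.
  move=> /le_trans; apply.
  by rewrite mulrDl lerD2l /e' mulrAC ler_pdivrMr// ler_pM2l// lerDl.
refine (interval_additive (Q := Q) _ _).
  move=> s t u st tu; rewrite /Q => h1 h2.
  have -> : u - s = (t - s) + (u - t) by ring.
  have := cabs_dist (g t) (g u) (g s); move: h1 h2.
  set x := cabs _; set y := cabs _; rewrite mulrDr; lra.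
move=> c c01; have [d hd dM] := hf c c01.
have [del del0 hdel] := hd _ e'0.
have key t : `|t - c| * (B + 1) < del -> cabs (g t - g c) <= (M + e') * B * `|t - c|.
  move=> tc; pose h := (t - c)%:C%C * (b - a).
  have ch : cabs h = `|t - c| * B by rewrite cabsM cabs_real.
  have hs : cabs h < del.
    by rewrite ch (le_lt_trans _ tc)// ler_wpM2l// lerDl.
  have -> : g t - g c = (f (a + c%:C%C * (b - a) + h) - f (a + c%:C%C * (b - a)) - h * d) + h * d.
    rewrite subrK /g /h rmorphB/=; congr (f _ - _); ring.
  rewrite (le_trans (cabsD _ _))// (le_trans (lerD (hdel _ hs) (lexx _)))//.
  rewrite cabsM ch (_ : (M + e') * B * _ = e' * (`|t - c| * B) + `|t - c| * B * M); last by ring.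
  by rewrite lerD2l ler_wpM2l// mulr_ge0.
exists (del / (B + 1)) => [|t t01]; first by rewrite divr_gt0.
split => h1 h2; rewrite /Q.
  have E : `|t - c| = c - t by rewrite distrC ger0_norm ?subr_ge0.
  rewrite cabsC; have := key t; rewrite E; apply.
  by rewrite -ltr_pdivlMr// ltrBlDr -ltrBlDl; lra.
have E : `|t - c| = t - c by rewrite ger0_norm ?subr_ge0.
have := key t; rewrite E; apply.
by rewrite -ltr_pdivlMr// ltrBlDr addrC.
Qed.

End ComplexDifferentiation.

(** * Ultralimits of complex-valued functions *)

Section UltraLimits.
Variables (R : realType) (T : Type) (U : set_system T).
Hypothesis UU : UltraFilter U.

Let PU : ProperFilter U := @ultra_proper _ U UU.
Let FU : Filter U := @filter_filter _ _ PU.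

Definition ultra_cvg (u : T -> R[i]) (l : R[i]) :=
  forall e : R, 0 < e -> U [set n | cabs (l - u n) <= e].

Lemma ultra_cvg_ex u (M : R) : (forall n, cabs (u n) <= M) -> exists l : R[i], ultra_cvg u l.
Proof. exact: ultra_lim. Qed.

Lemma ultra_cvg_cst c : ultra_cvg (fun=> c) c.
Proof.
move=> e e0; apply: (@filterS _ U _ setT); last exact: filterT.
by move=> n _ /=; rewrite subrr cabs0 ltW.
Qed.

Lemma ultra_cvg_near_le u l (M : R) : ultra_cvg u l ->
  U [set n | cabs (u n) <= M] -> cabs l <= M.
Proof.
move=> ul uM; apply/ler_addgt0Pr => e e0.
have [n /= [h1 h2]] := filter_ex (filterI (ul e e0) uM).
by rewrite -(subrK (u n) l) (le_trans (cabsD _ _))// addrC lerD.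
Qed.

Lemma ultra_cvgD u v l m : ultra_cvg u l -> ultra_cvg v m ->
  ultra_cvg (fun n => u n + v n) (l + m).
Proof.
move=> ul vm e e0; have e2 : 0 < e / 2 by rewrite divr_gt0.
apply: filterS (filterI (ul _ e2) (vm _ e2)) => n /= [h1 h2].
rewrite (_ : _ - _ = (l - u n) + (m - v n)); last by ring.
by rewrite (le_trans (cabsD _ _))// (le_trans (lerD h1 h2))// -splitr.
Qed.

Lemma ultra_cvgZ c u l : ultra_cvg u l -> ultra_cvg (fun n => c * u n) (c * l).
Proof.
move=> ul e e0; have c1 : 0 < cabs c + 1 by rewrite ltr_wpDl// cabs_ge0.
apply: filterS (ul _ (divr_gt0 e0 c1)) => n /= h.
rewrite -mulrBr cabsM (le_trans (ler_wpM2l (cabs_ge0 _) h))// mulrA.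
rewrite ler_pdivrMr// mulrC ler_pM2l//.
by rewrite lerDl.
Qed.

Lemma ultra_cvgB u v l m : ultra_cvg u l -> ultra_cvg v m ->
  ultra_cvg (fun n => u n - v n) (l - m).
Proof.
move=> ul /(ultra_cvgZ (-1)) vm; have := ultra_cvgD ul vm.
by rewrite mulN1r; under eq_fun do rewrite mulN1r.
Qed.

Lemma ultra_cvg_unique u l m : ultra_cvg u l -> ultra_cvg u m -> l = m.
Proof.
move=> ul um; apply: eq_cabs_small => e e0.
apply: (ultra_cvg_near_le (ultra_cvgB ul um)).
by apply: (@filterS _ U _ setT); [move=> n _ /=; rewrite subrr cabs0 ltW|exact: filterT].
Qed.

Lemma ultra_cvg_sum (I : Type) (r : seq I) (u : I -> T -> R[i]) (l : I -> R[i]) :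
  (forall i, ultra_cvg (u i) (l i)) ->
  ultra_cvg (fun n => \sum_(i <- r) u i n) (\sum_(i <- r) l i).
Proof.
move=> h; elim: r => [|i r IH].
  rewrite big_nil; under eq_fun do rewrite big_nil; exact: ultra_cvg_cst.
rewrite big_cons; under eq_fun do rewrite big_cons.
exact: ultra_cvgD.
Qed.

End UltraLimits.

Lemma ultra_near (U : set_system nat) (Uoo : \oo `<=` U) (P : nat -> Prop) N :
  (forall n, (N <= n)%N -> P n) -> U [set n | P n].
Proof. by move=> h; apply: Uoo; exists N. Qed.

Lemma ultra_cvg_le (R : realType) (U : set_system nat) (UU : UltraFilter U) (Uoo : \oo `<=` U)
    (u : nat -> R[i]) l (M : R) N : ultra_cvg U u l ->
  (forall n, (N <= n)%N -> cabs (u n) <= M) -> cabs l <= M.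
Proof. by move=> ul uM; apply: (ultra_cvg_near_le UU ul); exact: ultra_near uM. Qed.

Lemma nat_ultrafilter : exists2 U : set_system nat, UltraFilter U & \oo `<=` U.
Proof. by have [U [? ?]] := ultraFilterLemma (F := \oo) _; exists U. Qed.

Section UniformDifferentiability.
Variable R : realType.
Variables (f df : R[i] -> R[i]).
Hypothesis f_df : forall z, cabs z < 1 -> cdiff f z (df z).
Hypothesis df_cont : forall z, cabs z < 1 -> exists d, cdiff df z d.

(** Heine's theorem by contradiction: the ultralimit of a sequence of bad pairs lies in the smaller
    disk, where [df] is continuous. *)
Lemma derivative_unif_cont (rho e : R) : rho < 1 -> 0 < e ->
  exists2 del : R, 0 < del & forall z w, cabs z <= rho -> cabs w <= rho ->
    cabs (z - w) < del -> cabs (df z - df w) <= e.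
Proof.
move=> rho1 e0; apply: contrapT => hn.
have /choice[zw hzw] : forall n : nat, exists zw : R[i] * R[i],
    [/\ cabs zw.1 <= rho, cabs zw.2 <= rho, cabs (zw.1 - zw.2) < n.+1%:R^-1 &
        e < cabs (df zw.1 - df zw.2)].
  move=> n; apply: contrapT => hn2; apply: hn; exists n.+1%:R^-1 => // z w zr wr zw.
  by rewrite leNgt; apply/negP => ezw; apply: hn2; exists (z, w).
have [U UU Uoo] := nat_ultrafilter.
have PU : ProperFilter U := @ultra_proper _ U UU.
have FU : Filter U := @filter_filter _ _ PU.
have [l hl] := @ultra_cvg_ex R _ U UU (fun n => (zw n).1) rho (fun n => let: And4 h _ _ _ := hzw n in h).
have l1 : cabs l < 1.
  by rewrite (le_lt_trans _ rho1)//; apply: (ultra_cvg_le UU Uoo hl (N := 0)) => n _; case: (hzw n).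
have [d hd] := df_cont l1.
have e2 : 0 < e / 2 by rewrite divr_gt0.
have [del del0 hdel] := cdiff_cont hd e2.
have d2 : 0 < del / 4 by rewrite divr_gt0.
have [N _ hN] := near_infty_natSinv_lt (PosNum d2).
have [n /= [h1 h2]] := filter_ex (filterI (hl _ d2) (@ultra_near U Uoo _ N hN)).
have [_ _ h3 h4] := hzw n.
have h5 : cabs ((zw n).1 - l) < del by rewrite cabsC; lra.
have h6 : cabs ((zw n).2 - l) < del.
  by rewrite cabsC; have := cabs_dist (zw n).1 l (zw n).2; have := lt_trans h3 h2; move=> /=; lra.
have := hdel _ h5; have := hdel _ h6; rewrite !(addrC l) !subrK.
have := cabs_dist (df l) (df (zw n).1) (df (zw n).2); rewrite (cabsC (df l)).
lra.
Qed.

(** Mean value inequality for [w |-> f w - w * df z], whose derivative [df w - df z] is uniformly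
    small. *)
Lemma uniformly_differentiable (rho e : R) : rho < 1 -> 0 < e ->
  exists2 del : R, 0 < del & forall z h, cabs z <= rho -> cabs (z + h) <= rho ->
    cabs h < del -> cabs (f (z + h) - f z - h * df z) <= e * cabs h.
Proof.
move=> rho1 e0; have [del del0 hd] := derivative_unif_cont rho1 e0.
exists del => // z h zr zhr hdel.
pose g w := f w - w * df z.
have -> : f (z + h) - f z - h * df z = g (z + h) - g z by rewrite /g; ring.
rewrite [X in _ * cabs X](_ : h = z + h - z); last by ring.
apply: mean_value_le => t /andP[t0 t1].
have -> : z + t%:C%C * (z + h - z) = z + t%:C%C * h by congr (_ + _ * _); ring.
set w := z + _.
have wr : cabs w <= rho.
  have -> : w = (1 - t)%:C%C * z + t%:C%C * (z + h).
    by rewrite /w rmorphB rmorph1; ring.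
  rewrite (le_trans (cabsD _ _))// !cabsM !cabs_real !ger0_norm ?subr_ge0//.
  have -> : rho = (1 - t) * rho + t * rho by ring.
  by rewrite lerD// ler_wpM2l// subr_ge0.
exists (df w - (1 * df z + w * 0)).
  apply: cdiffB; first by apply: f_df; apply: le_lt_trans rho1.
  by apply: cdiffM; [exact: cdiff_id|exact: cdiff_cst].
rewrite mulr0 addr0 mul1r; apply: hd => //.
have -> : w - z = t%:C%C * h by rewrite /w; ring.
by rewrite cabsM cabs_real ger0_norm// (le_lt_trans _ hdel)// ler_piMl// cabs_ge0.
Qed.

End UniformDifferentiability.

(** * Roots of unity of order a power of two *)

Section DyadicRoots.
Variable R : realType.

(** The choice of the root in the right half plane makes the iterated roots of -1 tend to 1. *)
Definition right_sqrt (z : R[i]) : R[i] :=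
  if 0 <= complex.Re (sqrtC z) then sqrtC z else - sqrtC z.

Lemma right_sqrt_sqr z : right_sqrt z ^+ 2 = z.
Proof. by rewrite /right_sqrt; case: ifP; rewrite ?sqrrN sqrtCK. Qed.

Lemma right_sqrt_Re z : 0 <= complex.Re (right_sqrt z).
Proof.
rewrite /right_sqrt; case: (leP 0 (complex.Re (sqrtC z))) => // h.
by rewrite raddfN/= oppr_ge0 ltW.
Qed.

(** Up to conjugation this is exp(i pi / 2^j), obtained without the exponential. *)
Definition dyadic_root j := iter j right_sqrt (-1).

Lemma dyadic_root_pow j : dyadic_root j ^+ (2 ^ j) = -1.
Proof.
elim: j => [|j IH]; first by rewrite expr1.
by rewrite expnS exprM /= right_sqrt_sqr.
Qed.

Lemma dyadic_root_unit j : cabs (dyadic_root j) = 1.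
Proof.
apply/eqP; rewrite -(@eqrXn2 _ (2 ^ j))// ?cabs_ge0 ?expn_gt0//.
by rewrite expr1n -cabsX dyadic_root_pow cabsN cabs1.
Qed.

(** The order divides [2 ^ j.+1], and a smaller power of 2 would contradict [dyadic_root_pow]. *)
Lemma dyadic_root_prim j : (2 ^ j.+1).-primitive_root (dyadic_root j).
Proof.
have x1 : dyadic_root j ^+ (2 ^ j.+1) = 1.
  by rewrite expnS mulnC exprM dyadic_root_pow sqrrN expr1n.
have [m mp md] := prim_order_exists (expn_gt0 2 j.+1) x1.
have /(dvdn_pfactor _ _ (isT : prime 2))[k kj E] := md.
move: kj; rewrite leq_eqVlt => /orP[/eqP kj|]; first by rewrite -kj -E.
rewrite ltnS => kj; exfalso.
have : dyadic_root j ^+ (2 ^ j) = 1.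
  by apply/eqP; rewrite -(prim_order_dvd mp) E dvdn_exp2l.
rewrite dyadic_root_pow => /eqP; rewrite -subr_eq0 -opprD oppr_eq0.
by rewrite -mulr2n pnatr_eq0.
Qed.

Lemma unit_distE (s : R[i]) : cabs s = 1 -> cabs (s - 1) ^+ 2 = 2 - 2 * complex.Re s.
Proof.
move=> s1; apply: complexI; rewrite cabs_sqr rmorphB rmorph1/=.
have ss : s * s^* = 1 by rewrite -cabs_sqr s1 expr1n.
rewrite (_ : _ * _ = 1 + s * s^* - (s + s^*)); last by ring.
rewrite ss.
have -> : s + s^* = (2 * complex.Re s)%:C%C.
  by rewrite rmorphM rmorph_nat/= -addcJ.
by rewrite rmorphB/= rmorph_nat.
Qed.

(** If [s] is the next root, then |s^2 - 1| = |s - 1| |s + 1| and |s + 1|^2 = 2 + 2 Re s >= 2, so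
    the squared distance to 1 is at least halved at each step, starting from 4. *)
Lemma dyadic_root_near1 (e : R) : 0 < e -> exists N, forall j, (N <= j)%N ->
  cabs (dyadic_root j - 1) <= e.
Proof.
move=> e0.
have step j : cabs (dyadic_root j.+1 - 1) ^+ 2 <= cabs (dyadic_root j - 1) ^+ 2 / 2.
  set s := dyadic_root j.+1; have E : dyadic_root j = s ^+ 2 by rewrite /s /= right_sqrt_sqr.
  have s1 : cabs s = 1 by exact: dyadic_root_unit.
  have rs : 0 <= complex.Re s by exact: right_sqrt_Re.
  have -> : dyadic_root j - 1 = (s - 1) * (s - (-1)) by rewrite E; ring.
  rewrite cabsM exprMn -mulrA ler_peMr ?sqr_ge0// -(cabsN (s - -1)).
  have -> : - (s - -1) = - s - 1 by ring.
  by rewrite unit_distE ?cabsN// raddfN/=; lra.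
have bnd j : cabs (dyadic_root j - 1) ^+ 2 <= 4 / 2 ^+ j.
  elim: j => [|j IH].
    rewrite /= unit_distE ?cabsN ?cabs1// expr0 divr1 raddfN/=; lra.
  rewrite (le_trans (step j))// [in leRHS]exprS invfM mulrCA mulrC.
  by rewrite ler_pM2l ?invr_gt0.
have e2 : 0 < e ^+ 2 / 4 by rewrite divr_gt0// exprn_gt0.
have [N _ hN] := near_infty_natSinv_expn_lt (PosNum e2).
exists N => j /hN /= hj.
rewrite -(@ler_pXn2r _ 2) ?nnegrE ?cabs_ge0 ?(ltW e0)// (le_trans (bnd j))//.
by move: hj; rewrite div1r => /ltW; lra.
Qed.

End DyadicRoots.

(** * Taylor terms as limits of discrete circle averages *)

Section Monomials.
Variable R : realType.
Variables (f df : R[i] -> R[i]) (L : R).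
Hypothesis f_df : forall z, cabs z < 1 -> cdiff f z (df z).
Hypothesis df_le : forall z, cabs z < 1 -> cabs (df z) <= L.
Hypothesis df_cont : forall z, cabs z < 1 -> exists d, cdiff df z d.
Hypothesis L0 : 0 <= L.

Lemma disk_lipschitz z w : cabs z < 1 -> cabs w < 1 -> cabs (f z - f w) <= L * cabs (z - w).
Proof.
move=> z1 w1; apply: mean_value_le => t /andP[t0 t1].
suff h : cabs (w + t%:C%C * (z - w)) < 1.
  by exists (df (w + t%:C%C * (z - w))); [exact: f_df|exact: df_le].
have -> : w + t%:C%C * (z - w) = (1 - t)%:C%C * w + t%:C%C * z.
  by rewrite rmorphB rmorph1; ring.
rewrite (le_lt_trans (cabsD _ _))// !cabsM !cabs_real !ger0_norm ?subr_ge0//.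
have [->|tn0] := eqVneq t 0; first by rewrite subr0 mul1r mul0r addr0.
have tp : 0 < t by rewrite lt_neqAle eq_sym tn0.
have : t * cabs z < t * 1 by rewrite ltr_pM2l.
have : (1 - t) * cabs w <= (1 - t) * 1 by rewrite ler_wpM2l ?subr_ge0// ltW.
lra.
Qed.

Variable U : set_system nat.
Hypothesis UU : UltraFilter U.
Hypothesis Uoo : \oo `<=` U.

Local Notation w := (@dyadic_root R).

(** The mean over the roots of unity of order [2 ^ j.+1], in the role of the normalized integral
    over the circle. *)
Definition circle_mean j (u : R[i] -> R[i]) : R[i] :=
  ((2 ^ j.+1)%:R)^-1 * \sum_(k < 2 ^ j.+1) u (w j ^+ k).

Lemma circle_mean_le j u (M : R) : (forall v, cabs v = 1 -> cabs (u v) <= M) ->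
  cabs (circle_mean j u) <= M.
Proof.
move=> uM; have m0 : 0 < (2 ^ j.+1)%:R :> R by rewrite ltr0n expn_gt0.
rewrite cabsM cabsV cabs_nat mulrC ler_pdivrMr// (le_trans (cabs_sum _ _ _))//.
apply: (@le_trans _ _ (\sum_(k < 2 ^ j.+1) M)).
  by apply: ler_sum => k _; apply: uM; rewrite cabsX dyadic_root_unit expr1n.
by rewrite sumr_const card_ord mulr_natr.
Qed.

Lemma circle_meanD j u v : circle_mean j (fun x => u x + v x) = circle_mean j u + circle_mean j v.
Proof. by rewrite /circle_mean big_split/= mulrDr. Qed.

Lemma circle_meanZ j c u : circle_mean j (fun x => c * u x) = c * circle_mean j u.
Proof. by rewrite /circle_mean -mulr_sumr mulrCA. Qed.

Lemma circle_meanB j u v : circle_mean j (fun x => u x - v x) = circle_mean j u - circle_mean j v.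
Proof. by rewrite /circle_mean sumrB mulrBr. Qed.

Lemma circle_mean_cst j c : circle_mean j (fun=> c) = c.
Proof.
rewrite /circle_mean sumr_const card_ord -[c *+ _]mulr_natr mulrCA mulVf ?mulr1//.
Qed.

Lemma circle_mean_rot j u : circle_mean j (fun x => u (w j * x)) = circle_mean j u.
Proof.
rewrite /circle_mean; congr (_ * _).
have : (0 < 2 ^ j.+1)%N by rewrite expn_gt0.
have := prim_expr_order (dyadic_root_prim R j).
case: (2 ^ j.+1)%N => // n x1 _.
rewrite big_ord_recr big_ord_recl /= -exprS x1 expr0 addrC; congr (_ + _).
by apply: eq_bigr => i _; rewrite -exprS.
Qed.

(* [chi] is one of the characters [v ^+ n] and [v^* ^+ n] of the circle; the
   second hypothesis says that its derivative at [1] is [- kap] in the direction of the circle. *)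
Variables (chi : R[i] -> R[i]) (kap : R[i]).
Hypothesis chi_unit : forall v, cabs v = 1 -> cabs (chi v) = 1.
Hypothesis chiM : forall x y, chi (x * y) = chi x * chi y.
Hypothesis chi_diff : exists C : R, forall v, cabs v = 1 ->
  cabs (chi v - 1 + kap * (v - 1)) <= C * cabs (v - 1) ^+ 2.

(** For [chi v = v^* ^+ n] the limit in [j] is the Taylor term of degree [n] at [z];
    [derivative_mean] is the derivative of the average in [z]. *)
Definition coefficient_mean j z := circle_mean j (fun v => f (z * v) * chi v).
Definition derivative_mean j z := circle_mean j (fun v => df (z * v) * (v * chi v)).

Let zv (z v : R[i]) : cabs v = 1 -> cabs z < 1 -> cabs (z * v) < 1.
Proof. by move=> v1 z1; rewrite cabsM v1 mulr1. Qed.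

Let fbnd : exists M : R, forall z, cabs z < 1 -> cabs (f z) <= M.
Proof.
exists (cabs (f 0) + L) => z z1.
have := @disk_lipschitz z 0 z1; rewrite cabs0 ltr01 subr0 => /(_ isT) h.
rewrite -(subrK (f 0) (f z)) (le_trans (cabsD _ _))// addrC lerD2l (le_trans h)//.
by rewrite -[leRHS]mulr1 ler_wpM2l// ltW.
Qed.

Lemma coefficient_limits : exists HB : (R[i] -> R[i]) * (R[i] -> R[i]),
  forall z, cabs z < 1 -> ultra_cvg U (fun j => coefficient_mean j z) (HB.1 z) /\
    ultra_cvg U (fun j => derivative_mean j z) (HB.2 z).
Proof.
have [M hM] := fbnd.
have /choice[H hH] : forall z, exists l, cabs z < 1 -> ultra_cvg U (fun j => coefficient_mean j z) l.
  move=> z; have [z1|z1] := ltP (cabs z) 1; last by exists 0.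
  have [|l hl] := @ultra_cvg_ex _ _ _ UU (fun j => coefficient_mean j z) M.
    by move=> n; apply: circle_mean_le => v v1; rewrite cabsM chi_unit// mulr1; apply/hM/zv.
  by exists l.
have /choice[B hB] : forall z, exists l, cabs z < 1 -> ultra_cvg U (fun j => derivative_mean j z) l.
  move=> z; have [z1|z1] := ltP (cabs z) 1; last by exists 0.
  have [|l hl] := @ultra_cvg_ex _ _ _ UU (fun j => derivative_mean j z) L.
    by move=> n; apply: circle_mean_le => v v1; rewrite !cabsM v1 chi_unit// !mulr1; apply/df_le/zv.
  by exists l.
by exists (H, B) => z z1; split; [exact: hH|exact: hB].
Qed.

Variables (H B : R[i] -> R[i]).
Hypothesis H_lim : forall z, cabs z < 1 -> ultra_cvg U (fun j => coefficient_mean j z) (H z).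
Hypothesis B_lim : forall z, cabs z < 1 -> ultra_cvg U (fun j => derivative_mean j z) (B z).

Let mid (z : R[i]) : cabs z < 1 -> exists2 rho : R, cabs z < rho & rho < 1.
Proof. by move=> z1; exists ((cabs z + 1) / 2); lra. Qed.

(** The first order remainder of [f] is bounded uniformly in [v], so the bound survives the
    averaging and the ultralimit. *)
Lemma coefficient_cdiff z : cabs z < 1 -> cdiff H z (B z).
Proof.
move=> z1 e e0; have [rho zr r1] := mid z1.
have [del del0 hd] := uniformly_differentiable f_df df_cont r1 e0.
exists (Num.min del (rho - cabs z)); first by rewrite lt_min del0 subr_gt0.
move=> h; rewrite lt_min => /andP[h1 h2].
have zh : cabs (z + h) < rho by have := cabsD z h; lra.
have zh1 : cabs (z + h) < 1 by exact: lt_trans r1.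
have := ultra_cvgB UU (ultra_cvgB UU (H_lim zh1) (H_lim z1)) (ultra_cvgZ UU h (B_lim z1)).
move=> /(ultra_cvg_le UU Uoo (N := 0)); apply => n _.
rewrite -circle_meanZ -!circle_meanB; apply: circle_mean_le => v v1.
rewrite (_ : _ - _ = (f (z * v + h * v) - f (z * v) - (h * v) * df (z * v)) * chi v).
  rewrite cabsM chi_unit// mulr1 (_ : cabs h = cabs (h * v)).
    apply: hd; rewrite -?mulrDl ?cabsM v1 mulr1 ?(ltW zr)//; exact: ltW.
  by rewrite cabsM v1 mulr1.
by rewrite mulrDl; ring.
Qed.

Let wN1 j : w j - 1 != 0.
Proof.
rewrite subr_eq0; apply/eqP => E; have := dyadic_root_pow R j.
by rewrite E expr1n => /eqP; rewrite -subr_eq0 opprK -mulr2n pnatr_eq0.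
Qed.

(* Summing by parts over a rotation by the small root of unity [w j]. *)
Lemma coefficient_euler z : cabs z < 1 -> z * B z = kap * H z.
Proof.
move=> z1; have [rho zr r1] := mid z1.
have [M hM] := fbnd; have [C hC] := chi_diff.
have C0 : 0 <= C.
  have := hC (-1); rewrite cabsN cabs1 => /(_ erefl) h.
  have : 0 <= C * cabs (-1 - 1 : R[i]) ^+ 2 by exact: le_trans (cabs_ge0 _) h.
  rewrite pmulr_lge0// exprn_gt0// (_ : -1 - 1 = - 2%:R) ?cabsN ?cabs_nat//; ring.
have M0 : 0 <= M by apply: le_trans (cabs_ge0 _) (hM 0 _); rewrite cabs0.
apply: eq_cabs_small => e e0.
have e2 : 0 < e / 2 by rewrite divr_gt0.
have [del del0 hd] := uniformly_differentiable f_df df_cont r1 e2.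
(* [D * cabs t ^+ 2] bounds the two error terms that are quadratic in [t]; they and the remainder of
   [f] each get half of [e]. *)
pose D := C * M + (C + cabs kap) * L.
have D0 : 0 <= D by rewrite addr_ge0// mulr_ge0// addr_ge0// cabs_ge0.
have s0 : 0 < Num.min 1 (Num.min (del / 2) (e / (2 * (D + 1)))).
  by rewrite !lt_min ltr01 !divr_gt0// mulr_gt0// ltr_wpDl.
have [N hN] := dyadic_root_near1 s0.
have := ultra_cvgB UU (ultra_cvgZ UU z (B_lim z1)) (ultra_cvgZ UU kap (H_lim z1)).
move=> /(ultra_cvg_le UU Uoo (N := N)); apply => j /hN.
rewrite !le_min => /andP[t1 /andP[t2 t3]].
have w1 : cabs (w j) = 1 by exact: dyadic_root_unit.
set t := w j - 1 in t1 t2 t3.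
have tE : w j = 1 + t by rewrite /t addrC subrK.
have t0 : 0 < cabs t by rewrite lt_neqAle cabs_ge0 andbT eq_sym; apply/eqP => /cabs_eq0/eqP; apply/negP/wN1.
pose r v := f (z * v * w j) - f (z * v) - z * v * t * df (z * v).
have rle v : cabs v = 1 -> cabs (r v) <= e / 2 * cabs t.
  move=> v1; rewrite /r tE mulrDr mulr1.
  have zvt : cabs (z * v * t) = cabs z * cabs t by rewrite !cabsM v1 mulr1.
  have zt : cabs z * cabs t <= cabs t by rewrite ler_piMl ?cabs_ge0// ltW.
  rewrite (le_trans (hd _ _ _ _ _)) ?zvt//.
  - by rewrite cabsM v1 mulr1 ltW.
  - rewrite (_ : z * v + z * v * t = z * v * w j); last by rewrite tE; ring.
    by rewrite !cabsM v1 w1 !mulr1 ltW.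
  - by rewrite (le_lt_trans zt)// (le_lt_trans t2)//; lra.
  - by rewrite ler_wpM2l// ltW.
pose G := circle_mean j (fun v => r v * (chi v * chi (w j))).
have Gle : cabs G <= e / 2 * cabs t.
  by apply: circle_mean_le => v v1; rewrite !cabsM !chi_unit// !mulr1; exact: rle.
(* Replacing [v] by [w j * v] does not change the average. Expanding [f (z * v * w j)] to first
   order in [t] gives this identity; divided by [t], it tends to the Euler equation. *)
have key : (chi (w j) - 1) * coefficient_mean j z + chi (w j) * t * z * derivative_mean j z + G = 0.
  have := circle_mean_rot j (fun v => f (z * v) * chi v); rewrite -/(coefficient_mean j z).
  move=> /eqP; rewrite -subr_eq0 => /eqP <-.
  rewrite /coefficient_mean /derivative_mean /G -!circle_meanZ -!circle_meanD -circle_meanB.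
  congr circle_mean; apply/funext => v; rewrite chiM /r.
  by rewrite (_ : z * (w j * v) = z * v * w j); [ring|ring].
have cle : cabs (coefficient_mean j z) <= M.
  by apply: circle_mean_le => v v1; rewrite cabsM chi_unit// mulr1; apply/hM/zv.
have dle : cabs (derivative_mean j z) <= L.
  by apply: circle_mean_le => v v1; rewrite !cabsM v1 chi_unit// !mulr1; apply/df_le/zv.
move: (coefficient_mean j z) (derivative_mean j z) key cle dle Gle => A D' key cle dle Gle.
have ct := hC _ w1; rewrite -/t in ct.
pose q := chi (w j) - 1 + kap * t.
have ct1 : cabs (chi (w j) - 1) <= (C + cabs kap) * cabs t.
  rewrite (_ : chi (w j) - 1 = q - kap * t); last by rewrite /q; ring.
  rewrite (le_trans (cabsB _ _))// mulrDl cabsM lerD2r (le_trans ct)//.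
  by rewrite ler_wpM2l// expr2 ler_piMl ?cabs_ge0.
rewrite -(ler_pM2r t0) -cabsM.
rewrite (_ : _ * t = - (q * A) - (chi (w j) - 1) * t * (z * D') - G); last first.
  apply/eqP; rewrite -subr_eq0; apply/eqP; rewrite -key /q; ring.
rewrite (le_trans (cabsB _ _))// (_ : e * cabs t = e / 2 * cabs t + e / 2 * cabs t); last by field.
rewrite lerD// (le_trans (cabsB _ _))// cabsN !cabsM.
apply: (@le_trans _ _ (D * cabs t ^+ 2)).
  rewrite /D mulrDl; apply: lerD.
    by rewrite [leRHS]mulrAC ler_pM ?cabs_ge0.
  rewrite (_ : (C + cabs kap) * L * cabs t ^+ 2 = (C + cabs kap) * cabs t * cabs t * L); last by ring.
  rewrite ler_pM ?mulr_ge0 ?cabs_ge0//.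
    by rewrite ler_wpM2r ?cabs_ge0.
  by rewrite (le_trans _ dle)// ler_piMl ?cabs_ge0// ltW.
rewrite expr2 mulrA ler_wpM2r ?cabs_ge0//.
rewrite (le_trans (ler_wpM2l D0 t3))// mulrA ler_pdivrMr ?mulr_gt0 ?ltr_wpDl//.
rewrite (_ : e / 2 * (2 * (D + 1)) = (D + 1) * e); last by field.
by rewrite ler_wpM2r ?(ltW e0)// lerDl.
Qed.

End Monomials.

(** * Solutions of the Euler equation on the disk *)

Section EulerEquation.
Variable R : realType.
Implicit Types (f g K : R[i] -> R[i]) (z k : R[i]).

(** Euler's equation for functions homogeneous of degree [k]. Degrees add under products, see
    [eulerM], so division by a monomial leads to degree 0. *)
Definition euler f k z := exists2 d, cdiff f z d & z * d = k * f z.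

Lemma eulerM f g k l z : euler f k z -> euler g l z ->
  euler (fun x => f x * g x) (k + l) z.
Proof.
move=> [d hd Ed] [d' hd' Ed']; exists (d * g z + f z * d'); first exact: cdiffM.
by rewrite mulrDr mulrA Ed mulrCA Ed'; ring.
Qed.

Lemma eulerX z n : euler (fun x => x ^+ n) n%:R z.
Proof.
exists (n%:R * z ^+ n.-1); first exact: cdiffX.
by case: n => [|n]; [rewrite !mul0r mulr0|rewrite mulrCA -exprS].
Qed.

Lemma eulerV z n : z != 0 -> euler (fun x => x^-1 ^+ n) (- n%:R) z.
Proof.
move=> z0; elim: n => [|n IH].
  by exists 0; [exact: cdiff_cst|rewrite oppr0 mulr0 mul0r].
have V : euler (fun x => x^-1) (-1) z.
  exists (- z ^- 2); first exact: cdiffV.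
  by field.
have := eulerM V IH; rewrite -opprD nat1r => -[d hd Ed]; exists d; last first.
  by rewrite Ed exprS.
by move: hd; apply: cdiff_ext => x; rewrite exprS.
Qed.

Let ReZ (t : R) z : complex.Re (t%:C%C * z) = t * complex.Re z.
Proof. by case: z => a b /=; rewrite mul0r subr0. Qed.

Let ImZ (t : R) z : complex.Im (t%:C%C * z) = t * complex.Im z.
Proof. by case: z => a b /=; rewrite mul0r addr0. Qed.

(** The derivative vanishes off 0, so [K] is constant along segments that avoid 0. The punctured
    disk is not convex: points off the nonpositive real axis are joined to 1/2 directly, negative
    reals by way of i/2. *)
Lemma euler0_cst K : (forall z, cabs z < 1 -> z != 0 -> euler K 0 z) ->
  exists c, forall z, cabs z < 1 -> z != 0 -> K z = c.
Proof.
move=> hK.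
have seg a b : cabs a < 1 -> cabs b < 1 ->
    (forall t : R, 0 <= t <= 1 -> (1 - t)%:C%C * a + t%:C%C * b != 0) -> K b = K a.
  move=> a1 b1 h0; apply: eq_cabs_small => e e0.
  rewrite (le_trans _ (ltW e0))// (le_trans (mean_value_le (M := 0) _)) ?mul0r//.
  move=> t t01; have E : a + t%:C%C * (b - a) = (1 - t)%:C%C * a + t%:C%C * b.
    by rewrite rmorphB rmorph1; ring.
  have /hK/(_ (h0 _ t01))[d hd] : cabs ((1 - t)%:C%C * a + t%:C%C * b) < 1; last first.
    rewrite mul0r => /eqP; rewrite mulf_eq0 (negbTE (h0 _ t01))/= => /eqP d0.
    by exists d; rewrite ?E// d0 cabs0.
  case/andP: t01 => t0 t1.
  rewrite (le_lt_trans (cabsD _ _))// !cabsM !cabs_real !ger0_norm ?subr_ge0//.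
  have [->|tn0] := eqVneq t 0; first by rewrite subr0 mul1r mul0r addr0.
  have tp : 0 < t by rewrite lt_neqAle eq_sym tn0.
  have : t * cabs b < t * 1 by rewrite ltr_pM2l.
  have : (1 - t) * cabs a <= (1 - t) * 1 by rewrite ler_wpM2l ?subr_ge0// ltW.
  lra.
pose h : R[i] := (1 / 2)%:C%C; pose ih : R[i] := Complex 0 (1 / 2).
have h1 : cabs h < 1 by rewrite cabs_real ger0_norm; lra.
have ih1 : cabs ih < 1.
  by rewrite (le_lt_trans (cabs_le _))//= normr0 add0r ger0_norm; lra.
have right z : cabs z < 1 -> (complex.Im z != 0) || (0 < complex.Re z) -> K z = K h.
  move=> z1 hz; apply: seg => // t /andP[t0 t1]; apply/eqP => E.
  have := congr1 (@complex.Re R) E; have := congr1 (@complex.Im R) E.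
  rewrite !raddfD/= !(mul0r, subr0, addr0, mulr0, add0r) ReZ ImZ => e1 e2.
  case/orP: hz => [/eqP I0|Rp].
    move/eqP: e1; rewrite mulf_eq0 => /orP[/eqP t00|/eqP//]; move: e2; rewrite t00; lra.
  have : 0 <= t * complex.Re z by rewrite mulr_ge0// ltW.
  have [t12|t12] := leP t (1 / 2); first by lra.
  have : 0 < t * complex.Re z by rewrite mulr_gt0//; lra.
  lra.
exists (K h) => z z1 z0.
have [?|] := boolP ((complex.Im z != 0) || (0 < complex.Re z)); first exact: right.
rewrite negb_or negbK -leNgt => /andP[/eqP I0 R0].
rewrite -(right ih)//=; last by apply/orP; left; lra.
apply: seg => // t /andP[t0 t1]; apply/eqP => E.
have := congr1 (@complex.Re R) E; have := congr1 (@complex.Im R) E.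
rewrite !raddfD/= !(mul0r, subr0, addr0, mulr0, add0r) ReZ ImZ I0 mulr0 addr0 => e1 e2.
have t11 : t = 1 by lra.
move: e2; rewrite t11 oppr0 add0r mul1r => RR.
by move/eqP: z0; apply; rewrite (complexE z) I0 RR mulr0 addr0.
Qed.

Lemma cdiff_eq_at0 K d c : cdiff K 0 d ->
  (forall z, cabs z < 1 -> z != 0 -> K z = c) -> K 0 = c.
Proof.
move=> hd hc; apply: eq_cabs_small => e e0.
have [del del0 h] := cdiff_cont hd e0.
pose x : R := Num.min (del / 2) (1 / 2).
have x0 : 0 < x by rewrite lt_min; apply/andP; split; lra.
have xd : x < del by rewrite gt_min; apply/orP; left; lra.
have x1 : x < 1 by rewrite gt_min; apply/orP; right; lra.
have cx : cabs x%:C%C = x by rewrite cabs_real gtr0_norm.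
have := h x%:C%C; rewrite cx add0r hc ?cx//; first by rewrite cabsC; apply.
by apply/eqP => /complexI; lra.
Qed.

Lemma euler_monomial H n : (forall z, cabs z < 1 -> euler H n%:R z) ->
  exists a, forall z, cabs z < 1 -> H z = a * z ^+ n.
Proof.
move=> hH; have [|c hc] := @euler0_cst (fun x => H x * x^-1 ^+ n).
  by move=> z z1 z0; have := eulerM (hH z z1) (eulerV n z0); rewrite subrr.
have hz z : cabs z < 1 -> z != 0 -> H z = c * z ^+ n.
  by move=> z1 z0; rewrite -(hc z z1 z0) -mulrA -exprMn mulVf// expr1n mulr1.
exists c => z z1; have [->|z0] := eqVneq z 0; last exact: hz.
have [d hd Ed] : euler H n%:R 0 by apply: hH; rewrite cabs0.
(* At 0 the equation reads [0 = n * H 0]. It settles [n > 0]; for [n = 0] the value at 0 comes from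
   continuity. *)
case: n hH hc hz Ed => [|n] hH hc hz Ed.
  rewrite expr0 mulr1; apply: (cdiff_eq_at0 hd) => x x1 x0.
  by rewrite hz// expr0 mulr1.
rewrite expr0n/= mulr0; move/eqP: Ed; rewrite mul0r eq_sym mulf_eq0 pnatr_eq0/=.
by move/eqP.
Qed.

(** Times [x ^+ n.+1] the function is constant off 0, and by continuity the constant is the value of
    the product at 0, which is 0. *)
Lemma euler_negative H n : (forall z, cabs z < 1 -> euler H (- n.+1%:R) z) ->
  forall z, cabs z < 1 -> H z = 0.
Proof.
move=> hH; pose K x := H x * x ^+ n.+1.
have hK z : cabs z < 1 -> euler K 0 z.
  by move=> z1; have := eulerM (hH z z1) (eulerX z n.+1); rewrite addNr.
have [|c hc] := @euler0_cst K; first by move=> z z1 _; exact: hK.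
have [d hd _] : euler K 0 0 by apply: hK; rewrite cabs0.
have c0 : c = 0 by rewrite -(cdiff_eq_at0 hd hc) /K expr0n/= mulr0.
move=> z z1; have [->|z0] := eqVneq z 0.
  have [d' _ /eqP] : euler H (- n.+1%:R) 0 by apply: hH; rewrite cabs0.
  by rewrite mul0r eq_sym mulf_eq0 oppr_eq0 pnatr_eq0/= => /eqP.
have := hc z z1 z0; rewrite /K c0 => /eqP; rewrite mulf_eq0 expf_eq0/= (negbTE z0) orbF.
by move/eqP.
Qed.

End EulerEquation.

Section Characters.
Variable R : realType.

Definition circle_character (chi : R[i] -> R[i]) (kap : R[i]) :=
  [/\ forall v, cabs v = 1 -> cabs (chi v) = 1,
      forall x y, chi (x * y) = chi x * chi y &
      exists C : R, forall v, cabs v = 1 ->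
        cabs (chi v - 1 + kap * (v - 1)) <= C * cabs (v - 1) ^+ 2].

Lemma circle_character1 : circle_character (fun=> 1) 0.
Proof.
split=> [v _|x y|]; [exact: cabs1|by rewrite mulr1|exists 0 => v _].
by rewrite subrr mul0r addr0 cabs0 mul0r.
Qed.

Lemma circle_character_id : circle_character id (-1).
Proof. by split=> //; exists 0 => v _; rewrite mulN1r subrr cabs0 mul0r. Qed.

Lemma circle_character_conj : circle_character (fun v => v^*) 1.
Proof.
split=> [v|x y|]; [by rewrite cabs_conj|by rewrite rmorphM|exists 1 => v v1].
have vv : v * v^* = 1 by rewrite -cabs_sqr v1 expr1n.
rewrite mul1r mul1r (_ : v^* - 1 + (v - 1) = - ((v - 1) * (v - 1)^*)).
  by rewrite cabsN cabsM cabs_conj.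
by rewrite rmorphB rmorph1 /=; rewrite [RHS](_ : _ = v + v^* - 1 - v * v^*); [rewrite vv|]; ring.
Qed.

Lemma circle_characterM chi psi k l : circle_character chi k -> circle_character psi l ->
  circle_character (fun v => chi v * psi v) (k + l).
Proof.
move=> [u1 m1 [C hC]] [u2 m2 [D hD]]; split.
- by move=> v v1; rewrite cabsM u1// u2// mulr1.
- by move=> x y; rewrite m1 m2 mulrACA.
exists (C + D + (2 * C + cabs k) * cabs l) => v v1.
have C0 : 0 <= C.
  have := hC (-1); rewrite cabsN cabs1 => /(_ erefl) h.
  have : 0 <= C * cabs (-1 - 1 : R[i]) ^+ 2 by exact: le_trans (cabs_ge0 _) h.
  by rewrite pmulr_lge0// exprn_gt0// (_ : -1 - 1 = - 2%:R) ?cabsN ?cabs_nat//; ring.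
set t := v - 1.
have t2 : cabs t <= 2 by rewrite (le_trans (cabsB _ _))// v1 cabs1.
have c1 : cabs (chi v - 1) <= (2 * C + cabs k) * cabs t.
  rewrite (_ : chi v - 1 = (chi v - 1 + k * t) - k * t); last by ring.
  rewrite (le_trans (cabsB _ _))// mulrDl cabsM lerD2r (le_trans (hC _ v1))//.
  by rewrite expr2 mulrA ler_wpM2r ?cabs_ge0// mulrC ler_wpM2r.
rewrite (_ : _ + _ = (chi v - 1 + k * t) + chi v * (psi v - 1 + l * t) - (chi v - 1) * (l * t)); last by rewrite /t; ring.
rewrite (le_trans (cabsB _ _))// [leRHS]mulrDl lerD//.
  by rewrite (le_trans (cabsD _ _))// [leRHS]mulrDl lerD ?hC// cabsM u1// mul1r hD.
rewrite !cabsM expr2.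
rewrite (_ : (2 * C + cabs k) * cabs l * (cabs t * cabs t) = (2 * C + cabs k) * cabs t * (cabs l * cabs t)); last by ring.
by rewrite ler_wpM2r// mulr_ge0 ?cabs_ge0.
Qed.

Lemma circle_characterX chi k n : circle_character chi k ->
  circle_character (fun v => chi v ^+ n) (n%:R * k).
Proof.
move=> h; elim: n => [|n IH].
  by rewrite mul0r; exact: circle_character1.
rewrite -nat1r mulrDl mul1r; under eq_fun do rewrite exprS.
exact: circle_characterM.
Qed.

Lemma circle_character_biexp a b :
  circle_character (fun v => v ^+ a * v^* ^+ b) (b%:R - a%:R).
Proof.
have := circle_characterM (circle_characterX a circle_character_id)
  (circle_characterX b circle_character_conj).
by rewrite mulrN1 mulr1 addrC.
Qed.

End Characters.

(** * Fejer kernels and Fejer means *)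

Section FejerMeans.
Variable R : realType.
Local Notation w := (@dyadic_root R).

Definition dirichlet N (v : R[i]) := \sum_(a < N) v ^+ a.
(** The kernel as |D_N|^2 / N: positivity is visible, and [fejerE] expands it in characters of the
    circle, with conjugates in place of inverses. *)
Definition fejer N (v : R[i]) := N%:R^-1 * (dirichlet N v * (dirichlet N v)^*).

Lemma fejerE N v : fejer N v = N%:R^-1 * \sum_(a < N) \sum_(b < N) v ^+ a * v^* ^+ b.
Proof.
rewrite /fejer /dirichlet mulr_suml; congr (_ * _); apply: eq_bigr => a _.
by rewrite rmorph_sum mulr_sumr; apply: eq_bigr => b _; rewrite rmorphXn.
Qed.

Lemma cabs_fejer N v : (cabs (fejer N v))%:C%C = fejer N v.
Proof.
by rewrite cabsE ger0_norm// mulr_ge0 ?invr_ge0 ?ler0n// -normCK exprn_ge0.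
Qed.

(** [(v - 1) * dirichlet N v] telescopes to [v ^+ N - 1], of modulus at most 2. This second moment
    expresses the concentration of the kernel at 1. *)
Lemma fejer_moment N v : cabs v = 1 -> cabs (v - 1) ^+ 2 * cabs (fejer N v) <= 4 / N%:R.
Proof.
move=> v1; rewrite !cabsM cabsV cabs_nat cabs_conj -expr2 mulrCA -exprMn -cabsM.
rewrite -subrX1 mulrC ler_wpM2r ?invr_ge0//.
rewrite (_ : 4 = (1 + 1) ^+ 2 :> R); last by rewrite -natr1; ring.
rewrite ler_pXn2r ?nnegrE ?cabs_ge0// (le_trans (cabsB _ _))// cabsX v1 expr1n cabs1//.
Qed.

(** A geometric sum whose ratio [q] is a root of unity of order dividing [2 ^ j.+1]; the bounds on
    [a] and [b] exclude [q = 1] unless [a = b]. *)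
Lemma circle_mean_biexp j a b : (a < 2 ^ j.+1)%N -> (b < 2 ^ j.+1)%N ->
  circle_mean j (fun v : R[i] => v ^+ a * v^* ^+ b) = (a == b)%:R.
Proof.
move=> aM bM; pose q := w j ^+ a * (w j)^* ^+ b.
have ww : w j * (w j)^* = 1 by rewrite -cabs_sqr dyadic_root_unit expr1n.
have wM : w j ^+ (2 ^ j.+1) = 1 by exact/prim_expr_order/dyadic_root_prim.
rewrite /circle_mean (eq_bigr (fun k : 'I__ => q ^+ k)); last first.
  move=> k _; rewrite /q rmorphXn/= exprMn -!exprM.
  by rewrite (mulnC k a) (mulnC k b).
have [ab|ab] := eqVneq a b.
  rewrite (eq_bigr (fun=> 1)); last by move=> k _; rewrite /q ab -exprMn ww !expr1n.
  by rewrite sumr_const card_ord mulVf// pnatr_eq0 -lt0n expn_gt0.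
have qM : q ^+ (2 ^ j.+1) = 1.
  rewrite /q exprMn -!exprM (mulnC a) (mulnC b) (exprM (w j)) (exprM (w j)^*) -rmorphXn/= wM.
  by rewrite rmorph1 !expr1n mulr1.
have q1 : q - 1 != 0.
  rewrite subr_eq0; apply/eqP => E.
  have : w j ^+ a = w j ^+ b by rewrite -[RHS]mul1r -E /q -mulrA -exprMn [X in X ^+ b]mulrC ww expr1n mulr1.
  move/eqP; rewrite (eq_prim_root_expr (dyadic_root_prim R j)) !modn_small//.
  by rewrite (negbTE ab).
have : (q - 1) * \sum_(k < 2 ^ j.+1) q ^+ k = 0 by rewrite -subrX1 qM subrr.
by move=> /eqP; rewrite mulf_eq0 (negbTE q1)/= => /eqP ->; rewrite mulr0.
Qed.

Lemma circle_mean_sum j (I : Type) (r : seq I) (u : I -> R[i] -> R[i]) :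
  circle_mean j (fun v => \sum_(i <- r) u i v) = \sum_(i <- r) circle_mean j (u i).
Proof. by rewrite /circle_mean exchange_big mulr_sumr. Qed.

Lemma circle_mean_fejer N j : (0 < N)%N -> (N <= 2 ^ j.+1)%N -> circle_mean j (fejer N) = 1.
Proof.
move=> N0 NM.
have -> : fejer N = fun v : R[i] => N%:R^-1 * \sum_(a < N) \sum_(b < N) v ^+ a * v^* ^+ b.
  by apply/funext => v; exact: fejerE.
rewrite circle_meanZ circle_mean_sum (eq_bigr (fun=> 1)).
  by rewrite sumr_const card_ord mulVf// pnatr_eq0 -lt0n.
move=> a _; rewrite circle_mean_sum (bigD1 a)//= circle_mean_biexp ?(leq_trans (ltn_ord _) NM)// eqxx.
rewrite big1 ?addr0// => b ba; rewrite circle_mean_biexp ?(leq_trans (ltn_ord _) NM)//.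
by rewrite -val_eqE eq_sym/= in ba; rewrite (negbTE ba).
Qed.

Lemma circle_mean_dom j (u : R[i] -> R[i]) (g : R[i] -> R) :
  (forall v, cabs v = 1 -> cabs (u v) <= g v) ->
  ((cabs (circle_mean j u))%:C%C <= circle_mean j (fun v => (g v)%:C%C)).
Proof.
move=> ug; have m0 : 0 < (2 ^ j.+1)%:R :> R by rewrite ltr0n expn_gt0.
rewrite /circle_mean -rmorph_sum -(rmorph_nat (real_complex R)) -fmorphV -rmorphM/= lecR.
rewrite cabsM cabs_real gtr0_norm ?invr_gt0// ler_wpM2l ?invr_ge0//.
rewrite (le_trans (cabs_sum _ _ _))//; apply: ler_sum => k _; apply: ug.
by rewrite cabsX dyadic_root_unit expr1n.
Qed.

Variables (f df : R[i] -> R[i]) (L : R).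
Hypothesis f_df : forall z, cabs z < 1 -> cdiff f z (df z).
Hypothesis df_le : forall z, cabs z < 1 -> cabs (df z) <= L.
Hypothesis df_cont : forall z, cabs z < 1 -> exists d, cdiff df z d.

Let L0 : 0 <= L.
Proof. by apply: le_trans (cabs_ge0 _) (df_le (z := 0) _); rewrite cabs0. Qed.

Let zv (z v : R[i]) : cabs v = 1 -> cabs z < 1 -> cabs (z * v) < 1.
Proof. by move=> v1 z1; rewrite cabsM v1 mulr1. Qed.

(** [p.[z]] is the ultralimit of the averages of [fejer N v * f (z * v)]. Rotations preserve the
    Lipschitz constant, and so does an average with positive weights of total 1. The distance to [f]
    follows from [cabs (v - 1) <= d + cabs (v - 1) ^+ 2 / d] and the second moment of the kernel. *)
Lemma fejer_polynomial N : (0 < N)%N ->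
  exists p : {poly R[i]},
    (forall z v, cabs z < 1 -> cabs v < 1 -> cabs (p.[z] - p.[v]) <= L * cabs (z - v)) /\
    (forall d : R, 0 < d -> forall z, cabs z < 1 ->
       cabs (p.[z] - f z) <= L * (d + 4 / N%:R / d)).
Proof.
move=> N0; have [U UU Uoo] := nat_ultrafilter.
(* Characters with [a > b] pick Taylor terms of negative degree, which vanish; the others pick the
   degree [b - a]. *)
have coef (a b : nat) : exists c : R[i], forall z, cabs z < 1 ->
    ultra_cvg U (fun j => circle_mean j (fun v => f (z * v) * (v ^+ a * v^* ^+ b)))
      (if (a <= b)%N then c * z ^+ (b - a) else 0).
  pose chi v : R[i] := v ^+ a * v^* ^+ b; pose kap : R[i] := b%:R - a%:R.
  have [u1 m1 C1] : circle_character chi kap by exact: circle_character_biexp.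
  have [[H B] /= hHB] := coefficient_limits f_df df_le L0 UU u1.
  have hH z (z1 : cabs z < 1) := (hHB z z1).1.
  have hB z (z1 : cabs z < 1) := (hHB z z1).2.
  have eul z : cabs z < 1 -> euler H kap z.
    move=> z1; exists (B z).
      exact: (coefficient_cdiff f_df df_cont UU Uoo u1 hH hB z1).
    exact: (coefficient_euler f_df df_le df_cont L0 UU Uoo u1 m1 C1 hH hB z1).
  have [ab|ab] := leqP a b.
    have [c hc] : exists c, forall z, cabs z < 1 -> H z = c * z ^+ (b - a).
      by apply: euler_monomial => z /eul; rewrite /kap natrB.
    by exists c => z z1; rewrite -hc//; exact: hH.
  exists 0 => z z1; rewrite -(@euler_negative _ H (a - b).-1 _ z)//; first exact: hH.
  move=> x /eul; rewrite prednK ?subn_gt0// natrB ?opprB//; exact: ltnW.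
have /choice[c hc] : forall ab : nat * nat, exists c : R[i], forall z, cabs z < 1 ->
    ultra_cvg U (fun j => circle_mean j (fun v => f (z * v) * (v ^+ ab.1 * v^* ^+ ab.2)))
      (if (ab.1 <= ab.2)%N then c * z ^+ (ab.2 - ab.1) else 0) by case=> a b; exact: coef.
pose p : {poly R[i]} := N%:R^-1 *: \sum_(a < N) \sum_(b < N)
  (if (a <= b)%N then c (val a, val b) *: 'X^(b - a) else 0).
have hp z : cabs z < 1 -> ultra_cvg U (fun j => circle_mean j (fun v => fejer N v * f (z * v))) p.[z].
  move=> z1.
  have -> : (fun j => circle_mean j (fun v => fejer N v * f (z * v))) =
     (fun j => N%:R^-1 * \sum_(a < N) \sum_(b < N) circle_mean j (fun v => f (z * v) * (v ^+ a * v^* ^+ b))).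
    apply/funext => j; rewrite -(eq_bigr _ (fun a _ => circle_mean_sum j _ _)) -circle_mean_sum -circle_meanZ.
    congr circle_mean; apply/funext => v; rewrite fejerE -mulrA; congr (_ * _).
    rewrite mulr_suml; apply: eq_bigr => a _; rewrite mulr_suml; apply: eq_bigr => b _.
    by rewrite mulrC.
  rewrite /p hornerZ !horner_sum; apply: (ultra_cvgZ UU); apply: (ultra_cvg_sum UU) => a.
  rewrite horner_sum; apply: (ultra_cvg_sum UU) => b.
  have := hc (val a, val b) z z1; rewrite /=; case: ifP => _; last by rewrite horner0.
  by rewrite hornerZ hornerXn.
have big j : (N <= j)%N -> (N <= 2 ^ j.+1)%N.
  by move=> Nj; rewrite (leq_trans Nj)// (leq_trans (leqnSn j))// ltnW// ltn_expl.
have flip z v : cabs z < 1 -> cabs v < 1 -> cabs (f z - f v) <= L * cabs (z - v).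
  exact: (disk_lipschitz f_df df_le).
exists p; split=> [z z' z1 z'1|d d0 z z1].
  apply: (ultra_cvg_le UU Uoo (N := N) (ultra_cvgB UU (hp z z1) (hp z' z'1))) => j Nj.
  rewrite -circle_meanB -lecR.
  apply: le_trans (circle_mean_dom j (g := fun v => L * cabs (z - z') * cabs (fejer N v)) _) _.
    move=> v v1; rewrite -mulrBr cabsM mulrC ler_wpM2r ?cabs_ge0//.
    by rewrite (le_trans (flip _ _ (zv v1 z1) (zv v1 z'1)))// -mulrBl cabsM v1 mulr1.
  under eq_fun do rewrite rmorphM/= cabs_fejer.
  by rewrite circle_meanZ circle_mean_fejer ?mulr1// big.
apply: (ultra_cvg_le UU Uoo (N := N) (ultra_cvgB UU (hp z z1) (ultra_cvg_cst UU (f z)))) => j Nj.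
have -> : f z = circle_mean j (fun v => fejer N v * f z).
  under eq_fun do rewrite mulrC.
  by rewrite circle_meanZ circle_mean_fejer ?mulr1// big.
rewrite -circle_meanB -lecR.
apply: le_trans (circle_mean_dom j (g := fun v => L * d * cabs (fejer N v) + L * (4 / N%:R / d)) _) _.
  move=> v v1; rewrite -mulrBr cabsM; set F := cabs (fejer N v).
  have F0 : 0 <= F by exact: cabs_ge0.
  rewrite (le_trans (ler_wpM2l F0 (flip _ _ (zv v1 z1) z1)))//.
  rewrite -{2}(mulr1 z) -mulrBr cabsM; set t := cabs (v - 1).
  have tF : t ^+ 2 * F <= 4 / N%:R by exact: fejer_moment.
  have t0 : 0 <= t by exact: cabs_ge0.
  rewrite mulrCA -!mulrA -mulrDr ler_wpM2l//.
  apply: (@le_trans _ _ (F * t)); first by rewrite mulrCA ler_piMl ?mulr_ge0// ltW.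
  have tt : t <= d + t ^+ 2 / d.
    rewrite -(ler_pM2r d0) mulrDl divfK ?gt_eqF//.
    by have := sqr_ge0 (t - d); nra.
  rewrite mulrC (le_trans (ler_wpM2r F0 tt))// mulrDl lerD2l [leLHS]mulrAC [leRHS]mulrA.
  by rewrite ler_wpM2r// invr_ge0 ltW.
under eq_fun do rewrite rmorphD rmorphM/= cabs_fejer.
rewrite circle_meanD circle_meanZ circle_mean_fejer ?mulr1 ?big// circle_mean_cst.
by rewrite -rmorphD lecR mulrDr.
Qed.

Lemma disk_polynomial_approx (e : R) : 0 < e ->
  exists p : {poly R[i]},
    (forall z v, cabs z < 1 -> cabs v < 1 -> cabs (p.[z] - p.[v]) <= L * cabs (z - v)) /\
    (forall z, cabs z < 1 -> cabs (p.[z] - f z) <= e).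
Proof.
move=> e0; have L1 : 0 < L + 1 by rewrite ltr_wpDl.
(* With [1 / N <= d ^+ 2 / 4] the two summands of the bound are at most [d] each, and
   [L * (d + d) <= e]. *)
pose d := e / (L + 1) / 2; have d0 : 0 < d by rewrite !divr_gt0.
have d2 : 0 < d ^+ 2 / 4 by rewrite divr_gt0// exprn_gt0.
have [N _ hN] := near_infty_natSinv_lt (PosNum d2).
have [p [hp1 hp2]] := @fejer_polynomial N.+1 isT.
exists p; split=> // z z1; rewrite (le_trans (hp2 d d0 z z1))//.
have h : 4 / N.+1%:R / d <= d.
  have /= /ltW h := hN N (leqnn N).
  rewrite ler_pdivrMr// -expr2.
  apply: le_trans (_ : 4 * (d ^+ 2 / 4) <= _); first by rewrite ler_pM2l.
  by rewrite mulrC divfK.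
rewrite (le_trans (ler_wpM2l L0 (lerD (lexx d) h)))//.
have E : e = (L + 1) * (d + d) by rewrite /d; field; rewrite gt_eqF.
by rewrite [leRHS]E ler_wpM2r ?addr_ge0 ?(ltW d0)// lerDl.
Qed.

End FejerMeans.

(** * Boundary extension and approximation on the closed disk *)

Section ClosedDisk.
Variable R : realType.
Variable phi : R[i]^o -> R[i]^o.
Hypothesis phi_analytic : analytic_on_disk phi.
Hypothesis dphi_Hinfty : Hinfty (derive1 phi).

Let inD (z : R[i]) : cabs z < 1 -> unit_disk (z : R[i]^o).
Proof. by move=> z1; rewrite /unit_disk/= -cabsE -[1]/(1%:C%C) ltcR. Qed.

Let Din (z : R[i]) : unit_disk (z : R[i]^o) -> cabs z < 1.
Proof. by rewrite /unit_disk/= -cabsE -[1]/(1%:C%C) ltcR. Qed.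

Lemma derivative_bound : exists2 L : R, 0 <= L &
  forall z : R[i], cabs z < 1 -> cabs (derive1 phi z) <= L.
Proof.
have [_ [M hM]] := dphi_Hinfty; exists (cabs M) => [|z z1]; first exact: cabs_ge0.
rewrite -lecR !cabsE (le_trans (hM z (inD z1)))//.
have M0 : 0 <= M by apply: le_trans (hM 0 (inD _)); rewrite ?normr_ge0// cabs0.
by rewrite ger0_norm.
Qed.

Let phi_cdiff (z : R[i]) : cabs z < 1 -> cdiff phi z (derive1 phi z).
Proof. by move=> z1; apply: derivable_cdiff; exact/phi_analytic/inD. Qed.

Let dphi_cont (z : R[i]) : cabs z < 1 -> exists d, cdiff (derive1 phi) z d.
Proof.
move=> z1; exists (derive1 (derive1 phi) z); apply: derivable_cdiff.
by have [h _] := dphi_Hinfty; exact/h/inD.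
Qed.

Let shrink (z : R[i]) (t : R) : cabs z <= 1 -> 0 < t -> t < 1 ->
  cabs ((1 - t)%:C%C * z) < 1 /\ cabs ((1 - t)%:C%C * z - z) <= t.
Proof.
move=> z1 t0 t1; split.
  rewrite cabsM cabs_real gtr0_norm ?subr_gt0//.
  by rewrite (le_lt_trans (ler_wpM2l _ z1)) ?subr_ge0 ?(ltW t1)//; lra.
rewrite (_ : _ - z = - (t%:C%C * z)); last by rewrite rmorphB rmorph1; ring.
by rewrite cabsN cabsM cabs_real gtr0_norm// ler_piMr// ltW.
Qed.

(** Along the radius to [z] the values of [phi] are bounded and have an ultralimit [l]. The
    Lipschitz bound passes to [l] and shows that [phi] tends to [l] within the whole disk, so [l] is
    the extension at [z]. *)
Lemma closed_disk_extension_lipschitz (L : R) :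
  (forall z : R[i], cabs z < 1 -> cabs (derive1 phi z) <= L) ->
  forall z v : R[i], cabs z <= 1 -> cabs v < 1 ->
  cabs (closed_disk_extension phi z - phi v) <= L * cabs (z - v).
Proof.
move=> hL.
have L0 : 0 <= L by apply: le_trans (cabs_ge0 _) (hL 0 _); rewrite cabs0.
have lip (x y : R[i]) : cabs x < 1 -> cabs y < 1 -> cabs (phi x - phi y) <= L * cabs (x - y).
  exact: (disk_lipschitz phi_cdiff hL).
move=> z v z1 v1.
have [U UU Uoo] := nat_ultrafilter.
pose t (n : nat) : R := n.+2%:R^-1.
have t01 n : 0 < t n /\ t n < 1.
  by rewrite /t invr_gt0 ltr0n invf_lt1 ?ltr0n// ltr1n.
pose zn n : R[i] := (1 - t n)%:C%C * z.
have zn1 n : cabs (zn n) < 1 by have [? ?] := t01 n; case: (@shrink z (t n)).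
have znz n : cabs (zn n - z) <= t n by have [? ?] := t01 n; case: (@shrink z (t n)).
have [|l hl] := @ultra_cvg_ex R _ U UU (fun n => phi (zn n)) (cabs (phi 0) + L).
  move=> n; rewrite -(subrK (phi 0) (phi (zn n))) (le_trans (cabsD _ _))// addrC lerD2l.
  rewrite (le_trans (lip _ _ _ _)) ?cabs0// subr0 -[leRHS]mulr1 ler_wpM2l//; exact: ltW.
have near_t (e : R) : 0 < e -> exists N, forall n, (N <= n)%N -> t n <= e.
  move=> e0; have [N _ hN] := near_infty_natSinv_lt (PosNum e0).
  exists N => n Nn; have /= := hN n.+1; rewrite leqW// => /(_ isT)/ltW h.
  by rewrite (le_trans _ h)// /t lef_pV2 ?posrE ?ltr0n// ler_nat.
have hlv x : cabs x < 1 -> cabs (l - phi x) <= L * cabs (z - x).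
  move=> x1; apply/ler_addgt0Pr => e e0.
  have L1 : 0 < L + 1 by rewrite ltr_wpDl.
  have [N hN] := near_t _ (divr_gt0 e0 L1).
  have := ultra_cvgB UU hl (ultra_cvg_cst UU (phi x)).
  move=> /(ultra_cvg_le UU Uoo (N := N)); apply => n /hN tn.
  rewrite (le_trans (lip _ _ (zn1 n) x1))//.
  rewrite (le_trans (ler_wpM2l L0 (cabs_dist z (zn n) x)))// mulrDr addrC lerD2l.
  rewrite (le_trans (ler_wpM2l L0 (le_trans (znz n) tn)))// mulrA ler_pdivrMr// mulrC.
  by rewrite ler_wpM2l ?(ltW e0)// lerDl.
suff -> : closed_disk_extension phi z = l by exact: hlv.
rewrite /closed_disk_extension; apply: (@cvg_lim R[i]^o (@norm_hausdorff _ _)).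
(* The limit within the disk is unique because the radial points enter every neighbourhood of
   [z]. *)
have PF : ProperFilter (within (@unit_disk R) (nbhs (z : R[i]^o))).
  split; last exact: within_filter.
  move=> /nbhs_ballP[_ /= /posC_ex[e e0 ->]] hP.
  have [N hN] := near_t (e / 2) (divr_gt0 e0 (ltr0n _ 2)).
  apply: (hP (zn N)); last exact: inD.
  rewrite -ball_normE/= -cabsE ltcR cabsC (le_lt_trans (znz N))//.
  by rewrite (le_lt_trans (hN N _))//; lra.
exact: PF.
apply/cvg_cabsP => e e0; apply/nbhs_ballP.
have L1 : 0 < L + 1 by rewrite ltr_wpDl.
exists (e / (L + 1))%:C%C => /=; first by rewrite ltcR divr_gt0.
move=> x; rewrite -ball_normE/= -cabsE ltcR => zx /Din x1.
rewrite (le_lt_trans (hlv x x1))//.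
apply: (@le_lt_trans _ _ ((L + 1) * cabs (z - x))).
  by rewrite ler_wpM2r ?cabs_ge0// lerDl.
by rewrite mulrC -ltr_pdivlMr.
Qed.

Lemma closed_disk_polynomials : exists (L : R) (p : nat -> {poly R[i]}),
  [/\ 0 <= L,
      forall e : R, 0 < e -> exists N, forall n, (N <= n)%N ->
        forall z, cabs z <= 1 -> cabs ((p n).[z] - closed_disk_extension phi z) <= e,
      forall n z v, cabs z <= 1 -> cabs v <= 1 -> cabs ((p n).[z] - (p n).[v]) <= L * cabs (z - v) &
      forall z v, cabs z <= 1 -> cabs v <= 1 ->
        cabs (closed_disk_extension phi z - closed_disk_extension phi v) <= L * cabs (z - v)].
Proof.
have [L L0 hL] := derivative_bound.
have ext := closed_disk_extension_lipschitz hL.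
pose t (n : nat) : R := n.+2%:R^-1.
have t01 n : 0 < t n /\ t n < 1.
  by rewrite /t invr_gt0 ltr0n invf_lt1 ?ltr0n// ltr1n.
have near_t (e : R) : 0 < e -> exists N, forall n, (N <= n)%N -> t n <= e.
  move=> e0; have [N _ hN] := near_infty_natSinv_lt (PosNum e0).
  exists N => n Nn; have /= := hN n.+1; rewrite leqW// => /(_ isT)/ltW h.
  by rewrite (le_trans _ h)// /t lef_pV2 ?posrE ?ltr0n// ler_nat.
have /choice[q hq] : forall n, exists q : {poly R[i]},
    (forall z v, cabs z < 1 -> cabs v < 1 -> cabs (q.[z] - q.[v]) <= L * cabs (z - v)) /\
    (forall z, cabs z < 1 -> cabs (q.[z] - phi z) <= t n).
  by move=> n; apply: (disk_polynomial_approx phi_cdiff hL dphi_cont); case: (t01 n).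
have sh z n : cabs z <= 1 -> cabs ((1 - t n)%:C%C * z) < 1 /\ cabs ((1 - t n)%:C%C * z - z) <= t n.
  by move=> z1; have [? ?] := t01 n; apply: shrink.
(* [q n] is controlled on the open disk only; the contraction brings the closed disk inside it and
   keeps the constant [L]. It costs [L * t n] in [papp], besides the [t n] of [q n]. *)
pose p n := q n \Po ((1 - t n)%:C%C *: 'X).
have pE n z : (p n).[z] = (q n).[(1 - t n)%:C%C * z].
  by rewrite horner_comp hornerZ hornerX.
have papp n z : cabs z <= 1 -> cabs ((p n).[z] - closed_disk_extension phi z) <= (L + 1) * t n.
  move=> z1; have [s1 s2] := sh z n z1; rewrite pE.
  rewrite (le_trans (cabs_dist (phi ((1 - t n)%:C%C * z)) _ _))// mulrDl mul1r addrC lerD//.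
    by rewrite cabsC (le_trans (ext _ _ z1 s1))// ler_wpM2l// cabsC.
  by case: (hq n) => _; apply.
have pconv (e : R) : 0 < e -> exists N, forall n, (N <= n)%N ->
    forall z, cabs z <= 1 -> cabs ((p n).[z] - closed_disk_extension phi z) <= e.
  move=> e0; have L1 : 0 < L + 1 by rewrite ltr_wpDl.
  have [N hN] := near_t _ (divr_gt0 e0 L1); exists N => n /hN tn z z1.
  by rewrite (le_trans (papp n z z1))// mulrC -ler_pdivlMr.
have plip n z v : cabs z <= 1 -> cabs v <= 1 -> cabs ((p n).[z] - (p n).[v]) <= L * cabs (z - v).
  move=> z1 v1; rewrite !pE; have [h _] := hq n.
  rewrite (le_trans (h _ _ (sh z n z1).1 (sh v n v1).1))// ler_wpM2l// -mulrBr cabsM.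
  have [? ?] := t01 n.
  rewrite cabs_real ger0_norm ?subr_ge0 ?(ltW (t01 n).2)// ler_piMl ?cabs_ge0//; lra.
exists L, p; split=> // z v z1 v1; apply/ler_addgt0Pr => e e0.
have [N hN] := pconv _ (divr_gt0 e0 (ltr0n _ 2)).
have := hN N (leqnn N) z z1; have := hN N (leqnn N) v v1; have := plip N z v z1 v1.
set a := _.[z]; set b := _.[v]; set x := closed_disk_extension phi z; set y := closed_disk_extension phi v.
move=> h1 h2 h3; rewrite (_ : x - y = (a - b) - (a - x) + (b - y)); last by ring.
rewrite (le_trans (cabsD _ _))// (le_trans (lerD (le_trans (cabsB _ _) (lerD h1 h3)) h2))//.
by rewrite -addrA -splitr.
Qed.

End ClosedDisk.

(** * Operators on Hilbert spaces *)

Section HilbertOperators.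
Variable R : realType.

Definition linear_op (H K : hilbertType R) (A : H -> K) :=
  forall (a : R[i]) x y, A (a *: x + y) = a *: A x + A y.

Section LinearOp.
Variables (H K : hilbertType R) (A : H -> K).
Hypothesis lA : linear_op A.

Lemma linop0 : A 0 = 0.
Proof. by have := lA (-1) 0 0; rewrite scaler0 addr0 scaleN1r addNr. Qed.

Lemma linopD x y : A (x + y) = A x + A y.
Proof. by have := lA 1 x y; rewrite !scale1r. Qed.

Lemma linopZ a x : A (a *: x) = a *: A x.
Proof. by have := lA a x 0; rewrite linop0 !addr0. Qed.

Lemma linopN x : A (- x) = - A x.
Proof. by rewrite -scaleN1r linopZ scaleN1r. Qed.

Lemma linopB x y : A (x - y) = A x - A y.
Proof. by rewrite linopD linopN. Qed.

Lemma linop_sum (I : Type) (r : seq I) (P : pred I) (G : I -> H) :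
  A (\sum_(i <- r | P i) G i) = \sum_(i <- r | P i) A (G i).
Proof. by apply: (big_morph A) => [x y|]; [exact: linopD|exact: linop0]. Qed.
End LinearOp.

Section Inner.
Variable H : hilbertType R.
Implicit Types x y z : H.

Lemma inner_rn x : inner x x = (rn x ^+ 2)%:C%C.
Proof. by rewrite inner_norm rmorphXn/= rnE. Qed.

Lemma normsq_rn x : normsq x = rn x ^+ 2.
Proof. by apply: complexI; rewrite normsqE rmorphXn/= rnE. Qed.

Lemma cabs_inner x y : cabs (inner x y) <= rn x * rn y.
Proof. by rewrite -lecR rmorphM/= cabsE !rnE cauchy_schwarz. Qed.

Lemma inner_extr x y : (forall z, inner z x = inner z y) -> x = y.
Proof.
move=> h; apply/eqP; rewrite -subr_eq0; apply/eqP/inner_eq0.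
by rewrite innerBr h subrr.
Qed.

Lemma inner_extl x y : (forall z, inner x z = inner y z) -> x = y.
Proof.
move=> h; apply/eqP; rewrite -subr_eq0; apply/eqP/inner_eq0.
by rewrite innerBl h subrr.
Qed.

Lemma rn_sqrD x y : rn (x + y) ^+ 2 = rn x ^+ 2 + rn y ^+ 2 + 2 * complex.Re (inner x y).
Proof. by rewrite -!normsq_rn normsqD. Qed.

Lemma rn_le_inner x (M : R) : 0 <= M ->
  (forall y, cabs (inner x y) <= M * rn y) -> rn x <= M.
Proof.
move=> M0 /(_ x); rewrite inner_rn cabs_real ger0_norm ?sqr_ge0// expr2.
have [->|x0] := eqVneq (rn x) 0; first by [].
by rewrite ler_pM2r// lt_neqAle eq_sym x0 rn_ge0.
Qed.

Lemma inner_sumlP (I : Type) (r : seq I) (P : pred I) (u : I -> H) y :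
  inner (\sum_(i <- r | P i) u i) y = \sum_(i <- r | P i) inner (u i) y.
Proof. by apply: (big_morph (fun x => inner x y)) => [a b|]; rewrite ?innerDl ?inner0l. Qed.

Lemma inner_sumrP (I : Type) (r : seq I) (P : pred I) (u : I -> H) x :
  inner x (\sum_(i <- r | P i) u i) = \sum_(i <- r | P i) inner x (u i).
Proof. by apply: (big_morph (inner x)) => [a b|]; rewrite ?innerDr ?inner0r. Qed.

Lemma pythagoras (I : finType) (P : pred I) (u : I -> H) :
  (forall i j, i != j -> inner (u i) (u j) = 0) ->
  rn (\sum_(i | P i) u i) ^+ 2 = \sum_(i | P i) rn (u i) ^+ 2.
Proof.
move=> h; apply: complexI; rewrite -inner_rn rmorph_sum/= inner_sumlP.
apply: eq_bigr => i Pi; rewrite inner_sumrP (bigD1 i)//= big1 ?addr0 ?inner_rn//.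
by move=> j /andP[_ ji]; apply: h; rewrite eq_sym.
Qed.

(* Minimise [rn x ^+ 2 - 2 * Re (l x)]: a minimiser represents [l]. *)
Lemma riesz (l : H -> R[i]) (M : R) :
  (forall a x y, l (a *: x + y) = a * l x + l y) ->
  (forall x, cabs (l x) <= M * rn x) -> exists v, forall x, l x = inner x v.
Proof.
move=> ll lM.
have l0 : l 0 = 0.
  have := ll 1 0 0; rewrite scaler0 addr0 mul1r => h.
  by apply: (addrI (l 0)); rewrite addr0 -h.
have lZ a x : l (a *: x) = a * l x by have := ll a x 0; rewrite l0 !addr0.
have lD x y : l (x + y) = l x + l y by have := ll 1 x y; rewrite scale1r mul1r.
have ReZ (t : R) (z : R[i]) : complex.Re (t%:C%C * z) = t * complex.Re z.
  by case: z => a b /=; rewrite mul0r subr0.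
pose q x : R := rn x ^+ 2 - 2 * complex.Re (l x).
have qlb x : - M ^+ 2 <= q x.
  have h1 : complex.Re (l x) <= M * rn x.
    by rewrite (le_trans _ (lM x))// (le_trans (ler_norm _) (Re_le_cabs _)).
  rewrite /q; have := sqr_ge0 (rn x - M); nra.
pose S := [set q x | x in setT].
have hS : has_inf S.
  by split; [exists (q 0), 0|exists (- M ^+ 2) => _ [x _ <-]].
set m := inf S.
have mq x : m <= q x by apply: ge_inf; [case: hS|exists x].
have /choice[u hu] : forall n : nat, exists x, q x < m + n.+1%:R^-1.
  move=> n; have [|_ [x _ <-] hx] := @inf_adherent _ S (n.+1%:R^-1) _ hS.
    by rewrite invr_gt0 ltr0n.
  by exists x.
(* Parallelogram law, with [q] evaluated at the midpoint [z]: minimizing sequences are Cauchy. *)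
have par x y : rn (x - y) ^+ 2 <= 2 * ((q x - m) + (q y - m)).
  pose z := (2^-1 : R)%:C%C *: (x + y).
  have /(_ z) := mq; rewrite /q /z rnZ cabs_real lZ lD ReZ raddfD/=.
  rewrite ger0_norm ?invr_ge0// exprMn.
  have := rn_sqrD x y; have := rn_sqrD x (- y); rewrite innerNr raddfN/= rnN.
  set a := rn (x - y) ^+ 2; set b := rn (x + y) ^+ 2; set c := rn x ^+ 2; set d := rn y ^+ 2.
  have -> : (2^-1 : R) ^+ 2 = 1 / 4 by field.
  set e := complex.Re (l x); set f := complex.Re (l y); set g := complex.Re _.
  lra.
have [v hv] : exists v, forall e : R, 0 < e -> exists N, forall n, (N <= n)%N -> rn (v - u n) <= e.
  apply: complete_seq => e e0.
  have e4 : 0 < e ^+ 2 / 4 by rewrite divr_gt0// exprn_gt0.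
  have [N _ hN] := near_infty_natSinv_lt (PosNum e4).
  exists N => n k Nn Nk; rewrite -(@ler_pXn2r _ 2) ?nnegrE ?rn_ge0 ?(ltW e0)//.
  have /= h1 := hN n Nn; have /= h2 := hN k Nk.
  have h3 : q (u n) < m + e ^+ 2 / 4 by rewrite (lt_trans (hu n))// ltrD2l.
  have h4 : q (u k) < m + e ^+ 2 / 4 by rewrite (lt_trans (hu k))// ltrD2l.
  rewrite (le_trans (par _ _))//.
  by move: h3 h4; set a := q _; set b := q _; set c := e ^+ 2; lra.
have var w : complex.Re (inner v w) = complex.Re (l w).
  pose d := complex.Re (inner v w) - complex.Re (l w).
  (* This is [q (v + t w) >= q v], the limit of [m <= q (u n + t w)] with [u n] almost minimal. *)
  have key (t : R) : 0 <= 2 * t * d + t ^+ 2 * rn w ^+ 2.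
    apply/ler_addgt0Pr => e e0.
    pose c := 2 * `|t| * rn w + 1; have c0 : 0 < c by rewrite ltr_wpDl// !mulr_ge0// rn_ge0.
    have [N1 hN1] := hv _ (divr_gt0 (divr_gt0 e0 (ltr0n _ 2)) c0).
    have [N2 _ hN2] := near_infty_natSinv_lt (PosNum (divr_gt0 e0 (ltr0n _ 2))).
    pose n := maxn N1 N2.
    have h1 := hN1 n (leq_maxl _ _); have /= h2 := hN2 n (leq_maxr _ _).
    have hun : q (u n) < m + e / 2 by rewrite (lt_trans (hu n))// ltrD2l.
    have := mq (u n + t%:C%C *: w); move: hun.
    rewrite /q rn_sqrD rnZ cabs_real exprMn real_normK ?num_real// innerZr lD lZ.
    rewrite raddfD/= ReZ.
    have -> : (t%:C%C)^* = t%:C%C :> R[i] by exact: conjc_real.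
    rewrite ReZ => h3 h4.
    have h5 : `|complex.Re (inner v w) - complex.Re (inner (u n) w)| <= rn (v - u n) * rn w.
      rewrite -raddfB/= -innerBl; exact: le_trans (Re_le_cabs _) (cabs_inner _ _).
    have h6 : 2 * `|t| * (rn (v - u n) * rn w) <= e / 2.
      apply: (@le_trans _ _ (e / 2 / c * c)); last by rewrite divfK// gt_eqF.
      rewrite mulrCA; apply: ler_pM => //; rewrite ?rn_ge0 ?mulr_ge0 ?rn_ge0//.
      by rewrite /c lerDl.
    have h7 : 2 * t * (complex.Re (inner (u n) w) - complex.Re (inner v w)) <= e / 2.
      rewrite (le_trans (ler_norm _))// !normrM (ger0_norm (_ : 0 <= 2))// distrC.
      by rewrite (le_trans _ h6)// ler_wpM2l// mulr_ge0.
    have -> : 2 * t * d = 2 * t * complex.Re (inner (u n) w) - 2 * t * complex.Re (l w)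
       - 2 * t * (complex.Re (inner (u n) w) - complex.Re (inner v w)) by rewrite /d; ring.
    lra.
  have r0 : 0 <= rn w ^+ 2 by exact: sqr_ge0.
  have r1 : 0 < rn w ^+ 2 + 1 by rewrite ltr_wpDl.
  (* The best [t] would be [- d / rn w ^+ 2]; adding 1 to the denominator avoids the case
     [w = 0]. *)
  have := key (- d / (rn w ^+ 2 + 1)).
  have -> : 2 * (- d / (rn w ^+ 2 + 1)) * d + (- d / (rn w ^+ 2 + 1)) ^+ 2 * rn w ^+ 2
    = - (d ^+ 2 * (rn w ^+ 2 + 2) / (rn w ^+ 2 + 1) ^+ 2) by field; rewrite gt_eqF.
  rewrite oppr_ge0 pmulr_lle0 ?invr_gt0 ?exprn_gt0// pmulr_lle0; last by rewrite ltr_wpDl.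
  move=> d2; apply/eqP; rewrite -subr_eq0 -/d -sqrf_eq0 eq_le d2 sqr_ge0//.
exists v => x; rewrite inner_conj.
(* The real parts at ['i%C *: x] give the imaginary parts at [x]. *)
have h1 := var x; have := var ('i%C *: x).
rewrite innerZr lZ complexiE conjCi.
case: (inner v x) h1 => a b; case: (l x) => c d; rewrite -complexiE /= !(mul0r, mul1r, mulN1r, oppr0) => -> h.
have -> : d = - b by move: h; simpc; lra.
by [].
Qed.

End Inner.

Lemma adjoint_exists (H K : hilbertType R) (A : H -> K) (M : R) :
  linear_op A -> (forall x, rn (A x) <= M * rn x) ->
  exists B : K -> H, forall x y, inner (A x) y = inner x (B y).
Proof.
move=> lA bA; suff /choice[B hB] : forall y, exists b, forall x, inner (A x) y = inner x b.
  by exists B => x y; exact: hB.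
move=> y; apply: (@riesz _ _ (M * rn y)).
  by move=> a x z; rewrite lA innerDl innerZl.
move=> x; rewrite (le_trans (cabs_inner _ _))// mulrAC ler_wpM2r ?rn_ge0//.
Qed.

Lemma adjoint_linear (H K : hilbertType R) (A : H -> K) (B : K -> H) :
  (forall x y, inner (A x) y = inner x (B y)) -> linear_op B.
Proof.
move=> h a x y; apply: inner_extr => z.
by rewrite innerDr innerZr -!h innerDr innerZr.
Qed.

Lemma adjoint_le (H K : hilbertType R) (A : H -> K) (B : K -> H) (M : R) : 0 <= M ->
  (forall x, rn (A x) <= M * rn x) ->
  (forall x y, inner (A x) y = inner x (B y)) -> forall y, rn (B y) <= M * rn y.
Proof.
move=> M0 bA h y; apply: rn_le_inner => [|x]; first by rewrite mulr_ge0 ?rn_ge0.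
rewrite inner_conj cabs_conj -h (le_trans (cabs_inner _ _))// mulrAC ler_wpM2r ?rn_ge0//.
Qed.

(** The quadratic form is real at [x + y] and at [x + i y], which gives the imaginary and the real
    part of the identity. *)
Lemma positive_selfadjoint (H : hilbertType R) (A : H -> H) : linear_op A ->
  (forall x, 0 <= inner (A x) x) -> forall x y, inner (A x) y = inner x (A y).
Proof.
move=> lA pA x y.
have im z : complex.Im (inner (A z) z) = 0 by apply: ger0_Im; exact: pA.
have h1 := im (x + y); have h2 := im (x + 'i%C *: y).
move: h1 h2; rewrite !linopD// linopZ// !innerDl !innerDr !innerZl !innerZr !raddfD/= !im.
have ci : ('i%C : R[i])^* = - 'i%C by rewrite complexiE conjCi.
rewrite ci => h1 h2; rewrite [RHS]inner_conj; move: h1 h2.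
have := im y; case: (inner (A y) y) => e f /= ->.
case: (inner (A x) y) => a b; case: (inner (A y) x) => c d.
rewrite -[(_)^*]/((c -i* d)%C) /= !(mul0r, mul1r, mulN1r, oppr0, addr0, add0r, subr0, mulr0, opprK).
by simpc => h1 h2; apply/eqP; rewrite eq_complex/=; apply/andP; split; apply/eqP; lra.
Qed.

(** [A - A^2 = (1 - A) A (1 - A) + A (1 - A) A], and both summands are positive. *)
Lemma positive_contraction_sqr (H : hilbertType R) (A : H -> H) : linear_op A ->
  (forall x, 0 <= inner (A x) x) -> (forall x, inner (A x) x <= inner x x) ->
  forall x, (rn (A x) ^+ 2)%:C%C <= inner (A x) x.
Proof.
move=> lA pA cA x.
have sA := positive_selfadjoint lA pA.
have h1 := pA (x - A x); have h2 := cA (A x).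
rewrite -inner_rn -subr_ge0.
have -> : inner (A x) x - inner (A x) (A x) =
  inner (A (x - A x)) (x - A x) + (inner (A x) (A x) - inner (A (A x)) (A x)).
  by rewrite linopB// innerBl !innerBr (sA (A x) x); ring.
by rewrite addr_ge0// subr_ge0.
Qed.

End HilbertOperators.

(** * Spectral measures and integrals of bounded functions *)

Section SemiSpectral.
Variables (d : measure_display) (X : measurableType d) (R : realType).
Variables (H : hilbertType R) (E : set X -> H -> H).
Hypothesis hE : semispectral_measure E.
Implicit Types (A B D : set X) (x y : H).

Lemma sem_lin D : measurable D -> linear_op (E D).
Proof. by case: hE => h _ _ _ /h[[lD _] _]; exact: lD. Qed.

Lemma sem_pos D x : measurable D -> 0 <= inner (E D x) x.
Proof. by case: hE => h _ _ _ /h[_]. Qed.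

Lemma sem0 x : E set0 x = 0.
Proof. by case: hE => _ -> _ _. Qed.

Lemma semT x : E setT x = x.
Proof. by case: hE => _ _ -> _. Qed.

Lemma sem_sa D x y : measurable D -> inner (E D x) y = inner x (E D y).
Proof.
by move=> mD; apply: positive_selfadjoint; [exact: sem_lin|move=> z; exact: sem_pos].
Qed.

Lemma sem_sigma (D : (set X)^nat) x y : (forall n, measurable (D n)) -> trivIset setT D ->
  forall e : R, 0 < e -> exists N, forall n, (N <= n)%N ->
  cabs (inner (E (\bigcup_n D n) x) y - \sum_(k < n) inner (E (D k) x) y) <= e.
Proof.
move=> mD tD e e0; case: hE => _ _ _ /(_ D mD tD x y) h.
have [N _ hN] := (cvg_cabsP _ _).1 h e e0.
by exists N => n /hN/= /ltW.
Qed.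

Lemma semU A B x : measurable A -> measurable B -> A `&` B = set0 ->
  E (A `|` B) x = E A x + E B x.
Proof.
move=> mA mB AB; apply: inner_extl => y; apply: eq_cabs_small => e e0.
have mAB n : measurable (bigcup2 A B n) by rewrite /bigcup2; case: ifP => // _; case: ifP.
have [|N hN] := @sem_sigma (bigcup2 A B) x y mAB _ e e0.
  by rewrite -trivIset_bigcup2.
suff S : \sum_(k < maxn N 2) inner (E (bigcup2 A B k) x) y = inner (E A x + E B x) y.
  by have := hN _ (leq_maxl N 2); rewrite bigcup2E S.
have := leq_maxr N 2; case: (maxn N 2) => [|[|n]]// _.
rewrite !big_ord_recl/= big1 ?addr0 ?innerDl// => i _.
by rewrite sem0 inner0l.
Qed.

Lemma sem_diff A B x : measurable A -> measurable B -> B `<=` A ->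
  E (A `\` B) x = E A x - E B x.
Proof.
move=> mA mB BA; apply: (addrI (E B x)); rewrite addrC -semU//; last 2 first.
- exact: measurableD.
- by rewrite -subset0 => t [[_ nB] Bt]; exact: nB.
by rewrite [RHS]addrC subrK setDE setUIl setvU setIT; congr E; apply/setUidPl.
Qed.

Lemma semC A x : measurable A -> E (~` A) x = x - E A x.
Proof. by move=> mA; rewrite -setTD sem_diff// semT. Qed.

Lemma sem_le A x : measurable A -> inner (E A x) x <= inner x x.
Proof.
move=> mA; rewrite -subr_ge0 -innerBl -semC//; apply: sem_pos; exact: measurableC.
Qed.

Lemma sem_contr A x : measurable A -> rn (E A x) <= rn x.
Proof.
move=> mA; rewrite -(@ler_pXn2r _ 2) ?nnegrE ?rn_ge0// -lecR -[leRHS]inner_rn.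
apply: le_trans (sem_le x mA).
by apply: positive_contraction_sqr => [|z|z]; [exact: sem_lin|exact: sem_pos|exact: sem_le].
Qed.

(** Countable additivity over the differences of consecutive sets, whose partial sums telescope. *)
Lemma sem_decr (A : (set X)^nat) x y : (forall n, measurable (A n)) ->
  (forall n, A n.+1 `<=` A n) -> (forall t, exists n, ~ A n t) ->
  forall e : R, 0 < e -> exists N, forall n, (N <= n)%N -> cabs (inner (E (A n) x) y) <= e.
Proof.
move=> mA sA A0 e e0.
have sA' n m : (n <= m)%N -> A m `<=` A n.
  by move=> /subnK <-; elim: (m - n)%N => // k IH; apply: subset_trans IH; rewrite addSn.
pose D n := A n `\` A n.+1.
have mD n : measurable (D n) by exact: measurableD.
have tD : trivIset setT D.
  apply: ltn_trivIset => n m nm; rewrite -subset0 => t [[_ h1] [h2 _]].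
  by apply: h1; exact: sA' h2.
have UD : \bigcup_n D n = A 0.
  apply/seteqP; split=> [t [n _ [+ _]]|t At]; first exact: sA'.
  have ex : exists n, `[< ~ A n t >] by have [n ?] := A0 t; exists n; apply/asboolP.
  have := ex_minnP ex; case=> -[|n] /asboolP h hmin; first by [].
  exists n => //; split => //; apply: contrapT => /asboolP/hmin; rewrite ltnn//.
have tel n : \sum_(k < n) inner (E (D k) x) y = inner (E (A 0) x) y - inner (E (A n) x) y.
  elim: n => [|n IH]; first by rewrite big_ord0 subrr.
  rewrite big_ord_recr/= IH /D sem_diff// innerBl; ring.
have [N hN] := sem_sigma x y mD tD e0; exists N => n /hN.
by rewrite UD tel opprB addrC subrK.
Qed.

End SemiSpectral.

Section Spectral.
Variables (d : measure_display) (X : measurableType d) (R : realType).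
Variables (K : hilbertType R) (F : set X -> K -> K).
Hypothesis hF : spectral_measure F.
Implicit Types (A B D : set X) (x y v : K).

Let sF : semispectral_measure F. Proof. by case: hF. Qed.

Lemma sp_idem D x : measurable D -> F D (F D x) = F D x.
Proof. by case: hF => _ h /h/(congr1 (fun f => f x)). Qed.

Lemma sp_sqr D x : measurable D -> inner (F D x) x = (rn (F D x) ^+ 2)%:C%C.
Proof. by move=> mD; rewrite -inner_rn -(sem_sa sF)// sp_idem. Qed.

(** For [y = F B x] additivity turns the bound [sem_le] for the union into
    [inner (F A y) y + inner y y <= inner y y]. *)
Lemma sp_disj A B x : measurable A -> measurable B -> A `&` B = set0 -> F A (F B x) = 0.
Proof.
move=> mA mB AB; apply: rn_eq0; apply/eqP; rewrite -sqrf_eq0 eq_le sqr_ge0 andbT.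
have := sem_le sF (F B x) (measurableU _ _ mA mB).
rewrite (semU sF)// innerDl sp_sqr// [X in _ + X <= _](_ : _ = inner (F B x) (F B x)); last by rewrite sp_idem.
by rewrite -lerBrDr subrr -(rmorph0 (real_complex R)) lecR.
Qed.

Lemma sp_sub A B x : measurable A -> measurable B -> B `<=` A -> F A (F B x) = F B x.
Proof.
move=> mA mB BA.
have := sem_diff sF (F B x) mA mB BA; rewrite sp_disj//; first by move/esym/eqP; rewrite subr_eq0 sp_idem// => /eqP.
  exact: measurableD.
by rewrite setDE -setIA setICl setI0.
Qed.

Lemma sp_cap A B x : measurable A -> measurable B -> F A (F B x) = F (A `&` B) x.
Proof.
move=> mA mB.
have mAB : measurable (A `&` B) by exact: measurableI.
have AB : A `&` B `<=` B by exact: subIsetr.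
have -> : F B x = F (A `&` B) x + F (B `\` (A `&` B)) x.
  by rewrite (sem_diff sF)// addrC subrK.
rewrite (linopD (sem_lin sF mA)) sp_sub// ?sp_disj ?addr0//.
  exact: measurableD.
by rewrite -subset0 => t [At [Bt]]; apply; split.
Qed.

End Spectral.

(** * Simple functions and their uniform limits *)

Section SimpleSums.
Variables (d : measure_display) (X : measurableType d) (R : realType).

(** A finite measurable partition given by the map to its index set, so that a common refinement is
    a pair of maps. Empty pieces are allowed. *)
Definition classifier (I : finType) (q : X -> I) := forall i, measurable (q @^-1` [set i]).

Lemma classifier_preimage (I : finType) (q : X -> I) (J : set I) :
  classifier q -> measurable (q @^-1` J).
Proof.
move=> mq; rewrite (_ : q @^-1` J = \bigcup_(i in J) (q @^-1` [set i])).
  by apply: fin_bigcup_measurable.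
by apply/seteqP; split=> [t Jt|t [i Ji /= ->]]//; exists (q t).
Qed.

Lemma classifier_pair (I I' : finType) (q : X -> I) (q' : X -> I') :
  classifier q -> classifier q' -> classifier (fun t => (q t, q' t)).
Proof.
move=> mq mq' [i i']; rewrite (_ : _ @^-1` _ = q @^-1` [set i] `&` q' @^-1` [set i']).
  exact: measurableI.
by apply/seteqP; split=> [t /= [<- <-]|t [/= -> ->]].
Qed.

Section Sums.
Variables (K : hilbertType R) (F : set X -> K -> K).
Variable I : finType.
Variable q : X -> I.
Hypothesis mq : classifier q.

Definition ssum (c : I -> R[i]) (v : K) : K := \sum_i c i *: F (q @^-1` [set i]) v.

Lemma sem_fibers (sF : semispectral_measure F) (J : pred I) v :
  F (q @^-1` [set i | J i]) v = \sum_(i | J i) F (q @^-1` [set i]) v.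
Proof.
have key (s : seq I) : uniq s ->
    F (q @^-1` [set i | i \in s]) v = \sum_(i <- s) F (q @^-1` [set i]) v.
  elim: s => [_|i s IH /= /andP[iNs us]].
    rewrite big_nil (_ : _ @^-1` _ = set0) ?(sem0 sF)//.
    by rewrite -subset0 => t.
  rewrite big_cons -IH// -(semU sF)//; last 2 first.
  - exact: classifier_preimage.
  - by rewrite -subset0 => t /= [->]; exact/negP.
  congr (F _ v); apply/seteqP; split=> t /=.
    by rewrite in_cons => /orP[/eqP|]; [left|right].
  by rewrite in_cons => -[->|->]; rewrite ?eqxx ?orbT.
rewrite -big_enum -key ?enum_uniq//; congr (F _ v).
by apply/seteqP; split=> t /=; rewrite mem_enum.
Qed.

Lemma ssum_lin (sF : semispectral_measure F) c : linear_op (ssum c).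
Proof.
move=> a x y; rewrite /ssum scaler_sumr -big_split/=; apply: eq_bigr => i _.
by rewrite (sem_lin sF)// scalerDr !scalerA mulrC.
Qed.

Lemma ssumD c c' v : ssum (fun i => c i + c' i) v = ssum c v + ssum c' v.
Proof. by rewrite /ssum -big_split/=; apply: eq_bigr => i _; rewrite scalerDl. Qed.

Lemma ssumB c c' v : ssum (fun i => c i - c' i) v = ssum c v - ssum c' v.
Proof. by rewrite /ssum -sumrB; apply: eq_bigr => i _; rewrite scalerBl. Qed.

Hypothesis hF : spectral_measure F.
Let sF : semispectral_measure F. Proof. by case: hF. Qed.

Lemma fibers_ortho i j x y : i != j ->
  inner (F (q @^-1` [set i]) x) (F (q @^-1` [set j]) y) = 0.
Proof.
move=> ij; rewrite (sem_sa sF)// (sp_disj hF) ?inner0r//.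
by rewrite -subset0 => t /= [-> /eqP]; exact/negP.
Qed.

Lemma ssum_le c v (M : R) : 0 <= M -> (forall t, cabs (c (q t)) <= M) ->
  rn (ssum c v) <= M * rn v.
Proof.
move=> M0 cM; rewrite -(@ler_pXn2r _ 2) ?nnegrE ?mulr_ge0 ?rn_ge0//.
have {2}-> : v = \sum_i F (q @^-1` [set i]) v.
  by rewrite -(sem_fibers sF xpredT) (_ : _ @^-1` _ = setT) ?(semT sF)//; apply/seteqP.
rewrite exprMn !pythagoras//; last 2 first.
- by move=> i j ij; rewrite fibers_ortho.
- by move=> i j ij; rewrite innerZl innerZr fibers_ortho// !mulr0.
rewrite mulr_sumr; apply: ler_sum => i _; rewrite rnZ exprMn.
(* An index that [q] does not take has no bound on its coefficient, but its piece is empty. *)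
have [[t qt]|ni] := pselect (exists t, q t = i).
  by rewrite ler_wpM2r ?sqr_ge0// ler_pXn2r ?nnegrE ?cabs_ge0// -qt.
rewrite (_ : q @^-1` [set i] = set0) ?(sem0 sF) ?rn0 ?expr0n/= ?mulr0//.
by rewrite -subset0 => t /= qt; apply: ni; exists t.
Qed.

Lemma ssumM c c' v : ssum c (ssum c' v) = ssum (fun i => c i * c' i) v.
Proof.
rewrite {1}/ssum; apply: eq_bigr => i _; rewrite -scalerA; congr (_ *: _).
rewrite (linop_sum (sem_lin sF _))// (bigD1 i)//= big1 ?addr0.
  by rewrite (linopZ (sem_lin sF _))// (sp_idem hF).
move=> j ji; rewrite (linopZ (sem_lin sF _))// (sp_disj hF) ?scaler0//.
by rewrite -subset0 => t /= [-> /esym/eqP]; exact/negP.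
Qed.

End Sums.

Lemma ssum_comp (K : hilbertType R) (F : set X -> K -> K) (I J : finType)
    (q : X -> I) (r : I -> J) (c : J -> R[i]) v :
  semispectral_measure F -> classifier q ->
  ssum F (r \o q) c v = ssum F q (c \o r) v.
Proof.
move=> sF mq; rewrite /ssum (partition_big r xpredT)//=; apply: eq_bigr => j _.
rewrite (eq_bigr (fun i => c j *: F (q @^-1` [set i]) v)); last by move=> i /eqP ->.
rewrite -scaler_sumr -(sem_fibers mq sF (fun i => r i == j)); congr (_ *: F _ v).
by apply/seteqP; split=> t /eqP.
Qed.

Definition snear (I : finType) (g : X -> R[i]) (q : X -> I) (c : I -> R[i]) (e : R) :=
  forall t, cabs (g t - c (q t)) <= e.

(** On the common refinement the difference is the sum of one simple function, of modulus at most
    [e + e'] at the values taken. *)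
Lemma ssum_diff (K : hilbertType R) (F : set X -> K -> K) (I J : finType)
    (g : X -> R[i]) (q : X -> I) (q' : X -> J) c c' (e e' : R) v :
  spectral_measure F -> classifier q -> classifier q' -> 0 <= e -> 0 <= e' ->
  snear g q c e -> snear g q' c' e' ->
  rn (ssum F q c v - ssum F q' c' v) <= (e + e') * rn v.
Proof.
move=> hF mq mq' e0 e'0 gq gq'; have [sF _] := hF.
pose p t := (q t, q' t).
have mp : classifier p by exact: classifier_pair.
rewrite -[q]/(fst \o p) -[q']/(snd \o p) !ssum_comp// -ssumB.
apply: ssum_le => // [|t]; first by rewrite addr_ge0.
have /= := cabs_dist (g t) (c (q t)) (c' (q' t)).
by move=> /le_trans; apply; rewrite lerD// cabsC.
Qed.

(* These are exactly the bounded measurable functions. *)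
Definition simple_approx (g : X -> R[i]) := forall e : R, 0 < e ->
  exists (I : finType) (q : X -> I) (c : I -> R[i]), classifier q /\ snear g q c e.

Lemma simple_approx2 g h : simple_approx g -> simple_approx h -> forall e : R, 0 < e ->
  exists (I : finType) (q : X -> I) (c c' : I -> R[i]),
    [/\ classifier q, snear g q c e & snear h q c' e].
Proof.
move=> hg hh e e0; have [I [q [c [mq gq]]]] := hg e e0.
have [J [q' [c' [mq' hq']]]] := hh e e0.
exists (I * J)%type, (fun t => (q t, q' t)), (c \o fst), (c' \o snd).
by split => //; exact: classifier_pair.
Qed.

Lemma simple_bounded g : simple_approx g -> exists2 M : R, 0 <= M & forall t, cabs (g t) <= M.
Proof.
move=> /(_ 1 ltr01)[I [q [c [_ gq]]]]; exists (1 + \sum_i cabs (c i)).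
  by rewrite addr_ge0// sumr_ge0// => i _; exact: cabs_ge0.
move=> t; rewrite -(subrK (c (q t)) (g t)) (le_trans (cabsD _ _))// lerD//.
by rewrite (bigD1 (q t))//= lerDl sumr_ge0// => i _; exact: cabs_ge0.
Qed.

Lemma simple_approx_cst a : simple_approx (fun=> a).
Proof.
move=> e e0; exists unit, (fun=> tt), (fun=> a); split=> [i|t]; last by rewrite subrr cabs0 ltW.
by rewrite (_ : _ @^-1` _ = setT)//; apply/seteqP; split=> // t _ /=; case: i.
Qed.

Lemma simple_approxD g h : simple_approx g -> simple_approx h ->
  simple_approx (fun t => g t + h t).
Proof.
move=> hg hh e e0; have [I [q [c [c' [mq gq hq]]]]] := simple_approx2 hg hh (divr_gt0 e0 (ltr0n _ 2)).
exists I, q, (fun i => c i + c' i); split=> // t; rewrite opprD addrACA.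
by rewrite (le_trans (cabsD _ _))// (le_trans (lerD (gq t) (hq t)))// -splitr.
Qed.

Lemma simple_approxM g h : simple_approx g -> simple_approx h ->
  simple_approx (fun t => g t * h t).
Proof.
move=> hg hh e e0; have [M M0 gM] := simple_bounded hg; have [N N0 hN] := simple_bounded hh.
(* The 1 bounds the approximating values of [g] by [M + 1]. *)
pose e' := Num.min 1 (e / (N + M + 1)).
have P : 0 < N + M + 1 by rewrite ltr_wpDl// addr_ge0.
have e'0 : 0 < e' by rewrite lt_min ltr01 divr_gt0.
have e'1 : e' <= 1 by rewrite ge_min lexx.
have e'e : e' * (N + M + 1) <= e by rewrite -ler_pdivlMr// ge_min lexx orbT.
have [I [q [c [c' [mq gq hq]]]]] := simple_approx2 hg hh e'0.
exists I, q, (fun i => c i * c' i); split=> // t.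
rewrite (_ : _ - _ = (g t - c (q t)) * h t + c (q t) * (h t - c' (q t))); last by ring.
apply: le_trans e'e; rewrite (le_trans (cabsD _ _))// !cabsM.
have cM : cabs (c (q t)) <= M + 1.
  rewrite -(subrK (g t) (c (q t))) (le_trans (cabsD _ _))// addrC lerD// cabsC.
  exact: le_trans (gq t) e'1.
apply: (@le_trans _ _ (e' * N + (M + 1) * e')); last by rewrite le_eqVlt; apply/orP; left; apply/eqP; ring.
by rewrite lerD// ler_pM ?cabs_ge0.
Qed.

Lemma simple_approxZ a g : simple_approx g -> simple_approx (fun t => a * g t).
Proof. by move=> hg; apply: simple_approxM => //; exact: simple_approx_cst. Qed.

Lemma simple_approxB g h : simple_approx g -> simple_approx h ->
  simple_approx (fun t => g t - h t).
Proof.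
move=> hg /(simple_approxZ (-1)) hh; have := simple_approxD hg hh.
by under eq_fun do rewrite mulN1r.
Qed.

Lemma simple_approxX g n : simple_approx g -> simple_approx (fun t => g t ^+ n).
Proof.
move=> hg; elim: n => [|n IH]; first exact: simple_approx_cst.
by under eq_fun do rewrite exprS; exact: simple_approxM.
Qed.

Lemma simple_approx_sum (I : Type) (r : seq I) (g : I -> X -> R[i]) :
  (forall i, simple_approx (g i)) -> simple_approx (fun t => \sum_(i <- r) g i t).
Proof.
move=> hg; elim: r => [|i r IH].
  by under eq_fun do rewrite big_nil; exact: simple_approx_cst.
by under eq_fun do rewrite big_cons; exact: simple_approxD.
Qed.

Lemma simple_approx_conj g : simple_approx g -> simple_approx (fun t => (g t)^*).
Proof.
move=> hg e /hg[I [q [c [mq gq]]]]; exists I, q, (fun i => (c i)^*); split=> // t.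
by rewrite -rmorphB/= cabs_conj.
Qed.

Lemma simple_approx_unif g : (forall e : R, 0 < e ->
    exists2 h, simple_approx h & forall t, cabs (g t - h t) <= e) -> simple_approx g.
Proof.
move=> hg e e0; have e2 : 0 < e / 2 by rewrite divr_gt0.
have [h hh gh] := hg _ e2; have [I [q [c [mq hq]]]] := hh _ e2.
exists I, q, c; split=> // t; rewrite (le_trans (cabs_dist (h t) _ _))//.
by rewrite (le_trans (lerD (gh t) (hq t)))// -splitr.
Qed.

Definition cindic (A : set X) (t : X) : R[i] := (`[< A t >])%:R.

Lemma classifier_bool A : measurable A -> classifier (fun t => `[< A t >]).
Proof.
move=> mA [].
  by rewrite (_ : _ @^-1` _ = A)//; apply/seteqP; split=> t /= /asboolP.
rewrite (_ : _ @^-1` _ = ~` A); first exact: measurableC.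
by apply/seteqP; split=> t /=; [move/asboolP|move=> nA; apply/asboolP].
Qed.

Lemma simple_approx_indic A : measurable A -> simple_approx (cindic A).
Proof.
move=> mA e e0; exists bool, (fun t => `[< A t >]), (fun b : bool => b%:R); split.
  exact: classifier_bool.
by move=> t; rewrite subrr cabs0 ltW.
Qed.

End SimpleSums.

Lemma simple_approx_comp (R : realType) (d d' : measure_display) (X : measurableType d)
    (Y : measurableType d') (f : X -> Y) (g : Y -> R[i]) :
  measurable_fun setT f -> simple_approx g -> simple_approx (g \o f).
Proof.
move=> mf hg e /hg[I [q [c [mq gq]]]]; exists I, (q \o f), c; split=> [i|t]; last exact: gq.
by rewrite comp_preimage -[X in measurable X]setTI; exact: mf.
Qed.

Section SpectralIntegral.
Variables (d : measure_display) (X : measurableType d) (R : realType).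
Variables (K : hilbertType R) (F : set X -> K -> K).
Hypothesis hF : spectral_measure F.
Let sF : semispectral_measure F. Proof. by case: hF. Qed.
Implicit Types (g h : X -> R[i]) (B : K -> K).

(** The error bound is asked of every simple function near [g] rather than of one sequence, so
    comparison with any convenient approximation is available by definition. *)
Definition is_sint g B := forall (I : finType) (q : X -> I) (c : I -> R[i]) (e : R),
  0 <= e -> classifier q -> snear g q c e -> forall v, rn (B v - ssum F q c v) <= e * rn v.

Lemma is_sint_exists g : simple_approx g -> exists B, is_sint g B.
Proof.
move=> hg.
have /choice[s hs] : forall n : nat, exists s : K -> K,
    forall (I : finType) (q : X -> I) (c : I -> R[i]) (e : R), 0 <= e -> classifier q -> snear g q c e ->
    forall v, rn (s v - ssum F q c v) <= (n.+1%:R^-1 + e) * rn v.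
  move=> n; have n0 : 0 < n.+1%:R^-1 :> R by rewrite invr_gt0 ltr0n.
  have [I [q [c [mq gq]]]] := hg _ n0; exists (ssum F q c) => J q' c' e e0 mq' gq' v.
  by apply: (ssum_diff v hF mq mq' _ e0 gq gq'); exact: ltW.
have cs v : exists l, forall e : R, 0 < e -> exists N, forall n, (N <= n)%N -> rn (l - s n v) <= e.
  apply: complete_seq => e e0.
  have v1 : 0 < 4 * (rn v + 1) by rewrite mulr_gt0// ltr_wpDl// rn_ge0.
  have d0 := divr_gt0 e0 v1; have [N _ hN] := near_infty_natSinv_lt (PosNum d0).
  exists N => n m Nn Nm; have [I [q [c [mq gq]]]] := hg _ d0.
  have h1 := hs n I q c _ (ltW d0) mq gq v; have h2 := hs m I q c _ (ltW d0) mq gq v.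
  have /= h3 := hN n Nn; have /= h4 := hN m Nm.
  set t := e / _ in h1 h2 h3 h4.
  have -> : e = t * (4 * (rn v + 1)) by rewrite /t divfK// gt_eqF.
  rewrite (le_trans (rn_dist (ssum F q c v) _ _))// (rnC (ssum F q c v)).
  have k1 : (n.+1%:R^-1 + t) * rn v <= (t + t) * rn v by rewrite ler_wpM2r ?rn_ge0// lerD2r ltW.
  have k2 : (m.+1%:R^-1 + t) * rn v <= (t + t) * rn v by rewrite ler_wpM2r ?rn_ge0// lerD2r ltW.
  have := le_trans h1 k1; have := le_trans h2 k2.
  have t0 : 0 <= t by exact: ltW.
  have r0 := rn_ge0 v.
  by nra.
have /choice[B hB] := cs; exists B => I q c e e0 mq gq v.
apply/ler_addgt0Pr => e' e'0.
have v1 : 0 < rn v + 1 by rewrite ltr_wpDl// rn_ge0.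
have e2 : 0 < e' / 2 by rewrite divr_gt0.
have [N1 h1] := hB v _ e2.
have [N2 _ h2] := near_infty_natSinv_lt (PosNum (divr_gt0 e2 v1)).
pose n := maxn N1 N2.
have k1 := h1 n (leq_maxl _ _); have /= /ltW k2 := h2 n (leq_maxr _ _).
rewrite (le_trans (rn_dist (s n v) _ _))// (le_trans (lerD k1 (hs n I q c e e0 mq gq v)))//.
rewrite mulrDl addrA [leRHS]addrC lerD2r [leRHS]splitr lerD2l.
rewrite (le_trans (ler_wpM2r (rn_ge0 v) k2))// mulrAC ler_pdivrMr// ler_wpM2l ?(ltW e2)//.
by rewrite lerDl.
Qed.

Definition sint g : K -> K := xget (fun=> 0) [set B | is_sint g B].

Lemma sintP g : simple_approx g -> is_sint g (sint g).
Proof.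
move=> /is_sint_exists[B hB]; rewrite /sint; case: xgetP => [B' ->//|h].
by case: (h B).
Qed.

(** The common criterion for the rules of calculus below: a simple function close to [g] whose sum
    is close to [w]. Restricting to [e <= 1] lets quadratic errors be absorbed in [C]. *)
Lemma sint_eq g v w : simple_approx g ->
  (exists C : R, forall e, 0 < e -> e <= 1 -> exists (I : finType) (q : X -> I) (c : I -> R[i]),
    [/\ classifier q, snear g q c (C * e) & rn (w - ssum F q c v) <= C * e]) ->
  sint g v = w.
Proof.
move=> hg [C hC]; apply: eq_rn_small => e e0.
pose D := `|C| + 1; have D0 : 0 < D by rewrite ltr_wpDl.
have v1 : 0 < rn v + 1 by rewrite ltr_wpDl// rn_ge0.
pose e' := Num.min 1 (e / (D * (rn v + 1))).
have e'0 : 0 < e' by rewrite lt_min ltr01 divr_gt0// mulr_gt0.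
have [I [q [c [mq gq wq]]]] : exists (I : finType) (q : X -> I) (c : I -> R[i]),
    [/\ classifier q, snear g q c (C * e') & rn (w - ssum F q c v) <= C * e'].
  by apply: hC; rewrite // ge_min lexx.
have CD : C * e' <= D * e' by rewrite ler_pM2r// (le_trans (ler_norm _))// lerDl.
have gq' : snear g q c (D * e') by move=> t; exact: le_trans (gq t) CD.
have De0 : 0 <= D * e' by rewrite mulr_ge0// ltW.
rewrite (le_trans (rn_dist (ssum F q c v) _ _))//.
rewrite (le_trans (lerD (sintP hg De0 mq gq' v) (le_trans _ CD)))//; first by rewrite rnC.
rewrite -[X in _ + X]mulr1 -mulrDr mulrAC -ler_pdivlMl// ?mulr_gt0//.
by rewrite mulrC ge_min lexx orbT.
Qed.

Lemma sint_near2 g h : simple_approx g -> simple_approx h -> forall e : R, 0 < e ->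
  exists (I : finType) (q : X -> I) (c c' : I -> R[i]),
    [/\ classifier q, snear g q c e, snear h q c' e,
      forall v, rn (sint g v - ssum F q c v) <= e * rn v &
      forall v, rn (sint h v - ssum F q c' v) <= e * rn v].
Proof.
move=> hg hh e e0; have [I [q [c [c' [mq gq hq]]]]] := simple_approx2 hg hh e0.
by exists I, q, c, c'; split=> // v; apply: sintP => //; exact: ltW.
Qed.

Lemma sint_lin g : simple_approx g -> linear_op (sint g).
Proof.
move=> hg a x y; apply: sint_eq => //.
exists (1 + cabs a * rn x + rn y) => e e0 e1.
have [I [q [c [mq gq]]]] := hg e e0; exists I, q, c.
have C1 : e <= (1 + cabs a * rn x + rn y) * e.
  by rewrite ler_peMl ?(ltW e0)// -addrA lerDl addr_ge0 ?mulr_ge0 ?cabs_ge0 ?rn_ge0.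
split=> // [t|]; first exact: le_trans (gq t) C1.
rewrite (ssum_lin mq sF) opprD addrACA -scalerBr (le_trans (rnD _ _))// rnZ.
have h1 := sintP hg (ltW e0) mq gq x; have h2 := sintP hg (ltW e0) mq gq y.
rewrite (le_trans (lerD (ler_wpM2l (cabs_ge0 a) h1) h2))//.
rewrite [leRHS](_ : _ = e + (cabs a * (e * rn x) + e * rn y)); last by ring.
by rewrite lerDr ltW.
Qed.

Lemma sintD g h v : simple_approx g -> simple_approx h ->
  sint (fun t => g t + h t) v = sint g v + sint h v.
Proof.
move=> hg hh; apply: sint_eq; first exact: simple_approxD.
exists (2 + 2 * rn v) => e e0 e1.
have [I [q [c [c' [mq gq hq gv hv]]]]] := sint_near2 hg hh e0.
have r0 : 0 <= rn v * e by rewrite mulr_ge0 ?rn_ge0 ?(ltW e0).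
exists I, q, (fun i => c i + c' i); split=> // [t|].
  rewrite opprD addrACA (le_trans (cabsD _ _))// (le_trans (lerD (gq t) (hq t)))//; nra.
rewrite ssumD opprD addrACA (le_trans (rnD _ _))// (le_trans (lerD (gv v) (hv v)))//; nra.
Qed.

Lemma sintM g h v : simple_approx g -> simple_approx h ->
  sint (fun t => g t * h t) v = sint g (sint h v).
Proof.
move=> hg hh; have [M M0 gM] := simple_bounded hg; have [N N0 hN] := simple_bounded hh.
apply: sint_eq; first exact: simple_approxM.
exists (N + (M + 1) + (rn (sint h v) + (M + 1) * rn v)) => e e0 e1.
have [I [q [c [c' [mq gq hq gv hv]]]]] := sint_near2 hg hh e0.
have cM t : cabs (c (q t)) <= M + 1.
  rewrite -(subrK (g t) (c (q t))) (le_trans (cabsD _ _))// addrC lerD// cabsC.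
  exact: le_trans (gq t) e1.
have M1 : 0 <= M + 1 by rewrite addr_ge0.
exists I, q, (fun i => c i * c' i); split=> // [t|].
  rewrite (_ : _ - _ = (g t - c (q t)) * h t + c (q t) * (h t - c' (q t))); last by ring.
  rewrite (le_trans (cabsD _ _))// !cabsM [leRHS]mulrDl.
  apply: (@le_trans _ _ (e * N + (M + 1) * e)).
    by rewrite lerD// ler_pM ?cabs_ge0.
  rewrite [leRHS](_ : _ = e * N + (M + 1) * e + (rn (sint h v) + (M + 1) * rn v) * e); last by ring.
  by rewrite lerDl mulr_ge0 ?(ltW e0)// addr_ge0 ?rn_ge0// mulr_ge0 ?rn_ge0.
rewrite -(ssumM mq hF) -(subrK (ssum F q c (sint h v)) (sint g _)) -addrA -(linopB (ssum_lin mq sF c)).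
rewrite (le_trans (rnD _ _))// (le_trans (lerD (gv _) (ssum_le mq hF _ M1 cM)))//.
rewrite (le_trans (lerD (lexx _) (ler_wpM2l M1 (hv v))))//.
rewrite [leRHS](_ : _ = e * (N + (M + 1)) + (e * rn (sint h v) + (M + 1) * (e * rn v))); last by ring.
by rewrite lerDr mulr_ge0 ?(ltW e0)// addr_ge0.
Qed.

Lemma sint_indic A v : measurable A -> sint (cindic R A) v = F A v.
Proof.
move=> mA; apply: sint_eq; first exact: simple_approx_indic.
exists 1 => e e0 e1; exists bool, (fun t => `[< A t >]), (fun b : bool => b%:R); split.
- exact: classifier_bool.
- by move=> t; rewrite subrr cabs0 mul1r ltW.
rewrite /ssum big_bool/= scale1r scale0r addr0 (_ : _ @^-1` _ = A) ?subrr ?rn0 ?mul1r ?(ltW e0)//.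
by apply/seteqP; split=> t /= /asboolP.
Qed.

Lemma sint_cst a v : sint (fun=> a) v = a *: v.
Proof.
apply: sint_eq; first exact: simple_approx_cst.
exists 1 => e e0 e1; exists unit, (fun=> tt), (fun=> a).
have E i : (fun _ : X => tt) @^-1` [set i] = setT by apply/seteqP; split=> // t _ /=; case: i.
split=> [i|t|]; [by rewrite E|by rewrite subrr cabs0 mul1r ltW|].
rewrite /ssum (eq_bigr (fun=> a *: v)) => [|i _]; last by rewrite E (semT sF).
by rewrite sumr_const card_unit mulr1n subrr rn0 mul1r ltW.
Qed.

Lemma sintZ a g v : simple_approx g -> sint (fun t => a * g t) v = a *: sint g v.
Proof. by move=> hg; rewrite sintM ?sint_cst//; exact: simple_approx_cst. Qed.

Lemma sintB g h v : simple_approx g -> simple_approx h ->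
  sint (fun t => g t - h t) v = sint g v - sint h v.
Proof.
move=> hg hh; rewrite -scaleN1r -sintZ// -sintD//; last exact: simple_approxZ.
by congr (sint _ v); apply/funext => t; rewrite mulN1r.
Qed.

Lemma sint_sum (I : Type) (r : seq I) (g : I -> X -> R[i]) v :
  (forall i, simple_approx (g i)) ->
  sint (fun t => \sum_(i <- r) g i t) v = \sum_(i <- r) sint (g i) v.
Proof.
move=> hg; elim: r => [|i r IH].
  by under eq_fun do rewrite big_nil; rewrite sint_cst scale0r big_nil.
rewrite big_cons -IH -sintD//; last exact: simple_approx_sum.
by congr (sint _ v); apply/funext => t; rewrite big_cons.
Qed.

Lemma sint_le g v (M : R) : simple_approx g -> 0 <= M -> (forall t, cabs (g t) <= M) ->
  rn (sint g v) <= M * rn v.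
Proof.
move=> hg M0 gM; apply/ler_addgt0Pr => e e0.
have P : 0 < 2 * (rn v + 1) by rewrite mulr_gt0// ltr_wpDl// rn_ge0.
have d0 := divr_gt0 e0 P; have [I [q [c [mq gq]]]] := hg _ d0.
have h1 := sintP hg (ltW d0) mq gq v; set t := e / _ in d0 gq h1.
have cM s : cabs (c (q s)) <= M + t.
  by rewrite -(subrK (g s) (c (q s))) (le_trans (cabsD _ _))// addrC lerD// cabsC.
have h2 := ssum_le mq hF v (addr_ge0 M0 (ltW d0)) cM.
rewrite -(subrK (ssum F q c v) (sint g v)) (le_trans (rnD _ _))// (le_trans (lerD h1 h2))//.
have -> : e = t * (2 * (rn v + 1)) by rewrite /t divfK// gt_eqF.
by have r0 := rn_ge0 v; have t0 := ltW d0; nra.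
Qed.

(** The form of dominated convergence used here: smallness off [A] and mere boundedness on [A]
    suffice when [F A v] is small. *)
Lemma sint_split g A v (e C : R) : simple_approx g -> measurable A -> 0 <= e -> 0 <= C ->
  (forall t, ~ A t -> cabs (g t) <= e) -> (forall t, A t -> cabs (g t) <= C) ->
  rn (sint g v) <= e * rn v + C * rn (F A v).
Proof.
move=> hg mA e0 C0 he hC.
have mcA : measurable (~` A) by exact: measurableC.
(* On [A] the indicator is written twice: one copy keeps the integrand below [C], the other becomes
   the projection [F A]. *)
have gE : g = fun t => g t * cindic R (~` A) t + g t * cindic R A t * cindic R A t.
  apply/funext => t; rewrite /cindic; have [At|nAt] := pselect (A t).
    by rewrite (_ : `[< (~` A) t >] = false) ?(asboolT At) ?mulr0 ?add0r ?mulr1//; apply/asboolP => /(_ At).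
  by rewrite (asboolT (nAt : (~` A) t)) (_ : `[< A t >] = false) ?mulr0 ?addr0 ?mulr1//; apply/asboolP.
have s1 : simple_approx (fun t => g t * cindic R (~` A) t).
  by apply: simple_approxM => //; exact: simple_approx_indic.
have s2 : simple_approx (fun t => g t * cindic R A t).
  by apply: simple_approxM => //; exact: simple_approx_indic.
rewrite gE sintD//; last by apply: simple_approxM => //; exact: simple_approx_indic.
rewrite [X in _ + X]sintM//; last exact: simple_approx_indic.
rewrite sint_indic// (le_trans (rnD _ _))// lerD//; apply: sint_le => // t.
  rewrite /cindic; have [At|nAt] := pselect (A t).
    by rewrite (_ : `[< (~` A) t >] = false) ?mulr0 ?cabs0//; apply/asboolP => /(_ At).
  by rewrite (asboolT (nAt : (~` A) t)) mulr1 he.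
rewrite /cindic; have [At|nAt] := pselect (A t).
  by rewrite (asboolT At) mulr1 hC.
by rewrite (_ : `[< A t >] = false) ?mulr0 ?cabs0//; apply/asboolP.
Qed.

Lemma sint_spectral_integral g : simple_approx g -> is_spectral_integral F g (sint g).
Proof.
move=> hg _ /posC_ex[e e0 ->]; have [I [q [c [mq gq]]]] := hg e e0.
exists #|I|, (fun i => q @^-1` [set enum_val i]), (fun i => c (enum_val i)); split.
- by move=> i; exact: mq.
- move=> i j _ _ [t [/= qi qj]]; apply: enum_val_inj; by rewrite -qi -qj.
- by move=> t; exists (enum_rank (q t)) => /=; rewrite enum_rankK.
- by move=> i t /= <-; rewrite -cabsE lecR.
move=> v; rewrite -!rnE -rmorphM lecR.
have := sintP hg (ltW e0) mq gq v; rewrite /ssum.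
by rewrite [X in _ - X](reindex (@enum_val I xpredT))//; exists enum_rank => i _; rewrite ?enum_valK ?enum_rankK.
Qed.

(** The pieces [D i] are disjoint and cover [X], so they are the fibers of a map to ['I_n]. The
    first conclusion makes [g] integrable against every spectral measure on [X]. *)
Lemma spectral_integral_sint g B : is_spectral_integral F g B ->
  simple_approx g /\ B = sint g.
Proof.
move=> h.
have key (e : R) : 0 < e -> exists (I : finType) (q : X -> I) (c : I -> R[i]),
    [/\ classifier q, snear g q c e & forall v, rn (B v - ssum F q c v) <= e * rn v].
  move=> e0; have [|n [D [c [mD tD cD gD BD]]]] := h e%:C%C; first by rewrite ltcR.
  have /choice[q hq] := cD.
  have E i : q @^-1` [set i] = D i.
    apply/seteqP; split=> [t /= <-//|t Dit /=].
    by apply: tD => //; exists t.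
  exists 'I_n, q, c; split=> [i|t|v]; first by rewrite E.
    by have := gD _ _ (hq t); rewrite -cabsE lecR.
  have := BD v; rewrite -!rnE -rmorphM lecR /ssum.
  by under [in X in _ -> X]eq_bigr do rewrite E.
have hg : simple_approx g.
  by move=> e /key[I [q [c [? ? _]]]]; exists I, q, c.
split=> //; apply/funext => v; apply/esym/sint_eq => //.
exists (1 + rn v) => e e0 _; have [I [q [c [mq gq Bq]]]] := key e e0.
exists I, q, c; split=> // [t|].
  by rewrite (le_trans (gq t))// ler_peMl ?(ltW e0)// lerDl rn_ge0.
by rewrite (le_trans (Bq v))// mulrDl mul1r mulrC lerDr ltW.
Qed.

End SpectralIntegral.

(** * Hilbert-Schmidt operators *)

Section BoundedOperators.
Variable R : realType.

Definition bop (H K : hilbertType R) (M : R) (A : H -> K) :=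
  linear_op A /\ forall x, rn (A x) <= M * rn x.

Lemma bop_bounded (H K : hilbertType R) (M : R) (A : H -> K) : bop M A -> bounded_operator A.
Proof.
move=> [lA bA]; split; first exact: lA.
by exists M%:C%C => x; rewrite -!rnE -rmorphM lecR.
Qed.

Lemma bounded_bop (H K : hilbertType R) (A : H -> K) : bounded_operator A ->
  exists2 M : R, 0 <= M & bop M A.
Proof.
move=> [lA [M bA]]; exists (cabs M); first exact: cabs_ge0.
split=> // x; rewrite -lecR rmorphM/= !rnE cabsE (le_trans (bA x))//.
have [->|x0] := eqVneq x 0; first by rewrite normr0 !mulr0.
have np : 0 < `|x| by rewrite normr_gt0.
rewrite ler_pM2r//; have M0 : 0 <= M by rewrite -(pmulr_lge0 _ np) (le_trans _ (bA _)).
by rewrite ger0_norm.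
Qed.

Lemma bop_adjoint (H K : hilbertType R) (M : R) (A : H -> K) (B : K -> H) : 0 <= M ->
  bop M A -> (forall x y, inner (A x) y = inner x (B y)) -> bop M B.
Proof.
move=> M0 [lA bA] h; split; first exact: adjoint_linear h.
exact: adjoint_le h.
Qed.

(** Parseval on both sides and an exchange of the two sums. *)
Lemma hs_sumsq_adjoint (H K : hilbertType R) (A : H -> K) (B : K -> H) :
  (forall x y, inner (A x) y = inner x (B y)) ->
  hs_sumsq (@std_basis R H) A = hs_sumsq (@std_basis R K) B.
Proof.
move=> AB.
have ge0 (L : hilbertType R) (f : L -> L -> R[i]) i j : (0 <= (sqnorm (f i j))%:E)%E.
  by rewrite lee_fin sqnorm_ge0.
rewrite /hs_sumsq (eq_esum (fun e _ => esym (parseval (A e) (@std_basisP R K)))).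
rewrite [RHS](eq_esum (fun e _ => esym (parseval (B e) (@std_basisP R H)))).
rewrite esum_esum; last by move=> i j; rewrite lee_fin sqnorm_ge0.
rewrite [RHS]esum_esum; last by move=> i j; rewrite lee_fin sqnorm_ge0.
rewrite (@reindex_esum _ _ _ (@std_basis R K `*`` (fun=> @std_basis R H)) _ (fun x => (x.2, x.1))).
- apply: eq_esum => -[f e] _ /=; congr (_%:E).
  by rewrite /sqnorm AB inner_conj norm_conjC.
- split=> [[x y] [? ?]|[x y] [x' y'] _ _ [-> ->]|[x y] [? ?]]//.
  by exists (y, x).
Qed.

Lemma hs_adjoint (H K : hilbertType R) (A : H -> K) (B : K -> H) :
  hilbert_schmidt A -> (forall x y, inner (A x) y = inner x (B y)) -> hilbert_schmidt B.
Proof.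
move=> /hilbert_schmidtP[/bounded_bop[M M0 bA] sA] AB.
apply/hilbert_schmidtP; split; last by rewrite -(hs_sumsq_adjoint AB).
exact: bop_bounded (bop_adjoint M0 bA AB).
Qed.

Lemma hs_comp_left (H K L : hilbertType R) (M : R) (A : H -> K) (B : K -> L) : 0 <= M ->
  hilbert_schmidt A -> bop M B -> hilbert_schmidt (B \o A) /\
  (hs_sumsq (@std_basis R H) (B \o A) <= (M ^+ 2)%:E * hs_sumsq (@std_basis R H) A)%E.
Proof.
move=> M0 /hilbert_schmidtP[/bounded_bop[N N0 [lA bA]] sA] [lB bB].
have le : (hs_sumsq (@std_basis R H) (B \o A) <= (M ^+ 2)%:E * hs_sumsq (@std_basis R H) A)%E.
  rewrite /hs_sumsq -esumZ ?sqr_ge0//; last by move=> e; exact: normsq_ge0.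
  apply: le_esum => e _; rewrite lee_fin !normsq_rn -exprMn.
  by apply: lerXn2r; rewrite ?nnegrE ?mulr_ge0 ?rn_ge0//; exact: bB.
split=> //; apply/hilbert_schmidtP; split.
  apply: (@bop_bounded _ _ (M * N)); split=> [a x y|x] /=; first by rewrite lA lB.
  by rewrite (le_trans (bB _))// -mulrA ler_wpM2l.
by rewrite (le_lt_trans le)// lte_mul_pinfty// ?lee_fin ?sqr_ge0//.
Qed.

End BoundedOperators.

(** * Rank one operators and two-sided multiplication *)

Section HSOperators.
Variable R : realType.

Section RankOne.
Variables (U V : hilbertType R).
Local Notation hs := (hs_operator U V).
Implicit Types (Q : hs) (a : V) (b : U).

Lemma hs_lin Q : linear_op Q.
Proof. exact: hs_operator_linear. Qed.

Lemma rn_hs Q : (rn Q ^+ 2)%:E = hs_sumsq (@std_basis R U) Q.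
Proof.
rewrite -hs_normsqE; congr (_%:E); apply: complexI.
by rewrite rmorphXn/= rnE -[ `|Q| ]/(hs_norm Q) hs_normE -rmorphXn sqr_sqrtr// hs_normsq_ge0.
Qed.

Lemma hs_normsq_rn Q : hs_normsq Q = rn Q ^+ 2.
Proof. by apply: EFin_inj; rewrite hs_normsqE rn_hs. Qed.

Lemma rank_one_sumsq a b : hs_sumsq (@std_basis R U) (fun z => inner z b *: a) = (normsq a * normsq b)%:E.
Proof.
rewrite /hs_sumsq (eq_esum (b := fun e => (normsq a * sqnorm (inner b e))%:E)).
  rewrite esumZ ?normsq_ge0//; first by rewrite (parseval b (@std_basisP R U)) EFinM.
  by move=> e; exact: sqnorm_ge0.
move=> e _; rewrite normsqZ mulrC; congr (_ * _)%:E.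
by rewrite /sqnorm inner_conj norm_conjC.
Qed.

Lemma rank_one_hs a b : hilbert_schmidt (fun z : U => inner z b *: a).
Proof.
apply/hilbert_schmidtP; split; last by rewrite rank_one_sumsq ltry.
apply: (@bop_bounded _ _ _ (rn b * rn a)); split=> [c x y|x].
  by rewrite inner_linear scalerDl scalerA.
by rewrite rnZ mulrAC ler_wpM2r ?rn_ge0// mulrC cabs_inner.
Qed.

Definition rank_one a b : hs := hs_of (rank_one_hs a b).

Lemma rank_oneE a b z : rank_one a b z = inner z b *: a. Proof. by []. Qed.

Lemma rank_one_normsq a b : hs_normsq (rank_one a b) = normsq a * normsq b.
Proof. by apply: EFin_inj; rewrite hs_normsqE rank_one_sumsq. Qed.

Lemma hs_eq Q Q' : (forall x, Q x = Q' x) -> Q = Q'.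
Proof. by move=> h; apply: val_inj; apply/funext => x; exact: h. Qed.

(* [Q] may be replaced by its component along [a], which makes all the operators rank one. *)
Lemma rank_one_polar Q a b :
  hs_normsq (Q + rank_one a b) - hs_normsq (Q - rank_one a b) = 4 * complex.Re (inner (Q b) a).
Proof.
have [->|a0] := eqVneq a 0.
  have -> : rank_one 0 b = 0 by apply: hs_eq => x; rewrite rank_oneE scaler0.
  by rewrite addr0 subr0 subrr inner0r mulr0.
have [M M0 bQ] := bounded_bop (hs_operatorP Q).1.
have [Qs hQs] := adjoint_exists bQ.1 bQ.2.
have na0 : (normsq a)%:C%C != 0 :> R[i].
  by rewrite normsqE sqrf_eq0 normr_eq0.
pose c : R[i] := ((normsq a)^-1)%:C%C.
have cE : c * inner a a = 1 by rewrite /c inner_norm -normsqE -rmorphM mulVf//; apply: contra_neq na0 => ->.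
pose T := rank_one a b; pose W := rank_one a (c *: Qs a).
have cR : c^* = c by exact: conjc_real.
have We e : W e = (c * inner (Q e) a) *: a.
  by rewrite rank_oneE innerZr cR -hQs.
have re e : complex.Re (inner (Q e) (T e)) = complex.Re (inner (W e) (T e)).
  congr complex.Re; rewrite We rank_oneE !innerZr innerZl mulrAC cE mul1r//.
have N0 : hs_normsq (0 : hs) = 0 by rewrite hs_normsq_rn rn0 expr0n.
(* The inner product is defined by polarization, so [Q] is compared with [W] through squared norms,
   basis vector by basis vector. *)
have E : hs_normsq (Q + T) + hs_normsq (W - T) = hs_normsq (Q - T) + hs_normsq (W + T).
  have := @hs_normsq_eq R U V 0 (Q + T) (W - T) 0 (Q - T) (W + T) 0 (lexx 0).
  rewrite !mul0r !addr0; apply=> e; rewrite !mul0r !addr0.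
  rewrite !hs_funD !hs_funN !normsqD normsqN !innerNr !raddfN/= re; ring.
have WT s : W + s *: T = rank_one a (c *: Qs a + s^* *: b).
  by apply: hs_eq => x; rewrite hs_funD hs_funZ !rank_oneE innerDr !innerZr conjCK scalerDl !scalerA.
have h1 : hs_normsq (W + T) = normsq a * normsq (c *: Qs a + b).
  by rewrite -[T]scale1r WT rank_one_normsq conjC1 scale1r.
have h2 : hs_normsq (W - T) = normsq a * normsq (c *: Qs a - b).
  by rewrite -[T]scale1r -scaleNr WT rank_one_normsq rmorphN1 scaleN1r.
have -> : hs_normsq (Q + T) - hs_normsq (Q - T) = hs_normsq (W + T) - hs_normsq (W - T).
  by move: E; move: (hs_normsq (Q + T)) (hs_normsq (W - T)) (hs_normsq (Q - T)) (hs_normsq (W + T)) => p q r s; lra.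
rewrite h1 h2 -mulrBr !normsqD normsqN innerNr raddfN/=.
have -> : complex.Re (inner (c *: Qs a) b) = (normsq a)^-1 * complex.Re (inner (Q b) a).
  rewrite innerZl hQs [inner b _]inner_conj /c.
  by case: (inner (Qs a) b) => u v /=; rewrite mul0r subr0.
have na : normsq a != 0 by apply: contra_neq na0 => ->.
by field.
Qed.

Lemma inner_rank_one Q a b : inner Q (rank_one a b) = inner (Q b) a.
Proof.
have -> : inner Q (rank_one a b) = hs_inner Q (rank_one a b) by [].
have E : 'i%C *: rank_one a b = rank_one ('i%C *: a) b.
  by apply: hs_eq => x; rewrite hs_funZ !rank_oneE !scalerA mulrC.
rewrite /hs_inner E !rank_one_polar innerZr.
have -> : ('i%C : R[i])^* = - 'i%C by rewrite complexiE conjCi.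
case: (inner (Q b) a) => u v; apply/eqP; rewrite eq_complex/=; apply/andP; split; apply/eqP.
  by field.
by field.
Qed.

Lemma hs_ext Q Q' : (forall a b, inner Q (rank_one a b) = inner Q' (rank_one a b)) -> Q = Q'.
Proof.
by move=> h; apply: hs_eq => b; apply: inner_extl => a; rewrite -!inner_rank_one.
Qed.

(** By self-adjointness it is enough that [A] and [B] agree on rank one operators, and their values
    there are determined by rank one coefficients. *)
Lemma hs_op_ext (A B : hs -> hs) :
  (forall Q Q', inner (A Q) Q' = inner Q (A Q')) -> (forall Q Q', inner (B Q) Q' = inner Q (B Q')) ->
  (forall x y a b, inner (A (rank_one x y)) (rank_one a b) = inner (B (rank_one x y)) (rank_one a b)) ->
  forall Q, A Q = B Q.
Proof.
move=> sA sB AB Q; apply: hs_ext => a b; rewrite sA sB; congr (inner Q _).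
by apply: hs_ext => x y; exact: AB.
Qed.

End RankOne.

Section Sandwich.

(** [Q |-> A Q B]. For bounded linear [A] and [B] the default 0 of [insubd] is never taken, see
    [sandwich_hs]. *)
Definition sandwich (U V U' V' : hilbertType R) (A : V -> V') (B : U' -> U)
  (Q : hs_operator U V) : hs_operator U' V' := insubd 0 (fun x => A (Q (B x))).

(** [Q B] is the adjoint of [B^* Q^*], and passing to adjoints keeps the Hilbert-Schmidt norm. *)
Lemma hs_comp_right (U V U' : hilbertType R) (N : R) (B : U' -> U) (Q : U -> V) : 0 <= N ->
  hilbert_schmidt Q -> bop N B -> hilbert_schmidt (Q \o B) /\
  (hs_sumsq (@std_basis R U') (Q \o B) <= (N ^+ 2)%:E * hs_sumsq (@std_basis R U) Q)%E.
Proof.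
move=> N0 hQ bB; have [M M0 bQ] := bounded_bop hQ.1.
have [Qs hQs] := adjoint_exists bQ.1 bQ.2.
have [Bs hBs] := adjoint_exists bB.1 bB.2.
have hQs' := hs_adjoint hQ hQs.
have [h1 h2] := hs_comp_left N0 hQs' (bop_adjoint N0 bB hBs).
have E x y : inner ((Bs \o Qs) x) y = inner x ((Q \o B) y).
  by rewrite /= inner_conj -hBs -hQs -inner_conj.
by split; [exact: hs_adjoint h1 E|rewrite -(hs_sumsq_adjoint E) (hs_sumsq_adjoint hQs)].
Qed.

Variables (U V U' V' : hilbertType R) (M N : R) (A : V -> V') (B : U' -> U).
Hypotheses (M0 : 0 <= M) (N0 : 0 <= N) (bA : bop M A) (bB : bop N B).

Lemma sandwich_hs (Q : hs_operator U V) : hilbert_schmidt (fun x => A (Q (B x))).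
Proof.
have [h _] := hs_comp_right N0 (hs_operatorP Q) bB.
by have [] := hs_comp_left M0 h bA.
Qed.

Lemma sandwichE (Q : hs_operator U V) x : sandwich A B Q x = A (Q (B x)).
Proof.
rewrite /sandwich; have : (fun x => A (Q (B x))) \in @hs_pred R U' V' by apply/asboolP; exact: sandwich_hs.
by move=> h; rewrite -[hs_fun _]/(val _) insubdK.
Qed.

Lemma sandwich_lin : linear_op (sandwich A B).
Proof.
move=> a Q Q'; apply: hs_eq => x; rewrite hs_funD hs_funZ !sandwichE hs_funD hs_funZ.
by rewrite bA.1.
Qed.

Lemma sandwich_le (Q : hs_operator U V) : rn (sandwich A B Q) <= M * N * rn Q.
Proof.
rewrite -(@ler_pXn2r _ 2) ?nnegrE ?rn_ge0 ?mulr_ge0 ?rn_ge0//.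
rewrite -lee_fin rn_hs !exprMn 2!EFinM rn_hs.
have -> : (sandwich A B Q : U' -> V') = A \o (Q \o B) by apply/funext => x; rewrite sandwichE.
have [h1 h2] := hs_comp_right N0 (hs_operatorP Q) bB.
have [_ h3] := hs_comp_left M0 h1 bA.
by rewrite (le_trans h3)// -muleA lee_wpmul2l// lee_fin sqr_ge0.
Qed.

Lemma sandwich_rank_one (Bs : U -> U') a b : (forall x y, inner (B x) y = inner x (Bs y)) ->
  sandwich A B (rank_one a b) = rank_one (A a) (Bs b).
Proof.
move=> hB; apply: hs_eq => x; rewrite sandwichE !rank_oneE hB.
by rewrite (linopZ bA.1).
Qed.

Lemma sandwich_inner (Q : hs_operator U V) a b (As : V' -> V) :
  (forall x y, inner (A x) y = inner x (As y)) ->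
  inner (sandwich A B Q) (rank_one a b) = inner Q (rank_one (As a) (B b)).
Proof. by move=> hA; rewrite !inner_rank_one sandwichE hA. Qed.

End Sandwich.

(** Riesz provides some adjoint [S]; its values are then identified by their coefficients against
    rank one operators. *)
Lemma sandwich_adjoint (U V U' V' : hilbertType R) (M N : R) (A : V -> V') (B : U' -> U)
    (As : V' -> V) (Bs : U -> U') : 0 <= M -> 0 <= N -> bop M A -> bop N B ->
  (forall x y, inner (A x) y = inner x (As y)) -> (forall x y, inner (B x) y = inner x (Bs y)) ->
  forall Q Q', inner (sandwich A B Q) Q' = inner Q (sandwich As Bs Q').
Proof.
move=> M0 N0 bA bB hA hB Q Q'.
have [S hS] := adjoint_exists (sandwich_lin M0 N0 bA bB) (sandwich_le M0 N0 bA bB).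
have bAs := bop_adjoint M0 bA hA; have bBs := bop_adjoint N0 bB hB.
rewrite hS; congr (inner Q _); apply: hs_ext => a b.
rewrite (sandwich_inner M0 N0 bAs bBs _ _ _ (As := A)); last first.
  by move=> x y; rewrite inner_conj -hA -inner_conj.
by rewrite inner_conj -hS (sandwich_rank_one M0 N0 bA bB _ _ hB) -inner_conj.
Qed.

End HSOperators.

(** * Measurable sections *)

Section ComplexMeasurable.
Variables (d : measure_display) (X : measurableType d) (R : realType).
Implicit Types (g : X -> R[i]).

Definition cmeasurable g :=
  measurable_fun setT (fun t => complex.Re (g t)) /\ measurable_fun setT (fun t => complex.Im (g t)).

(** [c (q t)] rounds [u t] down to the grid of step [e] that starts at [- M]. *)
Lemma simple_approx_real (u : X -> R) (M : R) : measurable_fun setT u ->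
  (forall t, `|u t| <= M) -> forall e : R, 0 < e ->
  exists (I : finType) (q : X -> I) (c : I -> R), classifier q /\ forall t, `|u t - c (q t)| <= e.
Proof.
move=> mu uM e e0.
have uM0 t : 0 <= (u t + M) / e.
  by rewrite divr_ge0 ?(ltW e0)//; have := uM t; rewrite ler_norml => /andP[]; lra.
pose N := Num.trunc (2 * M / e).
have bnd t : (Num.trunc ((u t + M) / e) < N.+1)%N.
  rewrite ltnS /N; apply: le_truncn; rewrite ler_pM2r ?invr_gt0//.
  by have := uM t; rewrite ler_norml => /andP[]; lra.
exists 'I_N.+1, (fun t => Ordinal (bnd t)), (fun k : 'I_N.+1 => (val k)%:R * e - M); split; last first.
  move=> t /=; have := truncn_itv (uM0 t); set k := Num.trunc _ => /andP[].
  rewrite ler_pdivlMr// ltr_pdivrMr// -natr1 mulrDl mul1r => h1 h2.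
  by rewrite ler_norml; apply/andP; split; lra.
move=> k; rewrite (_ : _ @^-1` _ = u @^-1` `[k%:R * e - M, k.+1%:R * e - M[%classic).
  by rewrite -[X in measurable X]setTI; apply: mu => //; exact: measurable_itv.
apply/seteqP; split=> t /=; rewrite in_itv/=.
  move=> /(congr1 val)/= kE; have := truncn_itv (uM0 t); rewrite kE.
  by rewrite ler_pdivlMr// ltr_pdivrMr// lerBlDr ltrBrDr.
move=> /andP[h1 h2]; apply: val_inj => /=; apply: truncn_def.
by rewrite ler_pdivlMr// ltr_pdivrMr// -lerBlDr -ltrBrDr h1.
Qed.

Lemma cmeasurable_simple g (M : R) : cmeasurable g -> (forall t, cabs (g t) <= M) ->
  simple_approx g.
Proof.
move=> [mr mi] gM e e0; have e2 : 0 < e / 2 by rewrite divr_gt0.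
have [I [q [c [mq hq]]]] := simple_approx_real mr (fun t => le_trans (Re_le_cabs _) (gM t)) e2.
have [J [p [b [mp hp]]]] := simple_approx_real mi (fun t => le_trans (Im_le_cabs _) (gM t)) e2.
exists (I * J)%type, (fun t => (q t, p t)), (fun k => Complex (c k.1) (b k.2)).
split; first exact: classifier_pair.
move=> t /=; rewrite (le_trans (cabs_le _))//.
have := lerD (hq t) (hp t); rewrite -splitr.
by case: (g t).
Qed.

Lemma cmeasurable_cvg (h : nat -> X -> R[i]) g : (forall n, cmeasurable (h n)) ->
  (forall t (e : R), 0 < e -> exists N, forall n, (N <= n)%N -> cabs (g t - h n t) <= e) ->
  cmeasurable g.
Proof.
move=> mh hg; split.
  apply: (@measurable_fun_cvg _ _ _ setT (fun n t => complex.Re (h n t))) => [n|t _].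
    by have [] := mh n.
  apply/cvgrPdist_le => e e0; have [N hN] := hg t e e0; exists N => // n /= /hN.
  by apply: le_trans; rewrite -raddfB; exact: Re_le_cabs.
apply: (@measurable_fun_cvg _ _ _ setT (fun n t => complex.Im (h n t))) => [n|t _].
  by have [] := mh n.
apply/cvgrPdist_le => e e0; have [N hN] := hg t e e0; exists N => // n /= /hN.
by apply: le_trans; rewrite -raddfB; exact: Im_le_cabs.
Qed.

Lemma simple_cmeasurable g : simple_approx g -> cmeasurable g.
Proof.
move=> hg.
have /choice[h hh] : forall n : nat, exists h, cmeasurable h /\ forall t, cabs (g t - h t) <= n.+1%:R^-1.
  move=> n; have [|I [q [c [mq gq]]]] := hg n.+1%:R^-1; first by rewrite invr_gt0 ltr0n.
  exists (c \o q); split=> //; split=> _ Y _; rewrite setTI.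
    by rewrite (_ : _ @^-1` _ = q @^-1` [set i | Y (complex.Re (c i))])//; exact: classifier_preimage.
  by rewrite (_ : _ @^-1` _ = q @^-1` [set i | Y (complex.Im (c i))])//; exact: classifier_preimage.
apply: (@cmeasurable_cvg h) => [n|t e e0]; first by have [] := hh n.
have [N _ hN] := near_infty_natSinv_lt (PosNum e0); exists N => n /hN/= /ltW hn.
by have [_ /(_ t)/le_trans] := hh n; apply.
Qed.

Lemma cmeasurableD g h : cmeasurable g -> cmeasurable h -> cmeasurable (fun t => g t + h t).
Proof.
move=> [g1 g2] [h1 h2]; split.
  by under eq_fun do rewrite raddfD; exact: measurable_funD.
by under eq_fun do rewrite raddfD; exact: measurable_funD.
Qed.

Lemma cmeasurableB g h : cmeasurable g -> cmeasurable h -> cmeasurable (fun t => g t - h t).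
Proof.
move=> [g1 g2] [h1 h2]; split.
  by under eq_fun do rewrite raddfB; exact: measurable_funB.
by under eq_fun do rewrite raddfB; exact: measurable_funB.
Qed.

Lemma cmeasurable_sum (I : Type) (r : seq I) (h : I -> X -> R[i]) :
  (forall i, cmeasurable (h i)) -> cmeasurable (fun t => \sum_(i <- r) h i t).
Proof.
move=> mh; elim: r => [|i r IH].
  by under eq_fun do rewrite big_nil; apply: simple_cmeasurable; exact: simple_approx_cst.
by under eq_fun do rewrite big_cons; exact: cmeasurableD.
Qed.

End ComplexMeasurable.

(** Dynkin's pi-lambda theorem for the rectangles, a pi-system that generates the product
    sigma-algebra. *)
Lemma rect_induction (d1 d2 : measure_display) (X1 : measurableType d1) (X2 : measurableType d2)
    (P : set (X1 * X2) -> Prop) :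
  (forall A B, measurable A -> measurable B -> P (A `*` B)) ->
  (forall D, measurable D -> P D -> P (~` D)) ->
  (forall D : nat -> set (X1 * X2), (forall n, measurable (D n)) -> trivIset setT D ->
     (forall n, P (D n)) -> P (\bigcup_n D n)) ->
  forall D, measurable D -> P D.
Proof.
move=> PR PC PU D mD.
have E := measurable_prod_measurableType X1 X2.
have : <<s [set A `*` B | A in @measurable _ X1 & B in @measurable _ X2] >> D by rewrite -E.
apply: (@dynkin_induction _ _ _ P E).
- move=> _ _ [A mA [B mB <-]] [A' mA' [B' mB' <-]].
  exists (A `&` A'); first exact: measurableI.
  by exists (B `&` B'); [exact: measurableI|rewrite setXI].
- by rewrite -setXTT; exact: PR.
- by move=> _ [A mA [B mB <-]]; exact: PR.
- exact: PC.
- exact: PU.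
Qed.

Section Sections.
Variables (d1 d2 : measure_display) (X1 : measurableType d1) (X2 : measurableType d2).
Variables (R : realType) (K : hilbertType R) (E : set X1 -> K -> K).
Hypothesis hE : semispectral_measure E.

(** Its integral against the second measure gives the coefficients of the product measure on rank
    one operators, see [product_form]. *)
Definition section_fun (D : set (X1 * X2)) (x a : K) (t : X2) : R[i] :=
  inner (E (ysection D t) x) a.

Lemma ysection_preimage (D : set (X1 * X2)) t : ysection D t = [set s | D (s, t)].
Proof. by apply/seteqP; split=> s; rewrite /ysection /mkset in_setE. Qed.

Lemma ysectionX (A : set X1) (B : set X2) t :
  ysection (A `*` B) t = if `[< B t >] then A else set0.
Proof.
rewrite ysection_preimage; case: asboolP => Bt; apply/seteqP; split=> s //=; first by case.
by case.
Qed.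

Lemma ysectionC (D : set (X1 * X2)) t : ysection (~` D) t = ~` ysection D t.
Proof. by rewrite !ysection_preimage. Qed.

Lemma section_rect A B x a t : section_fun (A `*` B) x a t = inner (E A x) a * cindic R B t.
Proof.
rewrite /section_fun ysectionX /cindic; case: asbool; first by rewrite mulr1.
by rewrite (sem0 hE) inner0l mulr0.
Qed.

Lemma section_le D x a t : measurable D -> cabs (section_fun D x a t) <= rn x * rn a.
Proof.
move=> mD; rewrite (le_trans (cabs_inner _ _))// ler_wpM2r ?rn_ge0//.
by apply: (sem_contr hE); exact: measurable_ysection.
Qed.

Lemma section_sigma (D : nat -> set (X1 * X2)) x a t : (forall n, measurable (D n)) ->
  trivIset setT D -> forall e : R, 0 < e -> exists N, forall n, (N <= n)%N ->
  cabs (section_fun (\bigcup_n D n) x a t - \sum_(k < n) section_fun (D k) x a t) <= e.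
Proof.
move=> mD tD; rewrite /section_fun ysection_bigcup.
apply: (sem_sigma hE); first by move=> n; exact: measurable_ysection.
by move=> i j _ _ [s]; rewrite !ysection_preimage => -[h1 h2]; apply: tD => //; exists (s, t).
Qed.

Lemma section_cmeasurable D x a : measurable D -> cmeasurable (section_fun D x a).
Proof.
move: D; apply: rect_induction => [A B mA mB|D mD IH|D mD tD IH].
- have -> : section_fun (A `*` B) x a = fun t => inner (E A x) a * cindic R B t.
    by apply/funext => t; exact: section_rect.
  by apply: simple_cmeasurable; apply: simple_approxZ; exact: simple_approx_indic.
- have -> : section_fun (~` D) x a = fun t => inner x a - section_fun D x a t.
    apply/funext => t; rewrite /section_fun ysectionC (semC hE) ?innerBl//.
    exact: measurable_ysection.
  by apply: cmeasurableB => //; apply: simple_cmeasurable; exact: simple_approx_cst.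
- apply: (@cmeasurable_cvg _ _ _ (fun n t => \sum_(k < n) section_fun (D k) x a t)).
    by move=> n; apply: cmeasurable_sum => k; exact: IH.
  by move=> t; exact: section_sigma.
Qed.

Lemma section_simple D x a : measurable D -> simple_approx (section_fun D x a).
Proof.
move=> mD; apply: cmeasurable_simple; first exact: section_cmeasurable.
by move=> t; exact: section_le.
Qed.

End Sections.

(** * The product of two spectral measures *)

Lemma classifier_seq (d : measure_display) (X : measurableType d) (R : realType) (T : eqType)
    (s : seq T) (G : T -> X -> R[i]) (e : R) : 0 < e -> (forall p, simple_approx (G p)) ->
  exists (I : finType) (q : X -> I), classifier q /\
    forall p, p \in s -> exists c : I -> R[i], snear (G p) q c e.
Proof.
move=> e0 hG; elim: s => [|p s [I [q [mq hq]]]].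
  exists unit, (fun=> tt); split=> // -[].
  by rewrite (_ : _ @^-1` _ = setT)//; apply/seteqP.
have [J [q' [c' [mq' hq']]]] := hG p e e0.
exists (I * J)%type, (fun t => (q t, q' t)); split; first exact: classifier_pair.
move=> r; rewrite in_cons => /orP[/eqP ->|/hq[c hc]]; first by exists (c' \o snd).
by exists (c \o fst).
Qed.

Lemma ultra_cvg_ge0 (R : realType) (T : Type) (U : set_system T) (UU : UltraFilter U)
  (u : T -> R[i]) l : ultra_cvg U u l -> (forall n, 0 <= u n) -> 0 <= l.
Proof.
move=> ul u0.
have PU : ProperFilter U := @ultra_proper _ U UU.
have FU : Filter U := @filter_filter _ _ PU.
have key (e : R) : 0 < e -> `|complex.Im l| <= e /\ - e <= complex.Re l.
  move=> /ul h; have [n /= hn] := filter_ex h; have un := u0 n.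
  have := ger0_Im un; move: un; rewrite lecE => /andP[_ /= r0] i0.
  have := le_trans (Re_le_cabs _) hn; have := le_trans (Im_le_cabs _) hn.
  rewrite !raddfB/= i0 subr0 => h1; rewrite ler_norml => /andP[h2 _]; split=> //; lra.
rewrite lecE/=; apply/andP; split.
  by rewrite -normr_eq0 eq_le normr_ge0 andbT; apply/ler_addgt0Pr => e /key[? _]; rewrite add0r.
by apply/ler_addgt0Pr => e /key[_ h]; lra.
Qed.

Section ProductMeasure.
Variables (d1 d2 : measure_display) (X1 : measurableType d1) (X2 : measurableType d2).
Variables (R : realType) (K1 K2 : hilbertType R).
Variables (F1 : set X1 -> K1 -> K1) (F2 : set X2 -> K2 -> K2).
Hypotheses (hF1 : spectral_measure F1) (hF2 : spectral_measure F2).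
Local Notation hs := (hs_operator K2 K1).
Local Notation rk := (@rank_one R K2 K1).
Implicit Types (Q : hs) (x a : K1) (y b : K2) (D : set (X1 * X2)).

Let sF1 : semispectral_measure F1. Proof. by case: hF1. Qed.
Let sF2 : semispectral_measure F2. Proof. by case: hF2. Qed.

Let bF1 A : measurable A -> bop 1 (F1 A).
Proof. by move=> mA; split=> [|x]; [exact: sem_lin|rewrite mul1r; exact: sem_contr]. Qed.

Let bF2 A : measurable A -> bop 1 (F2 A).
Proof. by move=> mA; split=> [|x]; [exact: sem_lin|rewrite mul1r; exact: sem_contr]. Qed.

Definition rect_op (A : set X1) (B : set X2) : hs -> hs := sandwich (F1 A) (F2 B).

Section Rect.
Variables (A : set X1) (B : set X2).
Hypotheses (mA : measurable A) (mB : measurable B).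

Lemma rect_opE Q y : rect_op A B Q y = F1 A (Q (F2 B y)).
Proof. exact: (sandwichE ler01 ler01 (bF1 mA) (bF2 mB)). Qed.

Lemma rect_op_lin : linear_op (rect_op A B).
Proof. exact: (sandwich_lin ler01 ler01 (bF1 mA) (bF2 mB)). Qed.

Lemma rect_op_rk x y : rect_op A B (rk x y) = rk (F1 A x) (F2 B y).
Proof.
apply: (sandwich_rank_one ler01 ler01 (bF1 mA) (bF2 mB)) => u v.
exact: (sem_sa sF2).
Qed.

Lemma rect_op_sa Q Q' : inner (rect_op A B Q) Q' = inner Q (rect_op A B Q').
Proof.
by apply: (sandwich_adjoint ler01 ler01 (bF1 mA) (bF2 mB)) => u v; [exact: (sem_sa sF1)|exact: (sem_sa sF2)].
Qed.

Lemma rect_op_idem Q : rect_op A B (rect_op A B Q) = rect_op A B Q.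
Proof. by apply: hs_eq => y; rewrite !rect_opE (sp_idem hF1)// (sp_idem hF2). Qed.

Lemma rect_op_sqr Q : inner (rect_op A B Q) Q = (rn (rect_op A B Q) ^+ 2)%:C%C.
Proof. by rewrite -inner_rn -rect_op_sa rect_op_idem. Qed.
End Rect.

Section Tagged.
Variables (D : set (X1 * X2)) (I : finType) (q : X2 -> I) (t : I -> X2).
Hypotheses (mD : measurable D) (mq : classifier q).

Definition tag_op Q : hs := \sum_i rect_op (ysection D (t i)) (q @^-1` [set i]) Q.

Let mY i : measurable (ysection D (t i)). Proof. exact: measurable_ysection. Qed.

Lemma tag_op_lin : linear_op tag_op.
Proof.
move=> c Q Q'; rewrite /tag_op scaler_sumr -big_split/=; apply: eq_bigr => i _.
exact: rect_op_lin.
Qed.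

(** The fibers of [q] are disjoint, so the summands are mutually orthogonal, whatever the sections
    are. *)
Lemma tag_op_sqr Q : inner (tag_op Q) Q = (rn (tag_op Q) ^+ 2)%:C%C.
Proof.
have disj i j : i != j -> q @^-1` [set i] `&` q @^-1` [set j] = set0.
  by move=> ij; rewrite -subset0 => s /= [-> /eqP]; exact/negP.
rewrite pythagoras.
  rewrite /tag_op inner_sumlP rmorph_sum; apply: eq_bigr => i _.
  exact: rect_op_sqr.
move=> i j ij; rewrite rect_op_sa// (_ : rect_op _ _ _ = 0) ?inner0r//.
apply: hs_eq => y; rewrite !rect_opE// (sp_disj hF2)//; last by apply: disj; rewrite eq_sym.
by rewrite (linop0 (hs_lin _)) (linop0 (sem_lin sF1 _))// (linop0 (sem_lin sF1 _)).
Qed.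

Lemma tag_op_le Q : rn (tag_op Q) <= rn Q.
Proof.
have := cabs_inner (tag_op Q) Q; rewrite tag_op_sqr cabs_real ger0_norm ?sqr_ge0// expr2.
have [->|x0] := eqVneq (rn (tag_op Q)) 0; first by rewrite rn_ge0.
by rewrite ler_pM2l// lt_neqAle eq_sym x0 rn_ge0.
Qed.

Lemma tag_op_rk x y a b : inner (tag_op (rk x y)) (rk a b) =
  inner (ssum F2 q (fun i => section_fun F1 D x a (t i)) b) y.
Proof.
rewrite /tag_op /ssum !inner_sumlP; apply: eq_bigr => i _.
rewrite rect_op_rk// inner_rank_one rank_oneE !innerZl mulrC; congr (_ * _).
by rewrite (sem_sa sF2).
Qed.
End Tagged.

(** The coefficient of the product measure between [rank_one x y] and [rank_one a b]; [b] precedes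
    [y] in the inner product because [rank_one] is conjugate-linear in its second argument. *)
Definition product_form D x a y b := inner (sint F2 (section_fun F1 D x a) b) y.

Lemma tag_exists D (s : seq (K1 * K1)) (e : R) : measurable D -> 0 < e -> exists P : hs -> hs,
  [/\ linear_op P, forall Q, inner (P Q) Q = (rn (P Q) ^+ 2)%:C%C, forall Q, rn (P Q) <= rn Q &
    forall p, p \in s -> forall y b,
      cabs (inner (P (rk p.1 y)) (rk p.2 b) - product_form D p.1 p.2 y b) <= e * rn b * rn y].
Proof.
move=> mD e0; have e3 : 0 < e / 3 by rewrite divr_gt0.
have [I [q [mq hq]]] := @classifier_seq _ _ _ _ s (fun p => section_fun F1 D p.1 p.2) _ e3
  (fun p => section_simple sF1 p.1 p.2 mD).
(* The values of [g] at the tags approximate [g] only if each tag lies in its piece; empty pieces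
   get an arbitrary point. *)
have /choice[t ht] : forall i, exists t, (exists t', q t' = i) -> q t = i.
  move=> i; have [[t' ti]|ni] := pselect (exists t', q t' = i); first by exists t'.
  by exists point.
exists (tag_op D q t); split.
- exact: tag_op_lin.
- exact: tag_op_sqr.
- exact: tag_op_le.
move=> p /hq[c hc] y b; rewrite tag_op_rk// /product_form -innerBl.
set g := section_fun F1 D p.1 p.2; rewrite -/g in hc.
have hg : simple_approx g by exact: section_simple.
have gq : snear g q (fun i => g (t i)) (e / 3 + e / 3).
  move=> tau; rewrite (le_trans (cabs_dist (c (q tau)) _ _))// lerD ?hc// cabsC.
  have E : q (t (q tau)) = q tau by apply: ht; exists tau.
  by have := hc (t (q tau)); rewrite E.
rewrite (le_trans (cabs_inner _ _))// ler_wpM2r ?rn_ge0// rnC.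
rewrite (le_trans (sintP hF2 hg _ mq gq b))// ?addr_ge0 ?(ltW e3)//.
by rewrite ler_wpM2r ?rn_ge0//; lra.
Qed.

(** Only what survives a weak limit is required: positivity and contractivity in place of
    idempotence, which is recovered in [pm_idem]. *)
Definition is_product_op D (A : hs -> hs) :=
  [/\ linear_op A, forall Q, 0 <= inner (A Q) Q, forall Q, inner (A Q) Q <= inner Q Q &
   forall x y a b, inner (A (rk x y)) (rk a b) = product_form D x a y b].

(* A limit, along an ultrafilter on refinements, of [tag_op] for tagged partitions of [X2]. *)
Lemma product_op_exists D : measurable D -> exists A, is_product_op D A.
Proof.
move=> mD.
have /choice[P hP] : forall i : seq (K1 * K1) * nat, exists P : hs -> hs,
  [/\ linear_op P, forall Q, inner (P Q) Q = (rn (P Q) ^+ 2)%:C%C, forall Q, rn (P Q) <= rn Q &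
    forall p, p \in i.1 -> forall y b,
      cabs (inner (P (rk p.1 y)) (rk p.2 b) - product_form D p.1 p.2 y b) <= i.2.+1%:R^-1 * rn b * rn y].
  by move=> i; apply: tag_exists; rewrite // invr_gt0 ltr0n.
(* The tails of the directed set whose elements are a finite list of pairs [(x, a)] to be treated
   and a precision. *)
pose F0 : set_system (seq (K1 * K1) * nat) :=
  [set A : set (seq (K1 * K1) * nat) | exists i0 : seq (K1 * K1) * nat,
      forall i : seq (K1 * K1) * nat, {subset i0.1 <= i.1} -> (i0.2 <= i.2)%N -> A i].
have PF0 : ProperFilter F0.
  split; first by move=> [i0 /(_ i0)]; apply.
  split; first by exists ([::], 0%N).
    move=> A B [i hi] [j hj]; exists (i.1 ++ j.1, maxn i.2 j.2) => k /= sk.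
    rewrite geq_max => /andP[ik jk]; split.
      by apply: hi => // p pi; apply: sk; rewrite mem_cat pi.
    by apply: hj => // p pj; apply: sk; rewrite mem_cat pj orbT.
  by move=> A B AB [i hi]; exists i => k h1 h2; apply: AB; exact: hi.
have [U [UU F0U]] := ultraFilterLemma PF0.
have PU : ProperFilter U := @ultra_proper _ U UU.
have FU : Filter U := @filter_filter _ _ PU.
have bnd i Q Q' : cabs (inner (P i Q) Q') <= rn Q * rn Q'.
  by rewrite (le_trans (cabs_inner _ _))// ler_wpM2r ?rn_ge0//; case: (hP i) => _ _ h _; exact: h.
have /choice[b hb] : forall QQ : hs * hs, exists l, ultra_cvg U (fun i => inner (P i QQ.1) QQ.2) l.
  by move=> QQ; apply: (ultra_cvg_ex UU) => i; exact: bnd.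
have bl Q Q' : cabs (b (Q, Q')) <= rn Q * rn Q'.
  apply: (ultra_cvg_near_le UU (hb (Q, Q'))).
  by apply: filterS filterT => i _ /=; exact: bnd.
(* The form is conjugate-linear in [Q'], so Riesz is applied to its conjugate. *)
have /choice[A hA] : forall Q, exists v, forall Q', b (Q, Q') = inner v Q'.
  move=> Q; have [|Q'|v hv] := @riesz R hs (fun Q' => (b (Q, Q'))^*) (rn Q).
  - move=> c Q1 Q2; rewrite -[c in RHS]conjCK -rmorphM -rmorphD/=; congr (_^*).
    apply: (ultra_cvg_unique UU (hb _)); rewrite /=.
    under eq_fun do rewrite innerDr innerZr.
    exact: (ultra_cvgD UU (ultra_cvgZ UU _ (hb (Q, Q1))) (hb (Q, Q2))).
  - by rewrite cabs_conj; exact: bl.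
  by exists v => Q'; rewrite inner_conj -hv conjCK.
exists A; split.
- move=> c Q1 Q2; apply: inner_extl => Q'; rewrite innerDl innerZl -!hA.
  apply: (ultra_cvg_unique UU (hb _)) => /=.
  under eq_fun => i do (have [-> _ _ _] := hP i; rewrite innerDl innerZl).
  exact: (ultra_cvgD UU (ultra_cvgZ UU _ (hb (Q1, Q'))) (hb (Q2, Q'))).
- move=> Q; rewrite -hA; apply: (ultra_cvg_ge0 UU (hb _)) => i /=.
  by have [_ -> _ _] := hP i; rewrite ler0c sqr_ge0.
- move=> Q; rewrite -subr_ge0 -hA.
  apply: (ultra_cvg_ge0 UU (ultra_cvgB UU (ultra_cvg_cst UU (inner Q Q)) (hb (Q, Q)))) => i /=.
  have [_ -> h _] := hP i; rewrite inner_rn subr_ge0 lecR.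
  by rewrite ler_pXn2r ?nnegrE ?rn_ge0//; exact: h.
move=> x y a b'; rewrite -hA; apply: eq_cabs_small => e e0.
have c0 : 0 < rn b' * rn y + 1 by rewrite ltr_wpDl// mulr_ge0 ?rn_ge0.
have [N _ hN] := near_infty_natSinv_lt (PosNum (divr_gt0 e0 c0)).
apply: (ultra_cvg_near_le UU (ultra_cvgB UU (hb (rk x y, rk a b')) (ultra_cvg_cst UU (product_form D x a y b')))).
apply: F0U; exists ([:: (x, a)], N) => i /= si Ni.
have [_ _ _ h] := hP i; rewrite (le_trans (h (x, a) _ _ _))//.
  by apply: si; rewrite mem_head.
have /= /ltW h1 := hN i.2 Ni.
rewrite -mulrA (le_trans (ler_wpM2r _ h1)) ?mulr_ge0 ?rn_ge0//.
by rewrite mulrAC ler_pdivrMr// ler_wpM2l ?(ltW e0)// lerDl.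
Qed.

Definition product_spectral D : hs -> hs := xget (fun=> 0) [set A | is_product_op D A].
Local Notation PM := product_spectral.

Lemma product_spectralP D : measurable D -> is_product_op D (PM D).
Proof.
move=> /product_op_exists[A hA]; rewrite /product_spectral.
by case: xgetP => [B ->//|/(_ A)].
Qed.

Lemma pm_lin D : measurable D -> linear_op (PM D).
Proof. by case/product_spectralP. Qed.

Lemma pm_ge0 D Q : measurable D -> 0 <= inner (PM D Q) Q.
Proof. by case/product_spectralP => _ h _ _; exact: h. Qed.

Lemma pm_le1 D Q : measurable D -> inner (PM D Q) Q <= inner Q Q.
Proof. by case/product_spectralP => _ _ h _; exact: h. Qed.

Lemma pm_rk D x y a b : measurable D ->
  inner (PM D (rk x y)) (rk a b) = product_form D x a y b.
Proof. by case/product_spectralP. Qed.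

Lemma pm_sa D Q Q' : measurable D -> inner (PM D Q) Q' = inner Q (PM D Q').
Proof.
by move=> mD; apply: positive_selfadjoint; [exact: pm_lin|move=> ?; exact: pm_ge0].
Qed.

Lemma pm_sqr D Q : measurable D -> (rn (PM D Q) ^+ 2)%:C%C <= inner (PM D Q) Q.
Proof.
by move=> mD; apply: positive_contraction_sqr => [|?|?]; [exact: pm_lin|exact: pm_ge0|exact: pm_le1].
Qed.

Lemma pm_contr D Q : measurable D -> rn (PM D Q) <= rn Q.
Proof.
move=> mD; rewrite -(@ler_pXn2r _ 2) ?nnegrE ?rn_ge0// -lecR -[leRHS]inner_rn.
exact: le_trans (pm_sqr Q mD) (pm_le1 Q mD).
Qed.

Local Opaque product_spectral.

Lemma pm_rect A B Q : measurable A -> measurable B -> PM (A `*` B) Q = rect_op A B Q.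
Proof.
move=> mA mB; have mAB := measurableX mA mB.
apply: hs_op_ext => [? ?|? ?|x y a b]; [exact: pm_sa|exact: rect_op_sa|].
rewrite pm_rk// /product_form rect_op_rk// inner_rank_one rank_oneE.
have -> : section_fun F1 (A `*` B) x a = fun t => inner (F1 A x) a * cindic R B t.
  by apply/funext => t; exact: section_rect.
rewrite sintZ//; last exact: simple_approx_indic.
by rewrite sint_indic// !innerZl mulrC (sem_sa sF2).
Qed.

Lemma pm_setT Q : PM setT Q = Q.
Proof.
rewrite -setXTT pm_rect//; apply: hs_eq => y.
by rewrite rect_opE// (semT sF1) (semT sF2).
Qed.

Lemma pm_set0 Q : PM set0 Q = 0.
Proof.
have -> : set0 = set0 `*` set0 :> set (X1 * X2) by rewrite set0X.
by rewrite pm_rect//; apply: hs_eq => y; rewrite rect_opE// (sem0 sF1).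
Qed.

Lemma pm_U D D' Q : measurable D -> measurable D' -> D `&` D' = set0 ->
  PM (D `|` D') Q = PM D Q + PM D' Q.
Proof.
move=> mD mD' DD; have mU := measurableU _ _ mD mD'.
apply: (@hs_op_ext _ _ _ (PM _) (fun Q => PM D Q + PM D' Q)) => [? ?|? ?|x y a b].
- exact: pm_sa.
- by rewrite innerDl innerDr !pm_sa.
rewrite innerDl !pm_rk// /product_form -innerDl; congr (inner _ y).
rewrite -sintD//; [|exact: section_simple|exact: section_simple].
congr (sint _ _ b); apply/funext => t; rewrite /section_fun.
have -> : ysection (D `|` D') t = ysection D t `|` ysection D' t by rewrite !ysection_preimage.
rewrite (semU sF1) ?innerDl//.
- exact: measurable_ysection.
- exact: measurable_ysection.
- rewrite !ysection_preimage -subset0 => s [h1 h2].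
  by have : (D `&` D') (s, t) by []; rewrite DD.
Qed.

Lemma pm_diff D D' Q : measurable D -> measurable D' -> D' `<=` D ->
  PM (D `\` D') Q = PM D Q - PM D' Q.
Proof.
move=> mD mD' DD; apply: (addrI (PM D' Q)); rewrite addrC -pm_U//; last 2 first.
- exact: measurableD.
- by rewrite -subset0 => t [[_ nB] Bt]; exact: nB.
by rewrite [RHS]addrC subrK setDE setUIl setvU setIT; congr (PM _ Q); apply/setUidPl.
Qed.

Lemma pm_C D Q : measurable D -> PM (~` D) Q = Q - PM D Q.
Proof. by move=> mD; rewrite -setTD pm_diff// pm_setT. Qed.

(** The squared norm is controlled by the integral of [g n], where [g n t] is the squared norm of
    the section projection at [x] and decreases to 0 for each [t]. The sets [A n] where [g n > del]
    then decrease to the empty set, so [F2 (A n) y] is small and [sint_split] applies. *)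
Lemma pm_decr_rk (D : nat -> set (X1 * X2)) x y : (forall n, measurable (D n)) ->
  (forall n, D n.+1 `<=` D n) -> (forall t, exists n, ~ D n t) ->
  forall e : R, 0 < e -> exists N, forall n, (N <= n)%N -> rn (PM (D n) (rk x y)) <= e.
Proof.
move=> mD sD D0 e e0.
pose g n := section_fun F1 (D n) x x.
have mY n t : measurable (ysection (D n) t) by exact: measurable_ysection.
have sY n t : ysection (D n.+1) t `<=` ysection (D n) t.
  by rewrite !ysection_preimage => s; exact: sD.
have gE n t : g n t = (rn (F1 (ysection (D n) t) x) ^+ 2)%:C%C by exact: sp_sqr.
have gdecr n t : complex.Re (g n.+1 t) <= complex.Re (g n t).
  rewrite !gE/= -(sp_sub hF1 x (mY n t) (mY n.+1 t) (sY n t)).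
  rewrite ler_pXn2r ?nnegrE ?rn_ge0// (sp_cap hF1)// setIC -(sp_cap hF1)//.
  exact: (sem_contr sF1).
(* [c] bounds [g n]. Off [A n] the choice of [del] uses up half of [e ^+ 2]; the bound asked of
   [F2 (A n) y] uses the other half. *)
pose c := rn x * rn x; pose del := e ^+ 2 / (2 * (rn y ^+ 2 + 1)).
have y1 : 0 < rn y ^+ 2 + 1 by rewrite ltr_wpDl// sqr_ge0.
have del0 : 0 < del by rewrite divr_gt0 ?exprn_gt0// mulr_gt0.
pose A n := [set t | del < complex.Re (g n t)].
have mA n : measurable (A n).
  have [mr _] := section_cmeasurable sF1 x x (mD n).
  have := mr measurableT `]del, +oo[%classic (measurable_itv _); rewrite setTI.
  by rewrite set_itvE.
have sA n : A n.+1 `<=` A n by move=> t /= /lt_le_trans; apply; exact: gdecr.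
have A0 t : exists n, ~ A n t.
  have [|N hN] := sem_decr sF1 x x (mY ^~ t) (sY ^~ t) _ del0.
    move=> s; have [n nD] := D0 (s, t); exists n; by rewrite ysection_preimage.
  exists N; rewrite /A /= => /lt_le_trans/(_ (le_trans (ler_norm _) (le_trans (Re_le_cabs _) (hN N (leqnn N))))).
  by rewrite ltxx.
have c1 : 0 < (c + 1) * 2 by rewrite mulr_gt0// ltr_wpDl// mulr_ge0 ?rn_ge0.
have P2 : 0 < (e ^+ 2 / ((c + 1) * 2 * (rn y + 1))) by rewrite divr_gt0 ?exprn_gt0// mulr_gt0// ltr_wpDl// rn_ge0.
have [N hN] := sem_decr sF2 y y mA sA A0 (exprn_gt0 2 P2).
exists N => n Nn; rewrite -(@ler_pXn2r _ 2) ?nnegrE ?rn_ge0 ?(ltW e0)//.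
have gs : simple_approx (g n) by exact: section_simple.
have h1 : rn (F2 (A n) y) <= e ^+ 2 / ((c + 1) * 2 * (rn y + 1)).
  rewrite -(@ler_pXn2r _ 2) ?nnegrE ?rn_ge0 ?(ltW P2)//.
  by have := hN n Nn; rewrite (sp_sqr hF2)// cabs_real ger0_norm ?sqr_ge0.
have c0 : 0 <= c by rewrite mulr_ge0 ?rn_ge0.
have h2 : rn (sint F2 (g n) y) <= del * rn y + c * rn (F2 (A n) y).
  apply: (sint_split hF2 y gs (mA n) (ltW del0) c0) => t.
    by move=> /negP; rewrite -leNgt gE/= cabs_real ger0_norm ?sqr_ge0.
  by move=> _; exact: section_le.
rewrite -lecR (le_trans (pm_sqr _ _))//.
have r0 := pm_ge0 (rk x y) (mD n).
rewrite -[leLHS](ger0_norm r0) -cabsE lecR pm_rk// (le_trans (cabs_inner _ _))//.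
rewrite (le_trans (ler_wpM2r (rn_ge0 y) h2))// mulrDl.
have -> : e ^+ 2 = del * (rn y ^+ 2 + 1) + (c + 1) * (e ^+ 2 / ((c + 1) * 2 * (rn y + 1))) * (rn y + 1).
  rewrite /del; field; rewrite !gt_eqF//= ?ltr_wpDl ?rn_ge0 ?sqr_ge0//.
rewrite lerD//.
  by rewrite -mulrA -expr2 ler_wpM2l ?(ltW del0)// lerDl.
apply: ler_pM; rewrite ?mulr_ge0 ?rn_ge0 ?lerDl//.
by apply: ler_pM; rewrite ?rn_ge0 ?lerDl.
Qed.

Lemma pm_rect_rk D A B x y : measurable D -> measurable A -> measurable B ->
  PM D (rk (F1 A x) (F2 B y)) = PM (D `&` A `*` B) (rk x y).
Proof.
move=> mD mA mB; have mAB := measurableX mA mB.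
have mDA := measurableI _ _ mD mAB.
apply: hs_ext => a b; rewrite !pm_rk// /product_form.
have -> : section_fun F1 (D `&` A `*` B) x a = fun t => cindic R B t * section_fun F1 D (F1 A x) a t.
  apply/funext => t; rewrite /section_fun.
  have -> : ysection (D `&` A `*` B) t = ysection D t `&` ysection (A `*` B) t by rewrite !ysection_preimage.
  rewrite ysectionX /cindic; case: asbool.
    by rewrite mul1r (sp_cap hF1)//; exact: measurable_ysection.
  by rewrite setI0 (sem0 sF1) inner0l mul0r.
rewrite sintM//; [|exact: simple_approx_indic|exact: section_simple].
by rewrite sint_indic// (sem_sa sF2).
Qed.

Lemma pm_tail_rk (D : nat -> set (X1 * X2)) x y : (forall n, measurable (D n)) ->
  trivIset setT D -> forall e : R, 0 < e -> exists N, forall n, (N <= n)%N ->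
  rn (PM (\bigcup_n D n) (rk x y) - \sum_(k < n) PM (D k) (rk x y)) <= e.
Proof.
move=> mD tD; pose S n := \big[setU/set0]_(k < n) D k.
have mS n : measurable (S n) by exact: bigsetU_measurable.
have SU n : S n `<=` \bigcup_n D n.
  by rewrite /S -bigcup_mkord => t [k _ Dk]; exists k.
have mU : measurable (\bigcup_n D n) by exact: bigcup_measurable.
have PS n : PM (S n) (rk x y) = \sum_(k < n) PM (D k) (rk x y).
  elim: n => [|n IH]; first by rewrite /S !big_ord0 pm_set0.
  rewrite {1}/S big_ord_recr/= -/(S n) pm_U//; first by rewrite big_ord_recr IH.
  rewrite -subset0 => t [].
  rewrite /S -bigcup_mkord => -[k /= kn Dk] Dn.
  by have := tD k n I I (ex_intro _ t (conj Dk Dn)) => E; rewrite E ltnn in kn.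
move=> e e0; have [|||N hN] := @pm_decr_rk (fun n => \bigcup_n D n `\` S n) x y _ _ _ e e0.
- by move=> n; exact: measurableD.
- move=> n t [Ut nS]; split=> // St; apply: nS.
  by rewrite /S big_ord_recr; left.
- move=> t; have [[k _ Dk]|nU] := pselect ((\bigcup_n D n) t); last by exists 0 => -[].
  by exists k.+1 => -[_]; apply; rewrite /S big_ord_recr; right.
by exists N => n /hN; rewrite pm_diff// PS.
Qed.

(** Induction on [D']. The union step needs additivity in norm, which at this point is known on rank
    one operators only. *)
Lemma pm_M_rk D D' x y : measurable D -> measurable D' ->
  PM D (PM D' (rk x y)) = PM (D `&` D') (rk x y).
Proof.
move=> mD mD'; move: D' mD'; apply: rect_induction => [A B mA mB|D' mD' IH|D' mD' tD' IH].
- by rewrite pm_rect// rect_op_rk// pm_rect_rk.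
- have mI := measurableI _ _ mD mD'.
  rewrite pm_C// (linopB (pm_lin mD)) IH -(pm_diff _ mD mI (@subIsetl _ _ _)).
  by congr (PM _ _); rewrite !setDE setCI setIUr setICr set0U.
have mU : measurable (\bigcup_n D' n) by exact: bigcup_measurable.
apply: eq_rn_small => e e0; have e2 : 0 < e / 2 by rewrite divr_gt0.
have mI n : measurable (D `&` D' n) by exact: measurableI.
have tI : trivIset setT (fun n => D `&` D' n).
  by move=> i j _ _ [t [[_ h1] [_ h2]]]; apply: tD' => //; exists t.
have [N1 h1] := pm_tail_rk x y mD' tD' e2.
have [N2 h2] := pm_tail_rk x y mI tI e2.
pose n := maxn N1 N2; have k1 := h1 n (leq_maxl _ _); have k2 := h2 n (leq_maxr _ _).
rewrite setI_bigcupr.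
have k3 : rn (PM D (PM (\bigcup_n D' n) (rk x y)) - \sum_(k < n) PM (D `&` D' k) (rk x y)) <= e / 2.
  rewrite (eq_bigr (fun k => PM D (PM (D' (val k)) (rk x y)))); last by move=> k _; rewrite IH.
  rewrite -(linop_sum (pm_lin mD)) -(linopB (pm_lin mD)).
  exact: le_trans (pm_contr _ mD) k1.
rewrite rnC in k2; apply: le_trans (rn_dist _ _ _) _.
by apply: le_trans (lerD k3 k2) _; rewrite -splitr.
Qed.

(** Against a rank one operator both projections move to its side, where [pm_M_rk] applies. *)
Lemma pm_idem D Q : measurable D -> PM D (PM D Q) = PM D Q.
Proof.
move=> mD; apply: hs_ext => a b.
rewrite (pm_sa (PM D Q) (rk a b) mD) (pm_sa Q (PM D (rk a b)) mD) (pm_M_rk a b mD mD) setIid.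
by rewrite (pm_sa Q (rk a b) mD).
Qed.

Lemma pm_sqrE D Q : measurable D -> inner (PM D Q) Q = (rn (PM D Q) ^+ 2)%:C%C.
Proof. by move=> mD; rewrite -inner_rn -(pm_sa (PM D Q) Q mD) (pm_idem Q mD). Qed.

(* The strong limit of the decreasing projections [PM (D n)] is orthogonal to all the rank one operators. *)
Lemma pm_decr (D : nat -> set (X1 * X2)) Q : (forall n, measurable (D n)) ->
  (forall n, D n.+1 `<=` D n) -> (forall t, exists n, ~ D n t) ->
  forall e : R, 0 < e -> exists N, forall n, (N <= n)%N -> rn (PM (D n) Q) <= e.
Proof.
move=> mD sD D0.
have sD' n m : (n <= m)%N -> D m `<=` D n.
  by move=> /subnK <-; elim: (m - n)%N => // k IH; apply: subset_trans IH; rewrite addSn.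
have sqr n : inner (PM (D n) Q) Q = (rn (PM (D n) Q) ^+ 2)%:C%C.
  exact: pm_sqrE.
(* The difference of nested projections is a projection, so the vectors are Cauchy as soon as their
   squared norms are, and these decrease. *)
have dist n m : (n <= m)%N -> rn (PM (D n) Q - PM (D m) Q) ^+ 2 = rn (PM (D n) Q) ^+ 2 - rn (PM (D m) Q) ^+ 2.
  move=> nm; have mnm := measurableD (mD n) (mD m).
  have E := pm_diff Q (mD n) (mD m) (sD' _ _ nm).
  by apply: complexI; rewrite -E -(pm_sqrE Q mnm) E innerBl !sqr rmorphB.
pose u n := rn (PM (D n) Q) ^+ 2.
have udecr n m : (n <= m)%N -> u m <= u n.
  by move=> /dist h; rewrite -subr_ge0 -h sqr_ge0.
pose S := [set u n | n in setT].
have hS : has_inf S by split; [exists (u 0%N), 0%N|exists 0 => _ [n _ <-]; exact: sqr_ge0].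
have ulb n : inf S <= u n by apply: ge_inf; [case: hS|exists n].
have ucauchy (e : R) : 0 < e -> exists N, forall n m, (N <= n)%N -> (n <= m)%N -> u n - u m <= e.
  move=> e0; have [_ [N _ <-] hN] := inf_adherent e0 hS; exists N => n m Nn nm.
  rewrite lerBlDr (le_trans (udecr _ _ Nn))// (le_trans (ltW hN))// addrC lerD2l.
  exact: ulb.
have [v hv] : exists v, forall e : R, 0 < e -> exists N, forall n, (N <= n)%N -> rn (v - PM (D n) Q) <= e.
  apply: complete_seq => e e0; have [N hN] := ucauchy _ (exprn_gt0 2 e0).
  exists N => n m Nn Nm; rewrite -(@ler_pXn2r _ 2) ?nnegrE ?rn_ge0 ?(ltW e0)//.
  by have [nm|/ltnW mn] := leqP n m; [|rewrite rnC]; rewrite dist//; exact: hN.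
have v0 : v = 0.
  apply: hs_ext => a b; rewrite inner0l; apply: eq_cabs_small => e e0; rewrite subr0.
  have P : 0 < rn (rk a b) + rn Q + 1 by rewrite ltr_wpDl// addr_ge0 ?rn_ge0.
  have d0 := divr_gt0 e0 P.
  have [N1 h1] := hv _ d0; have [N2 h2] := pm_decr_rk a b mD sD D0 d0.
  pose n := maxn N1 N2; have k1 := h1 n (leq_maxl _ _); have k2 := h2 n (leq_maxr _ _).
  rewrite -(subrK (PM (D n) Q) v) innerDl pm_sa// (le_trans (cabsD _ _))//.
  rewrite (le_trans (lerD (cabs_inner _ _) (cabs_inner _ _)))//.
  rewrite (le_trans (lerD (ler_wpM2r (rn_ge0 _) k1) (ler_wpM2l (rn_ge0 _) k2)))//.
  set t := e / _; have -> : e = t * (rn (rk a b) + rn Q + 1) by rewrite /t divfK// gt_eqF.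
  have t0 : 0 <= t by exact: ltW.
  lra.
by move=> e /hv[N hN]; exists N => n /hN; rewrite v0 sub0r rnN.
Qed.

Lemma product_spectral_measure : spectral_measure PM.
Proof.
split; last by move=> D mD; apply/funext => Q /=; exact: pm_idem.
split.
- move=> D mD; split; last by move=> Q; exact: pm_ge0.
  apply: (@bop_bounded _ _ _ 1); split; first exact: pm_lin.
  by move=> Q; rewrite mul1r pm_contr.
- by apply/funext => Q; exact: pm_set0.
- by apply/funext => Q; exact: pm_setT.
move=> D mD tD Q Q'; pose S n := \big[setU/set0]_(k < n) D k.
have mS n : measurable (S n) by exact: bigsetU_measurable.
have SU n : S n `<=` \bigcup_n D n.
  by rewrite /S -bigcup_mkord => t [k _ Dk]; exists k.
have mU : measurable (\bigcup_n D n) by exact: bigcup_measurable.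
have PS n : PM (S n) Q = \sum_(k < n) PM (D k) Q.
  elim: n => [|n IH]; first by rewrite /S !big_ord0 pm_set0.
  rewrite {1}/S big_ord_recr/= -/(S n) pm_U//; first by rewrite big_ord_recr IH.
  rewrite -subset0 => t [].
  rewrite /S -bigcup_mkord => -[k /= kn Dk] Dn.
  by have := tD k n I I (ex_intro _ t (conj Dk Dn)) => E; rewrite E ltnn in kn.
apply/cvg_cabsP => e e0; have c0 : 0 < rn Q' + 1 by rewrite ltr_wpDl// rn_ge0.
have [|||N hN] := @pm_decr (fun n => \bigcup_n D n `\` S n) Q _ _ _ _ (divr_gt0 e0 c0).
- by move=> n; exact: measurableD.
- move=> n t [Ut nS]; split=> // St; apply: nS.
  by rewrite /S big_ord_recr; left.
- move=> t; have [[k _ Dk]|nU] := pselect ((\bigcup_n D n) t); last by exists 0 => -[].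
  by exists k.+1 => -[_]; apply; rewrite /S big_ord_recr; right.
exists N => // n /= Nn; rewrite -inner_suml -PS -innerBl -pm_diff//.
rewrite (le_lt_trans (cabs_inner _ _))// (le_lt_trans (ler_wpM2r (rn_ge0 _) (hN n Nn)))//.
by rewrite mulrAC ltr_pdivrMr// ltr_pM2l// ltrDl.
Qed.

End ProductMeasure.

(** * Dilations of contractions *)

Section ZeroSets.
Variables (d : measure_display) (X : measurableType d) (R : realType) (h : X -> R[i]).
Hypothesis hh : simple_approx h.

(** The square is the product of [h t] with its conjugate, which stays within the algebra of
    integrable functions. *)
Let sqr_measurable : measurable_fun setT (fun t => cabs (h t) ^+ 2).
Proof.
have [m _] := simple_cmeasurable (simple_approxM hh (simple_approx_conj hh)).
by move: m; congr measurable_fun; apply/funext => t; rewrite -cabs_sqr.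
Qed.

Lemma measurable_zero_set : measurable [set t | h t = 0].
Proof.
have := sqr_measurable measurableT (measurable_set1 (0 : R)); rewrite setTI.
congr measurable; apply/seteqP; split=> t /=; last by move=> ->; rewrite cabs0 expr0n.
by move=> /eqP; rewrite sqrf_eq0 => /eqP/cabs_eq0.
Qed.

Lemma measurable_punctured (e : R) : 0 < e -> measurable [set t | h t != 0 /\ cabs (h t) < e].
Proof.
move=> e0.
have := sqr_measurable measurableT (measurable_itv `]0, (e ^+ 2)[); rewrite setTI.
congr measurable; apply/seteqP; split=> t /=; rewrite in_itv/= ltr_pXn2r ?nnegrE ?cabs_ge0 ?(ltW e0)//.
  move=> /andP[h0 ->]; split=> //; apply/eqP => E.
  by move: h0; rewrite E cabs0 expr0n ltxx.
move=> [h0 ->]; rewrite andbT exprn_gt0// lt_neqAle cabs_ge0 andbT eq_sym.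
by apply/eqP => /cabs_eq0/eqP; rewrite (negbTE h0).
Qed.

(** With the zero set removed, these sets shrink to the empty set, so continuity from above
    applies. *)
Lemma punctured_decr (K : hilbertType R) (F : set X -> K -> K) (v : K) : spectral_measure F ->
  forall e : R, 0 < e -> exists2 del : R, 0 < del &
    rn (F [set t | h t != 0 /\ cabs (h t) < del] v) <= e.
Proof.
move=> hF e e0; pose A (n : nat) := [set t | h t != 0 /\ cabs (h t) < n.+1%:R^-1].
have [|||N hN] := sem_decr (proj1 hF) v v (A := A) _ _ _ (exprn_gt0 2 e0).
- by move=> n; apply: measurable_punctured; rewrite invr_gt0 ltr0n.
- move=> n t [h0 ht]; split=> //; apply: (lt_le_trans ht).
  by rewrite lef_pV2 ?posrE ?ltr0n// ler_nat.
- move=> t; have [h0|h0] := eqVneq (h t) 0; first by exists 0%N => -[]; rewrite h0 eqxx.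
  have c0 : 0 < cabs (h t) by rewrite cabs_gt0.
  have [N _ hN] := near_infty_natSinv_lt (PosNum c0).
  exists N => -[_]; apply/negP; rewrite -leNgt ltW//; exact: (hN N (leqnn N)).
have mA n : measurable (A n) by apply: measurable_punctured; rewrite invr_gt0 ltr0n.
exists N.+1%:R^-1; first by rewrite invr_gt0 ltr0n.
rewrite -(@ler_pXn2r _ 2) ?nnegrE ?rn_ge0 ?(ltW e0)//.
by have := hN N (leqnn N); rewrite (sp_sqr hF)// cabs_real ger0_norm ?sqr_ge0.
Qed.

End ZeroSets.

(** * Isometries and compressions *)

Section Isometry.
Variables (R : realType) (H K : hilbertType R) (J : H -> K) (Js : K -> H).
Hypotheses (iso : isometric_embedding J) (hJ : forall x y, inner (J x) y = inner x (Js y)).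
Implicit Types (x y : H) (v : K).

Lemma isometry_rn x : rn (J x) = rn x.
Proof. by case: iso => _ h; rewrite /rn h. Qed.

Lemma isometry_bop : bop 1 J.
Proof. by case: iso => h _; split=> // x; rewrite mul1r isometry_rn. Qed.

Lemma coisometry_bop : bop 1 Js.
Proof. exact: bop_adjoint ler01 isometry_bop hJ. Qed.

Lemma coisometry_le v : rn (Js v) <= rn v.
Proof. by rewrite -[leRHS]mul1r; case: coisometry_bop. Qed.

Lemma coisometry_inner v x : inner (Js v) x = inner v (J x).
Proof. by rewrite inner_conj -hJ -inner_conj. Qed.

(** [1 - J^* J] has zero quadratic form, hence vanishes by [positive_contraction_sqr]. *)
Lemma isometryK x : Js (J x) = x.
Proof.
pose B x := x - Js (J x).
have lB : linear_op B.
  by move=> a y z; rewrite /B (proj1 isometry_bop) (proj1 coisometry_bop) scalerBr opprD addrACA.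
have B0 y : inner (B y) y = 0.
  by rewrite /B innerBl coisometry_inner !inner_rn isometry_rn subrr.
have := @positive_contraction_sqr _ _ B lB _ _ x.
have h1 : forall y, 0 <= inner (B y) y by move=> y; rewrite B0.
have h2 : forall y, inner (B y) y <= inner y y by move=> y; rewrite B0 inner_ge0.
move=> /(_ h1 h2); rewrite B0 -(rmorph0 (real_complex R)) lecR => h.
by apply/esym/eqP; rewrite -subr_eq0; apply/eqP/rn_eq0/eqP; rewrite -sqrf_eq0 eq_le h sqr_ge0.
Qed.

Lemma compressionE (A : K -> K) (B : H -> H) : compression J A B -> forall x, B x = Js (A (J x)).
Proof.
move=> h x; apply: inner_extl => y; apply/esym/eqP.
have := h x y; rewrite innerBl => /eqP; rewrite subr_eq0 coisometry_inner => /eqP ->.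
by rewrite -coisometry_inner isometryK.
Qed.

Lemma compression_coisometry (A : K -> K) : compression J A (fun x => Js (A (J x))).
Proof. by move=> x y; rewrite -coisometry_inner (linopB (proj1 coisometry_bop)) isometryK subrr inner0l. Qed.

Lemma compression_semispectral (d : measure_display) (X : measurableType d) (F : set X -> K -> K) :
  semispectral_measure F -> semispectral_measure (fun D x => Js (F D (J x))).
Proof.
move=> sF; split.
- move=> D mD; split; last by move=> x; rewrite coisometry_inner sem_pos.
  apply: (@bop_bounded _ _ _ 1); split=> [a x y|x].
    by rewrite (proj1 isometry_bop) (sem_lin sF mD) (proj1 coisometry_bop).
  by rewrite mul1r (le_trans (coisometry_le _))// (le_trans (sem_contr sF _ mD))// isometry_rn.
- by apply/funext => x; rewrite (sem0 sF) (linop0 (proj1 coisometry_bop)).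
- by apply/funext => x; rewrite (semT sF) isometryK.
move=> D mD tD x y; rewrite coisometry_inner.
by under eq_fun do under eq_bigr do rewrite coisometry_inner; case: sF => _ _ _; apply.
Qed.

End Isometry.

Definition cval (R : realType) (z : borel_circle R) : R[i] := circle_val z.

Lemma cabs_cval (R : realType) (z : borel_circle R) : cabs (cval z) = 1.
Proof.
by apply: complexI; rewrite cabsE /cval /circle_val rmorph1; case: z => w /= /eqP.
Qed.

Section Dilated.
Variables (R : realType) (H K : hilbertType R) (T : H -> H) (J : H -> K) (Js : K -> H) (U : K -> K).
Variables (F : set (borel_circle R) -> K -> K) (E : set (borel_circle R) -> H -> H).
Hypothesis dil : unitary_dilation T J U.
Hypothesis hF : spectral_measure F.
Hypothesis hI : is_spectral_integral F (@circle_val R) U.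
Hypothesis hC : forall D, measurable D -> compression J (F D) (E D).
Hypothesis hJ : forall x y, inner (J x) y = inner x (Js y).
Implicit Types (x y : H) (v : K).
Local Notation cval := (@cval R).

Lemma dilation_isometry : isometric_embedding J.
Proof. by case: dil. Qed.

Let iso := dilation_isometry.
Let dilJ_rn := isometry_rn iso.
Let dilJs_le := coisometry_le iso hJ.
Let Jslin : linear_op Js := proj1 (coisometry_bop iso hJ).
Let Jlin : linear_op J := proj1 (isometry_bop iso).

Lemma dilE D x : measurable D -> E D x = Js (F D (J x)).
Proof. by move=> mD; apply: (compressionE iso hJ); exact: hC. Qed.

(** The coordinate of the circle is integrable because the dilation [U] is its integral. *)
Lemma simple_cval : simple_approx cval.
Proof. exact: (spectral_integral_sint hF hI).1. Qed.

Lemma iterU n v : iter n U v = sint F (fun z => cval z ^+ n) v.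
Proof.
elim: n => [|n IH]; first by rewrite (sint_cst hF) scale1r.
rewrite iterS IH (spectral_integral_sint hF hI).2 -[circle_val (R:=R)]/cval.
rewrite -sintM//; [|exact: simple_cval|exact: simple_approxX simple_cval].
by congr (sint F _ v); apply/funext => z; rewrite exprS.
Qed.

Lemma iterT n x : iter n T x = Js (sint F (fun z => cval z ^+ n) (J x)).
Proof. by rewrite -iterU; apply: (compressionE iso hJ); case: dil. Qed.

Lemma dilT_bop : bop 1 T.
Proof.
have TE x : T x = Js (U (J x)) by rewrite -[T x]/(iter 1 T x) iterT -iterU.
case: (dil) => _ [Ul Un _] _; split=> [a x y|x].
  by rewrite !TE Jlin (Ul a) Jslin.
by rewrite TE mul1r (le_trans (dilJs_le _))// {1}/rn Un -[complex.Re _]/(rn (J x)) dilJ_rn.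
Qed.

Lemma iterT_bop n : bop 1 (iter n T).
Proof.
elim: n => [|n [IHl IHn]]; first by split=> [//|x]; rewrite mul1r.
case: dilT_bop => Tl Tn; split=> [a x y|x]; first by rewrite !iterS IHl Tl.
by rewrite iterS mul1r (le_trans (Tn _))// mul1r -[leRHS]mul1r.
Qed.

Lemma sint_powers n (c : nat -> R[i]) x :
  Js (sint F (fun z => \sum_(k < n) c k * cval z ^+ k) (J x)) = \sum_(k < n) c k *: iter k T x.
Proof.
have sX k : simple_approx (fun z => cval z ^+ k) by exact: simple_approxX simple_cval.
rewrite sint_sum//; last by move=> k; exact: simple_approxZ.
rewrite (linop_sum Jslin); apply: eq_bigr => k _.
by rewrite sintZ// (linopZ Jslin) -iterT.
Qed.

Lemma simple_poly (p : {poly R[i]}) : simple_approx (fun z => p.[cval z]).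
Proof.
under eq_fun do rewrite horner_coef.
by apply: simple_approx_sum => i; apply: simple_approxZ; exact: simple_approxX simple_cval.
Qed.

Lemma poly_operator_sint (p : {poly R[i]}) x :
  poly_operator p T x = Js (sint F (fun z => p.[cval z]) (J x)).
Proof.
rewrite /poly_operator -(sint_powers (size p) (fun k => p`_k)).
by congr (Js (sint F _ _)); apply/funext => z; rewrite horner_coef.
Qed.

Section Calculus.
Variables (f : R[i] -> R[i]) (p : nat -> {poly R[i]}).
Hypothesis hp : forall e : R, 0 < e -> exists N, forall n, (N <= n)%N ->
  forall z, cabs z <= 1 -> cabs ((p n).[z] - f z) <= e.

Lemma simple_disk : simple_approx (f \o cval).
Proof.
apply: simple_approx_unif => e /hp[N hN]; exists (fun z => (p N).[cval z]).
  exact: simple_poly.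
by move=> z; rewrite cabsC hN// cabs_cval.
Qed.

(** Von Neumann's inequality for [q - f], read off from the dilation: [J] and its adjoint are
    contractions, and the integral is bounded by the supremum on the circle. *)
Lemma poly_operator_near (q : {poly R[i]}) (e : R) x : 0 <= e ->
  (forall z, cabs z <= 1 -> cabs (q.[z] - f z) <= e) ->
  rn (poly_operator q T x - Js (sint F (f \o cval) (J x))) <= e * rn x.
Proof.
move=> e0 h; rewrite poly_operator_sint -(linopB Jslin).
rewrite -sintB//; [|exact: simple_poly|exact: simple_disk].
rewrite (le_trans (dilJs_le _))// -(dilJ_rn x); apply: sint_le => //.
  by apply: simple_approxB; [exact: simple_poly|exact: simple_disk].
by move=> z; rewrite h// cabs_cval.
Qed.

(** [disk_calculus] chooses among all limits of polynomial approximations, so these limits have to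
    be shown equal. *)
Lemma disk_calculus_sint x : disk_calculus f T x = Js (sint F (f \o cval) (J x)).
Proof.
pose A x := Js (sint F (f \o cval) (J x)).
suff : disk_calculus f T = A by move=> ->.
have hA : is_disk_calculus f T A.
  exists p; split=> _ /posC_ex[e e0 ->]; have [N hN] := hp e0; exists N => // n /hN h.
    by move=> z; rewrite -!cabsE -(rmorph1 (real_complex R)) !lecR; exact: h.
  by move=> y; rewrite -!rnE -rmorphM lecR; apply: poly_operator_near => //; exact: ltW.
apply: xget_unique => // B [q [qf qB]]; apply/funext => y; apply: eq_rn_small => e e0.
have P : 0 < 2 * (rn y + 1) by rewrite mulr_gt0// ltr_wpDl// rn_ge0.
have d0 := divr_gt0 e0 P; set r := e / _ in d0.
have [N1 _ h1] := qf r%:C%C (etrans (ltcR 0 r) d0).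
have [N2 _ h2] := qB r%:C%C (etrans (ltcR 0 r) d0).
have k1 := h1 (maxn N1 N2) (leq_maxl _ _); have /(_ y) := h2 (maxn N1 N2) (leq_maxr _ _).
rewrite -!rnE -rmorphM lecR => k2.
have := @poly_operator_near (q (maxn N1 N2)) r y (ltW d0).
have k3 : forall z, cabs z <= 1 -> cabs ((q (maxn N1 N2)).[z] - f z) <= r.
  by move=> z; have := k1 z; rewrite -!cabsE -(rmorph1 (real_complex R)) !lecR; exact.
move=> /(_ k3) k4.
rewrite (le_trans (rn_dist (poly_operator (q (maxn N1 N2)) T y) _ _))// rnC.
rewrite (le_trans (lerD k2 k4))//.
have -> : e = r * (2 * (rn y + 1)) by rewrite /r divfK// gt_eqF.
by have := rn_ge0 y; have := ltW d0; nra.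
Qed.

End Calculus.

(** * Atoms of the semi-spectral measure of a contraction *)

Section Atoms.
Variable t : borel_circle R.
Let h z := cval z - cval t.

Lemma simple_cval_sub : simple_approx h.
Proof. by apply: simple_approxB; [exact: simple_cval|exact: simple_approx_cst]. Qed.

Lemma measurable_atom : measurable [set t].
Proof.
have := measurable_zero_set simple_cval_sub; congr measurable.
apply/seteqP; split=> z /=; last by move=> ->; rewrite /h subrr.
by move/eqP; rewrite subr_eq0 => /eqP; exact: val_inj.
Qed.

(** Coefficients of the Cesaro mean [A n] of the powers of [(cval t)^* T]. The symbol of [A n] is 1
    at [t], of modulus at most 1 on the circle, and elsewhere at most [2 / n.+1] divided by the
    distance to [t]. *)
Let c n k : R[i] := n.+1%:R^-1 * (cval t)^* ^+ k.
Let A n x := \sum_(k < n.+1) c n k *: iter k T x.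

Let tt1 : cval t * (cval t)^* = 1.
Proof. by rewrite -cabs_sqr cabs_cval expr1n. Qed.

Let A_bound n z : cabs (\sum_(k < n.+1) c n k * cval z ^+ k) <= 1.
Proof.
rewrite (le_trans (cabs_sum _ _ _))//.
rewrite (eq_bigr (fun=> n.+1%:R^-1)) => [|k _].
  by rewrite sumr_const card_ord -[_ *+ _]mulr_natr mulVf// pnatr_eq0.
by rewrite !cabsM cabsV cabs_nat !cabsX cabs_conj !cabs_cval !expr1n !mulr1.
Qed.

Let A_off n z : cabs (\sum_(k < n.+1) c n k * cval z ^+ k) * cabs (h z) <= 2 * n.+1%:R^-1.
Proof.
pose w := (cval t)^* * cval z.
have -> : cabs (h z) = cabs (w - 1).
  rewrite /h (_ : cval z - cval t = cval t * (w - 1)); first by rewrite cabsM cabs_cval mul1r.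
  by rewrite mulrBr /w mulrA tt1 mul1r mulr1.
have -> : \sum_(k < n.+1) c n k * cval z ^+ k = n.+1%:R^-1 * \sum_(k < n.+1) w ^+ k.
  by rewrite mulr_sumr; apply: eq_bigr => k _; rewrite /c /w exprMn mulrA.
rewrite -cabsM -mulrA [X in _ * X]mulrC -subrX1 cabsM cabsV cabs_nat mulrC.
rewrite ler_wpM2r ?invr_ge0// (le_trans (cabsB _ _))// cabsX /w cabsM cabs_conj !cabs_cval.
by rewrite mul1r expr1n cabs1.
Qed.

(** The circle is split into [t], where the symbol is exactly 1, a punctured neighbourhood of [t]
    carrying little of [J x], and the rest, where the symbol is uniformly small. *)
Let A_cvg x (e : R) : 0 < e -> exists N, forall n, (N <= n)%N -> rn (E [set t] x - A n x) <= e.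
Proof.
move=> e0.
have P : 0 < rn x + 1 by rewrite ltr_wpDl// rn_ge0.
have d0 := divr_gt0 e0 P; set r := e / _ in d0.
have [del del0 hdel] := punctured_decr simple_cval_sub (J x) hF d0.
have [N _ hN] := near_infty_natSinv_lt (PosNum (divr_gt0 (mulr_gt0 d0 del0) (ltr0Sn R 1))).
exists N => n /hN/= /ltW h2.
have sA : simple_approx (fun z => \sum_(k < n.+1) c n k * cval z ^+ k).
  by apply: simple_approx_sum => k; apply: simple_approxZ; exact: simple_approxX simple_cval.
have sI : simple_approx (cindic R [set t]) by apply: simple_approx_indic; exact: measurable_atom.
rewrite dilE; last exact: measurable_atom.
rewrite /A -sint_powers -(linopB Jslin) -(sint_indic hF); last exact: measurable_atom.
rewrite -sintB// (le_trans (dilJs_le _))//.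
have mP := measurable_punctured simple_cval_sub del0.
rewrite (le_trans (sint_split hF (J x) (simple_approxB sI sA) mP (ltW d0) ler01 _ _))//.
- move=> z zP; rewrite /cindic; have [->|zt] := pselect (z = t).
    rewrite (asboolT (erefl _ : [set t] t)) (_ : \sum_(k < _) _ = 1) ?subrr ?cabs0 ?(ltW d0)//.
    rewrite (eq_bigr (fun=> n.+1%:R^-1)) => [|k _]; last by rewrite /c -mulrA -exprMn [_^* * _]mulrC tt1 expr1n mulr1.
    by rewrite sumr_const card_ord -[_ *+ _]mulr_natr mulVf// pnatr_eq0.
  rewrite (_ : `[< [set t] z >] = false); last by apply/asboolP.
  rewrite sub0r cabsN; have hz : del <= cabs (h z).
    rewrite leNgt; apply/negP => hz; apply: zP; split=> //.
    by rewrite subr_eq0; apply/eqP => /val_inj.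
  have h3 := A_off n z; rewrite -(ler_pM2r del0).
  apply: le_trans (ler_wpM2l (cabs_ge0 _) hz) _; apply: (le_trans h3).
  by rewrite mulrC -ler_pdivlMr.
- move=> z [hz _]; rewrite /cindic (_ : `[< [set t] z >] = false); last first.
    by apply/asboolP => /= zt; move: hz; rewrite /h zt subrr eqxx.
  by rewrite sub0r cabsN; exact: A_bound.
rewrite mul1r dilJ_rn (le_trans (lerD (lexx _) hdel))//.
by rewrite -[X in _ + X]mulr1 -mulrDr /r divfK// gt_eqF.
Qed.

Let A_comm n x : T (A n x) = A n (T x).
Proof.
case: dilT_bop => Tl _; rewrite /A (linop_sum Tl); apply: eq_bigr => k _.
by rewrite (linopZ Tl) -iterS iterSr.
Qed.

(** [c n k = cval t * c n k.+1], so all but the two end terms cancel. *)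
Let A_eigen n x : rn (T (A n x) - cval t *: A n x) <= 2 * rn x * n.+1%:R^-1.
Proof.
pose u k := (cval t * c n k) *: iter k T x.
have -> : T (A n x) - cval t *: A n x = u n.+1 - u 0%N.
  case: dilT_bop => Tl _; rewrite /A (linop_sum Tl) scaler_sumr -sumrB.
  rewrite -(@telescope_sumr _ 0 n.+1 u)// big_mkord; apply: eq_bigr => k _.
  rewrite (linopZ Tl) -iterS scalerA; congr (_ *: _ - _).
  by rewrite /c [_ * (_ ^+ k.+1)]mulrC mulrA exprS mulrA tt1 mul1r mulrC.
have ub k : rn (u k) <= rn x * n.+1%:R^-1.
  rewrite rnZ /c !cabsM cabsV cabs_nat cabsX cabs_conj cabs_cval expr1n mulr1 mul1r mulrC.
  by rewrite ler_wpM2r ?invr_ge0//; case: (iterT_bop k) => _ /(_ x); rewrite mul1r.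
rewrite (le_trans (rnB _ _))// (le_trans (lerD (ub _) (ub _)))//.
by rewrite mulrDl mulrDl !mul1r.
Qed.

(* Mean ergodic theorem: [E [set t]] is the strong limit of the averages of
   [((cval t)^* T) ^ k], although it need not be a projection. *)
Lemma atom_eigen x : T (E [set t] x) = cval t *: E [set t] x.
Proof.
apply: eq_rn_small => e e0; case: dilT_bop => Tl Tn.
have e4 : 0 < e / 4 by rewrite divr_gt0.
have P : 0 < 2 * rn x + 1 by rewrite ltr_wpDl// mulr_ge0 ?rn_ge0.
have [N hN] := A_cvg x e4; have [M _ hM] := near_infty_natSinv_lt (PosNum (divr_gt0 e4 P)).
pose n := maxn N M; have k1 := hN n (leq_maxl _ _); have /= /ltW k2 := hM n (leq_maxr _ _).
have k3 : 2 * rn x * n.+1%:R^-1 <= e / 4.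
  rewrite (@le_trans _ _ ((2 * rn x + 1) * (e / 4 / (2 * rn x + 1))))//; last by rewrite mulrC divfK// gt_eqF.
  by rewrite ler_pM ?invr_ge0// ?mulr_ge0 ?rn_ge0// lerDl.
have k4 := A_eigen n x.
have k5 : rn (T (E [set t] x) - T (A n x)) <= e / 4 by rewrite -(linopB Tl) (le_trans (Tn _))// mul1r.
have k6 : rn (cval t *: A n x - cval t *: E [set t] x) <= e / 4.
  by rewrite -scalerBr rnZ cabs_cval mul1r rnC.
rewrite (le_trans (rn_dist (T (A n x)) _ _))// (le_trans (lerD k5 (rn_dist (cval t *: A n x) _ _)))//.
rewrite (le_trans (lerD (lexx _) (lerD (le_trans k4 k3) k6)))//.
rewrite [leRHS](_ : _ = e / 4 + (e / 4 + e / 4) + e / 4); last by field.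
by rewrite lerDl ltW.
Qed.

Lemma atom_comm x : E [set t] (T x) = T (E [set t] x).
Proof.
apply: eq_rn_small => e e0; case: dilT_bop => Tl Tn.
have e2 : 0 < e / 2 by rewrite divr_gt0.
have [N hN] := A_cvg x e2; have [M hM] := A_cvg (T x) e2.
have k1 := hN (maxn N M) (leq_maxl _ _); have k2 := hM (maxn N M) (leq_maxr _ _).
rewrite (le_trans (rn_dist (A (maxn N M) (T x)) _ _))// [leRHS]splitr lerD// -A_comm -(linopB Tl).
by rewrite (le_trans (Tn _))// mul1r rnC.
Qed.

End Atoms.

End Dilated.

Section FiniteAtoms.
Variables (d : measure_display) (X : measurableType d) (R : realType) (K : hilbertType R).
Variable F : set X -> K -> K.
Hypothesis hF : spectral_measure F.
Hypothesis m1 : forall t : X, measurable [set t].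

Lemma atoms_sum (s : seq X) a : uniq s -> \sum_(t <- s) rn (F [set t] a) ^+ 2 <= rn a ^+ 2.
Proof.
move=> us; have [sF _] := hF.
suff [ms S] : measurable [set t | t \in s] /\ F [set t | t \in s] a = \sum_(t <- s) F [set t] a.
  rewrite -lecR -inner_rn rmorph_sum/=.
  rewrite (eq_bigr (fun t => inner (F [set t] a) a)); last by move=> t _; rewrite (sp_sqr hF).
  by rewrite -inner_sumlP -S; exact: sem_le.
elim: s us => [_|t s IH /= /andP[ts us]].
  by rewrite big_nil (_ : mkset _ = set0) ?(sem0 sF)//; rewrite -subset0 => z.
have [ms S] := IH us.
have -> : [set z | z \in t :: s] = [set t] `|` [set z | z \in s].
  apply/seteqP; split=> z /=; first by rewrite in_cons => /orP[/eqP|]; [left|right].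
  by rewrite in_cons => -[->|->]; rewrite ?eqxx ?orbT.
split; first exact: measurableU.
rewrite big_cons -S (semU sF)//; rewrite -subset0 => z /= [->].
exact/negP.
Qed.

(** By [atoms_sum] there are at most [rn a ^+ 2 / e] atoms of this size. *)
Lemma atoms_finite a (e : R) : 0 < e -> finite_set [set t | e <= rn (F [set t] a) ^+ 2].
Proof.
move=> e0; apply: contrapT => nf.
have [n hn] : exists n : nat, rn a ^+ 2 < n%:R * e.
  exists (Num.truncn (rn a ^+ 2 / e)).+1; rewrite -ltr_pdivrMr//; exact: truncnS_gt.
have [B Be Bn] := infinite_set_fset n nf.
have := atoms_sum a (fset_uniq B); apply/negP; rewrite -ltNge.
apply: (lt_le_trans hn); apply: (@le_trans _ _ (\sum_(t <- B) e)).
  by rewrite big_const_seq count_predT iter_addr_0 -[leRHS]mulr_natl ler_wpM2r ?(ltW e0)// ler_nat.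
by rewrite big_seq [leRHS]big_seq; apply: ler_sum => t /Be.
Qed.

End FiniteAtoms.

(** * Double operator integrals *)

Section Uniqueness.
Variables (R : realType) (d : measure_display) (X : measurableType d).
Variables (H K : hilbertType R) (E : set X -> H -> H) (J : H -> K) (Js : K -> H) (F : set X -> K -> K).
Hypothesis dil : spectral_dilation E J F.
Hypothesis hJ : forall x y, inner (J x) y = inner x (Js y).

Lemma compression_ssum (I : finType) (q : X -> I) (c : I -> R[i]) x : classifier q ->
  ssum E q c x = Js (ssum F q c (J x)).
Proof.
have [iso hF hC] := dil; have Jsl := proj1 (coisometry_bop iso hJ).
move=> mq; rewrite /ssum (linop_sum Jsl); apply: eq_bigr => i _.
by rewrite (linopZ Jsl) -(compressionE iso hJ (hC _ (mq i))).
Qed.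

Lemma compression_integral_near (f : X -> R[i]) (I : finType) (q : X -> I) (c : I -> R[i]) (e : R) x :
  simple_approx f -> 0 <= e -> classifier q -> snear f q c e ->
  rn (Js (sint F f (J x)) - ssum E q c x) <= e * rn x.
Proof.
have [iso hF hC] := dil; have Jsl := proj1 (coisometry_bop iso hJ).
move=> hf e0 mq fq; rewrite compression_ssum// -(linopB Jsl) (le_trans (coisometry_le iso hJ _))//.
by rewrite -(isometry_rn iso x); exact: sintP.
Qed.

End Uniqueness.

(** Simple sums of [F] compress to simple sums of [E], in which the dilation no longer occurs; hence
    all dilations give the same integral. *)
Lemma semispectral_integralE (R : realType) (d : measure_display) (X : measurableType d)
    (H K : hilbertType R) (E : set X -> H -> H) (J : H -> K) (Js : K -> H) (F : set X -> K -> K)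
    (f : X -> R[i]) x :
  spectral_dilation E J F -> (forall x y, inner (J x) y = inner x (Js y)) -> simple_approx f ->
  semispectral_integral E f x = Js (sint F f (J x)).
Proof.
move=> dil hJ hf; have [iso hF hC] := dil.
suff : semispectral_integral E f = (fun x => Js (sint F f (J x))) by move=> ->.
apply: xget_unique.
  exists K, J, F, (sint F f); split=> //; first exact: sint_spectral_integral.
  exact: compression_coisometry.
move=> A [K' [J' [F' [B [dil' BI cA]]]]].
have [iso' hF' hC'] := dil'; move: cA; rewrite (spectral_integral_sint hF' BI).2 => cA.
have bJ' := isometry_bop iso'.
have [Js' hJ'] := adjoint_exists bJ'.1 bJ'.2.
apply/funext => z; rewrite (compressionE iso' hJ' cA); apply: eq_rn_small => e e0.
have P : 0 < 2 * (rn z + 1) by rewrite mulr_gt0// ltr_wpDl// rn_ge0.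
have d0 := divr_gt0 e0 P; set r := e / _ in d0.
have [I [q [c [mq fq]]]] := hf r d0.
have h1 := compression_integral_near dil hJ z hf (ltW d0) mq fq.
have h2 := compression_integral_near dil' hJ' z hf (ltW d0) mq fq.
rewrite (le_trans (rn_dist (ssum E q c z) _ _))// [X in _ + X]rnC (le_trans (lerD h2 h1))//.
have -> : e = r * (2 * (rn z + 1)) by rewrite /r divfK// gt_eqF.
by have := rn_ge0 z; have := ltW d0; nra.
Qed.

(** This pins down the measure chosen by [product_measure], on measurable sets only, since its
    values elsewhere are unconstrained. *)
Lemma product_measure_unique (R : realType) (d1 d2 : measure_display) (X1 : measurableType d1)
    (X2 : measurableType d2) (H1 H2 : hilbertType R) (E1 : set X1 -> H1 -> H1) (E2 : set X2 -> H2 -> H2)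
    (G G' : set (X1 * X2) -> hs_operator H2 H1 -> hs_operator H2 H1) :
  is_product_measure E1 E2 G -> is_product_measure E1 E2 G' -> forall D, measurable D -> G D = G' D.
Proof.
move=> [sG rG] [sG' rG']; apply: rect_induction => [A B mA mB|D mD DE|D mD tD DE].
- by apply/funext => Q; apply: hs_eq => x; rewrite rG// rG'.
- by apply/funext => Q; rewrite (semC sG)// (semC sG')// DE.
apply/funext => Q; apply: inner_extl => Q'; apply: eq_cabs_small => e e0.
have e2 : 0 < e / 2 by rewrite divr_gt0.
have [N hN] := sem_sigma sG Q Q' mD tD e2; have [M hM] := sem_sigma sG' Q Q' mD tD e2.
have h1 := hN (maxn N M) (leq_maxl _ _); have h2 := hM (maxn N M) (leq_maxr _ _).
rewrite (le_trans (cabs_dist (\sum_(k < maxn N M) inner (G (D k) Q) Q') _ _))//.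
rewrite [leRHS]splitr; apply: lerD; first exact: h1.
have S : \sum_(k < maxn N M) inner (G (D k) Q) Q' = \sum_(k < maxn N M) inner (G' (D k) Q) Q'.
  by apply: eq_bigr => k _; rewrite DE.
by rewrite S cabsC; exact: h2.
Qed.

Section ProductDilation.
Variables (R : realType) (d1 d2 : measure_display) (X1 : measurableType d1) (X2 : measurableType d2).
Variables (H1 H2 K1 K2 : hilbertType R) (J1 : H1 -> K1) (J2 : H2 -> K2) (J1s : K1 -> H1) (J2s : K2 -> H2).
Variables (F1 : set X1 -> K1 -> K1) (F2 : set X2 -> K2 -> K2).
Variables (E1 : set X1 -> H1 -> H1) (E2 : set X2 -> H2 -> H2).
Hypotheses (dil1 : spectral_dilation E1 J1 F1) (dil2 : spectral_dilation E2 J2 F2).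
Hypothesis hJ1 : forall x y, inner (J1 x) y = inner x (J1s y).
Hypothesis hJ2 : forall x y, inner (J2 x) y = inner x (J2s y).
Local Notation PM := (product_spectral F1 F2).

Let iso1 : isometric_embedding J1. Proof. by case: dil1. Qed.
Let iso2 : isometric_embedding J2. Proof. by case: dil2. Qed.
Let hF1 : spectral_measure F1. Proof. by case: dil1. Qed.
Let hF2 : spectral_measure F2. Proof. by case: dil2. Qed.
Let bJ1 := isometry_bop iso1.
Let bJ2 := isometry_bop iso2.
Let bJ1s := coisometry_bop iso1 hJ1.
Let bJ2s := coisometry_bop iso2 hJ2.

(** [Q |-> J1 Q J2^*], the embedding under which the product of [F1] and [F2] dilates the product of
    [E1] and [E2]; [hs_drop] is its adjoint. *)
Definition hs_lift : hs_operator H2 H1 -> hs_operator K2 K1 := sandwich J1 J2s.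
Definition hs_drop : hs_operator K2 K1 -> hs_operator H2 H1 := sandwich J1s J2.

Lemma hs_liftE Q y : hs_lift Q y = J1 (Q (J2s y)).
Proof. exact: (sandwichE ler01 ler01 bJ1 bJ2s). Qed.

Lemma hs_dropE Q y : hs_drop Q y = J1s (Q (J2 y)).
Proof. exact: (sandwichE ler01 ler01 bJ1s bJ2). Qed.

Lemma hs_drop_lin : linear_op hs_drop.
Proof. exact: (sandwich_lin ler01 ler01 bJ1s bJ2). Qed.

Lemma hs_lift_adj Q Q' : inner (hs_lift Q) Q' = inner Q (hs_drop Q').
Proof.
apply: (sandwich_adjoint ler01 ler01 bJ1 bJ2s hJ1) => x y.
exact: coisometry_inner.
Qed.

Lemma hs_lift_iso : isometric_embedding hs_lift.
Proof.
split=> [a Q Q'|Q]; first exact: (sandwich_lin ler01 ler01 bJ1 bJ2s).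
rewrite -!rnE; congr (_%:C%C); apply/eqP; rewrite -(@eqrXn2 _ 2) ?rn_ge0//; apply/eqP/complexI.
rewrite -!inner_rn hs_lift_adj; congr (inner _ _); apply: hs_eq => x.
by rewrite hs_dropE hs_liftE (isometryK iso1 hJ1) (isometryK iso2 hJ2).
Qed.

Lemma hs_lift_rank_one x y : hs_lift (rank_one x y) = rank_one (J1 x) (J2 y).
Proof.
apply: (sandwich_rank_one ler01 ler01 bJ1 bJ2s) => u v.
exact: coisometry_inner.
Qed.

Lemma compressed_product_measure : is_product_measure E1 E2 (fun D Q => hs_drop (PM D (hs_lift Q))).
Proof.
have [sPM _] := product_spectral_measure hF1 hF2.
split; first exact: (@compression_semispectral R _ _ hs_lift hs_drop hs_lift_iso hs_lift_adj _ _ PM sPM).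
move=> A B mA mB Q x.
have [_ _ hC1] := dil1; have [_ _ hC2] := dil2.
rewrite hs_dropE (pm_rect hF1 hF2)// (rect_opE hF1 hF2)// hs_liftE.
by rewrite (compressionE iso1 hJ1 (hC1 _ mA)) (compressionE iso2 hJ2 (hC2 _ mB)).
Qed.

Lemma product_dilation : spectral_dilation (product_measure E1 E2) hs_lift PM.
Proof.
split; [exact: hs_lift_iso|exact: product_spectral_measure|move=> D mD].
suff -> : product_measure E1 E2 D = (fun Q => hs_drop (PM D (hs_lift Q))).
  exact: compression_coisometry hs_lift_iso hs_lift_adj _.
have h := compressed_product_measure.
apply: (product_measure_unique (E1 := E1) (E2 := E2) _ h mD).
by rewrite /product_measure; case: xgetP => [G -> //|/(_ _ h)].
Qed.

Lemma double_operator_integralE (f : X1 * X2 -> R[i]) Q : simple_approx f ->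
  double_operator_integral E1 E2 f Q = hs_drop (sint PM f (hs_lift Q)).
Proof. exact: semispectral_integralE product_dilation hs_lift_adj. Qed.

End ProductDilation.

(** * Functions of one variable under the product measure *)

Section Marginals.
Variables (R : realType) (d1 d2 : measure_display) (X1 : measurableType d1) (X2 : measurableType d2).
Variables (K1 K2 : hilbertType R) (F1 : set X1 -> K1 -> K1) (F2 : set X2 -> K2 -> K2).
Hypotheses (hF1 : spectral_measure F1) (hF2 : spectral_measure F2).
Local Notation PM := (product_spectral F1 F2).
Implicit Types (Q : hs_operator K2 K1).

Let idbop (K : hilbertType R) : bop 1 (@id K).
Proof. by split=> // x; rewrite mul1r. Qed.

Lemma simple_approx_fst (g : X1 -> R[i]) : simple_approx g -> simple_approx (fun p : X1 * X2 => g p.1).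
Proof. exact: simple_approx_comp (measurable_fst). Qed.

Lemma simple_approx_snd (g : X2 -> R[i]) : simple_approx g -> simple_approx (fun p : X1 * X2 => g p.2).
Proof. exact: simple_approx_comp (measurable_snd). Qed.

Lemma hs_sumE (I : Type) (r : seq I) (G : I -> hs_operator K2 K1) y :
  (\sum_(i <- r) G i) y = \sum_(i <- r) G i y.
Proof. by elim: r => [|i r IH]; rewrite ?big_nil ?big_cons// hs_funD IH. Qed.

(** For simple functions this is the formula on rectangles whose second side is everything; the
    error is again a two-sided multiplication, of norm at most [e]. *)
Lemma sint_fst (g : X1 -> R[i]) Q y : simple_approx g ->
  sint PM (fun p => g p.1) Q y = sint F1 g (Q y).
Proof.
move=> hg; have hPM := product_spectral_measure hF1 hF2.
have [M M0 gM] := simple_bounded hg.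
have bg : bop M (sint F1 g) by split=> [|v]; [exact: sint_lin|exact: sint_le].
suff -> : sint PM (fun p => g p.1) Q = sandwich (sint F1 g) id Q.
  by rewrite (sandwichE M0 ler01 bg (idbop _)).
apply: (sint_eq hPM); first exact: simple_approx_fst.
exists (1 + rn Q) => e e0 _; have [I [q [c [mq gq]]]] := hg e e0.
exists I, (fun p => q p.1), c; split=> [i|p|].
- by have := @measurable_fst _ _ X1 X2 measurableT _ (mq i); rewrite setTI.
- by rewrite (le_trans (gq p.1))// ler_peMl ?(ltW e0)// lerDl rn_ge0.
pose D v := sint F1 g v - ssum F1 q c v.
have bD : bop e D.
  split=> [a u v|v]; last exact: sintP (ltW e0) mq gq v.
  by rewrite /D (sint_lin hF1 hg) (ssum_lin mq hF1.1) scalerBr opprD addrACA.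
have -> : sandwich (sint F1 g) id Q - ssum PM (fun p => q p.1) c Q = sandwich D id Q.
  apply: hs_eq => z; rewrite hs_funD hs_funN (sandwichE M0 ler01 bg (idbop _)).
  rewrite (sandwichE (ltW e0) ler01 bD (idbop _)) /D; congr (_ - _).
  rewrite /ssum hs_sumE; apply: eq_bigr => i _; rewrite hs_funZ; congr (_ *: _).
  have -> : (fun p : X1 * X2 => q p.1) @^-1` [set i] = (q @^-1` [set i]) `*` setT.
    by apply/seteqP; split=> p /=; [|case].
  by rewrite (pm_rect hF1 hF2)// (rect_opE hF1 hF2)// (semT hF2.1).
rewrite (le_trans (sandwich_le (ltW e0) ler01 bD (idbop _) Q))// mulr1 mulrDl mul1r mulrC lerDr.
exact: ltW.
Qed.

Lemma sint_snd (g : X2 -> R[i]) Q y : simple_approx g ->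
  sint PM (fun p => g p.2) Q y = Q (sint F2 g y).
Proof.
move=> hg; have hPM := product_spectral_measure hF1 hF2.
have [M M0 gM] := simple_bounded hg.
have bg : bop M (sint F2 g) by split=> [|v]; [exact: sint_lin|exact: sint_le].
suff -> : sint PM (fun p => g p.2) Q = sandwich id (sint F2 g) Q.
  by rewrite (sandwichE ler01 M0 (idbop _) bg).
apply: (sint_eq hPM); first exact: simple_approx_snd.
exists (1 + rn Q) => e e0 _; have [I [q [c [mq gq]]]] := hg e e0.
exists I, (fun p => q p.2), c; split=> [i|p|].
- by have := @measurable_snd _ _ X1 X2 measurableT _ (mq i); rewrite setTI.
- by rewrite (le_trans (gq p.2))// ler_peMl ?(ltW e0)// lerDl rn_ge0.
pose D v := sint F2 g v - ssum F2 q c v.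
have bD : bop e D.
  split=> [a u v|v]; last exact: sintP (ltW e0) mq gq v.
  by rewrite /D (sint_lin hF2 hg) (ssum_lin mq hF2.1) scalerBr opprD addrACA.
have -> : sandwich id (sint F2 g) Q - ssum PM (fun p => q p.2) c Q = sandwich id D Q.
  apply: hs_eq => z; rewrite hs_funD hs_funN (sandwichE ler01 M0 (idbop _) bg).
  rewrite (sandwichE ler01 (ltW e0) (idbop _) bD) /D (linopB (hs_lin Q)); congr (_ - _).
  rewrite /ssum hs_sumE (linop_sum (hs_lin Q)); apply: eq_bigr => i _.
  rewrite hs_funZ (linopZ (hs_lin Q)); congr (_ *: _).
  have -> : (fun p : X1 * X2 => q p.2) @^-1` [set i] = setT `*` (q @^-1` [set i]).
    by apply/seteqP; split=> p /=; [|case].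
  by rewrite (pm_rect hF1 hF2)// (rect_opE hF1 hF2)// (semT hF1.1).
rewrite (le_trans (sandwich_le ler01 (ltW e0) (idbop _) bD Q))// mul1r mulrDl mul1r mulrC lerDr.
exact: ltW.
Qed.

End Marginals.

(** * The perturbation formula *)

Lemma hs_rn_apply (R : realType) (U V : hilbertType R) (Z : hs_operator U V) x :
  rn (Z x) <= rn Z * rn x.
Proof. by have := hs_norm_apply Z x; rewrite -!rnE -rmorphM lecR. Qed.

Section Perturbation.
Variables (R : realType) (H : hilbertType R) (T S : H -> H) (Q : hs_operator H H).
Hypothesis QE : forall x, Q x = T x - S x.
Variables (K1 K2 : hilbertType R) (J1 : H -> K1) (J2 : H -> K2) (J1s : K1 -> H) (J2s : K2 -> H).
Variables (U1 : K1 -> K1) (U2 : K2 -> K2).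
Local Notation X := (borel_circle R).
Variables (F1 : set X -> K1 -> K1) (F2 : set X -> K2 -> K2) (ET ES : set X -> H -> H).
Hypotheses (dilT : unitary_dilation T J1 U1) (dilS : unitary_dilation S J2 U2).
Hypotheses (hF1 : spectral_measure F1) (hF2 : spectral_measure F2).
Hypotheses (hI1 : is_spectral_integral F1 (@circle_val R) U1)
           (hI2 : is_spectral_integral F2 (@circle_val R) U2).
Hypothesis hC1 : forall D, measurable D -> compression J1 (F1 D) (ET D).
Hypothesis hC2 : forall D, measurable D -> compression J2 (F2 D) (ES D).
Hypothesis hJ1 : forall x y, inner (J1 x) y = inner x (J1s y).
Hypothesis hJ2 : forall x y, inner (J2 x) y = inner x (J2s y).
Local Notation PM := (product_spectral F1 F2).
Implicit Types (x y : H) (g : X * X -> R[i]) (B D : set (X * X)) (p : X * X).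

Let iso1 := dilation_isometry dilT.
Let iso2 := dilation_isometry dilS.
Let dsT : spectral_dilation ET J1 F1. Proof. by split. Qed.
Let dsS : spectral_dilation ES J2 F2. Proof. by split. Qed.
Let hPM : spectral_measure PM. Proof. exact: product_spectral_measure. Qed.
Let liftQ := hs_lift J1 J2s Q.

Definition double_integral g : hs_operator H H := hs_drop J2 J1s (sint PM g liftQ).
Local Notation DI := double_integral.

Let drop_lin : linear_op (hs_drop J2 J1s) := hs_drop_lin dsT dsS hJ1.

Lemma double_integral_sum (I : Type) (r : seq I) (g : I -> X * X -> R[i]) :
  (forall i, simple_approx (g i)) -> DI (fun p => \sum_(i <- r) g i p) = \sum_(i <- r) DI (g i).
Proof. by move=> hg; rewrite /DI (sint_sum hPM)// (linop_sum drop_lin). Qed.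

Lemma double_integralZ a g : simple_approx g -> DI (fun p => a * g p) = a *: DI g.
Proof. by move=> hg; rewrite /DI (sintZ hPM)// (linopZ drop_lin). Qed.

Lemma double_integralB g h : simple_approx g -> simple_approx h ->
  DI (fun p => g p - h p) = DI g - DI h.
Proof. by move=> hg hh; rewrite /DI (sintB hPM)// (linopB drop_lin). Qed.

Let sc1 : simple_approx (fun p : X * X => cval p.1).
Proof. exact: simple_approx_fst (simple_cval hF1 hI1). Qed.

Let sc2 : simple_approx (fun p : X * X => cval p.2).
Proof. exact: simple_approx_snd (simple_cval hF1 hI1). Qed.

Lemma double_integral_monomial k l y :
  DI (fun p => cval p.1 ^+ k * cval p.2 ^+ l) y = iter k T (Q (iter l S y)).
Proof.
have s1 : simple_approx (fun z : X => cval z ^+ k) by exact: simple_approxX (simple_cval hF1 hI1).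
have s2 : simple_approx (fun z : X => cval z ^+ l) by exact: simple_approxX (simple_cval hF1 hI1).
rewrite /DI (hs_dropE dsT dsS hJ1) (sintM hPM); [|exact: simple_approxX|exact: simple_approxX].
rewrite (sint_fst hF1 hF2 (g := fun z => cval z ^+ k))//.
rewrite (sint_snd hF1 hF2 (g := fun z => cval z ^+ l))//.
rewrite /liftQ (hs_liftE dsT dsS hJ2) (iterT dilT hF1 hI1 hJ1).
by rewrite (iterT dilS hF2 hI2 hJ2).
Qed.

(** The quotient expanded as a polynomial in both variables, so that it integrates termwise. For
    [i = 0] the inner sum is empty, which makes the truncated [i.-1] harmless. *)
Definition poly_difference (q : {poly R[i]}) p : R[i] :=
  \sum_(i < size q) q`_i * \sum_(k < i) cval p.1 ^+ (i.-1 - k) * cval p.2 ^+ k.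

Lemma poly_differenceE q p :
  (cval p.1 - cval p.2) * poly_difference q p = q.[cval p.1] - q.[cval p.2].
Proof.
rewrite !horner_coef -sumrB mulr_sumr; apply: eq_bigr => i _.
by rewrite mulrCA -subrXX mulrBr.
Qed.

Let simple_monomial k l : simple_approx (fun p : X * X => cval p.1 ^+ k * cval p.2 ^+ l).
Proof. by apply: simple_approxM; exact: simple_approxX. Qed.

Lemma simple_poly_difference q : simple_approx (poly_difference q).
Proof.
apply: simple_approx_sum => i; apply: simple_approxZ; apply: simple_approx_sum => k.
exact: simple_monomial.
Qed.

Lemma iter_telescope n y :
  iter n T y - iter n S y = \sum_(k < n) iter (n.-1 - k) T (Q (iter k S y)).
Proof.
pose u k := - iter (n - k) T (iter k S y).
have -> : iter n T y - iter n S y = u n - u 0%N by rewrite /u subnn subn0 opprK addrC.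
rewrite -(telescope_sumr u (leq0n n)) big_mkord; apply: eq_bigr => k _.
have /linopB iTB := proj1 (iterT_bop dilT hF1 hI1 hJ1 (n.-1 - k)).
rewrite QE iTB /u opprK addrC -iterSr -iterS; congr (iter _ _ _ - iter _ _ _).
  by case: n k {u iTB} => [[]//|n k] /=; rewrite subSn// -ltnS.
by rewrite subnS -subn1 -subnDA -subn1 -subnDA addnC.
Qed.

Lemma double_integral_poly q y :
  DI (poly_difference q) y = poly_operator q T y - poly_operator q S y.
Proof.
rewrite double_integral_sum; last first.
  by move=> i; apply: simple_approxZ; apply: simple_approx_sum => k; exact: simple_monomial.
rewrite hs_sumE /poly_operator -sumrB; apply: eq_bigr => i _.
rewrite double_integralZ; last by apply: simple_approx_sum => k; exact: simple_monomial.
rewrite hs_funZ -scalerBr; congr (_ *: _).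
rewrite double_integral_sum; last by move=> k; exact: simple_monomial.
rewrite hs_sumE iter_telescope; apply: eq_bigr => k _; exact: double_integral_monomial.
Qed.

Let h p := cval p.1 - cval p.2.
Let sh : simple_approx h. Proof. exact: simple_approxB sc1 sc2. Qed.
Definition diagonal : set (X * X) := [set p | h p = 0].

Lemma diagonalE p : diagonal p -> p.1 = p.2.
Proof. by move=> /eqP; rewrite subr_eq0 => /eqP; exact: val_inj. Qed.

Lemma measurable_diagonal : measurable diagonal.
Proof. exact: measurable_zero_set sh. Qed.

Let mat := measurable_atom hF1 hI1.

Lemma atom_drop t : hs_drop J2 J1s (PM ([set t] `*` [set t]) liftQ) = 0.
Proof.
have Tl := proj1 (dilT_bop dilT hF1 hI1 hJ1).
apply: hs_eq => y; rewrite (hs_dropE dsT dsS hJ1) (pm_rect hF1 hF2); [|exact: mat|exact: mat].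
rewrite (rect_opE hF1 hF2); [|exact: mat|exact: mat].
rewrite /liftQ (hs_liftE dsT dsS hJ2).
rewrite -(compressionE iso1 hJ1 (hC1 (mat t))) -(compressionE iso2 hJ2 (hC2 (mat t))) QE.
have lE : linear_op (ET [set t]).
  move=> a u v; rewrite !(compressionE iso1 hJ1 (hC1 (mat t))).
  by rewrite (proj1 (isometry_bop iso1)) (sem_lin hF1.1 (mat t)) (proj1 (coisometry_bop iso1 hJ1)).
rewrite (atom_eigen dilS hF2 hI2 hC2 hJ2) (linopB lE) (linopZ lE).
by rewrite (atom_comm dilT hF1 hI1 hC1 hJ1) (atom_eigen dilT hF1 hI1 hC1 hJ1) subrr.
Qed.

(* Off the finitely many large atoms of [F1 (.) (J1 x)] the sections of a subset of the diagonal
   are small; the atoms contribute nothing by [atom_drop]. *)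
Lemma diagonal_drop B : measurable B -> B `<=` diagonal -> hs_drop J2 J1s (PM B liftQ) = 0.
Proof.
move=> mB BD; apply: hs_ext => x y; rewrite inner0l.
have drop_inner D Z : inner (hs_drop J2 J1s Z) (rank_one x y) = inner Z (rank_one (J1 x) (J2 y)).
  rewrite inner_conj -(hs_lift_adj dsT dsS hJ1 hJ2) -inner_conj.
  by rewrite (hs_lift_rank_one dsT dsS hJ2).
rewrite drop_inner//; set rk := rank_one _ _.
have col (t : X) : measurable ([set: X] `*` [set t]) by apply: measurableX => //; exact: mat.
(* Over finitely many points [B] splits into pieces that are empty or a single [(t, t)]; the latter
   are killed by [atom_drop]. *)
have fin (s : seq X) : uniq s -> measurable (B `&` [set p | p.2 \in s]) /\
    inner (PM (B `&` [set p | p.2 \in s]) liftQ) rk = 0.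
  elim: s => [_|t s IH /= /andP[ts us]].
    rewrite (_ : _ `&` _ = set0); last by rewrite -subset0 => p [].
    by rewrite (sem0 hPM.1) inner0l.
  have [ms S0] := IH us.
  have mBt : measurable (B `&` ([set: X] `*` [set t])) by exact: measurableI.
  have -> : B `&` [set p | p.2 \in t :: s] =
      (B `&` ([set: X] `*` [set t])) `|` (B `&` [set p | p.2 \in s]).
    apply/seteqP; split=> p /=.
      by rewrite in_cons => -[Bp /orP[/eqP|]]; [left|right].
    by rewrite in_cons => -[[Bp [_ ->]]|[Bp ->]]; rewrite ?eqxx ?orbT.
  split; first exact: measurableU.
  have disj : (B `&` ([set: X] `*` [set t])) `&` (B `&` [set p | p.2 \in s]) = set0.
    by rewrite -subset0 => p /= [[_ [_ ->]] [_]]; exact/negP.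
  rewrite (pm_U hF1 hF2 liftQ mBt ms disj) innerDl S0 addr0.
  have [Btt|nB] := pselect (B (t, t)).
    rewrite (_ : _ `&` _ = [set t] `*` [set t]).
      by rewrite -drop_inner// atom_drop inner0l.
    apply/seteqP; split=> -[u v] /=; first by move=> [/BD/diagonalE/= -> [_ ->]].
    by move=> [-> ->].
  rewrite (_ : _ `&` _ = set0); first by rewrite (sem0 hPM.1) inner0l.
  rewrite -subset0 => -[u v] /= [Buv [_ vt]]; apply: nB.
  by have /= uv := diagonalE (BD _ Buv); rewrite uv vt in Buv.
apply: eq_cabs_small => e e0; rewrite subr0.
have P : 0 < (rn liftQ * rn (J2 y) + 1) by rewrite ltr_wpDl// mulr_ge0 ?rn_ge0.
have d0 := divr_gt0 e0 P; set r := e / _ in d0.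
have r20 : 0 < r ^+ 2 by rewrite exprn_gt0.
have /finite_seqP[s0 sE] := atoms_finite hF1 mat (J1 x) r20.
have [ms S0] := fin (undup s0) (undup_uniq s0).
set M := B `&` _ in ms S0.
have -> : inner (PM B liftQ) rk = inner (PM (B `\` M) liftQ) rk.
  by rewrite (sem_diff hPM.1 _ mB ms); [rewrite innerBl S0 subr0|exact: subIsetl].
have mBM : measurable (B `\` M) by exact: measurableD.
rewrite (pm_sa hF1 hF2)// (le_trans (cabs_inner _ _))//.
have -> : e = r * (rn liftQ * rn (J2 y) + 1) by rewrite /r divfK// gt_eqF.
suff small : rn (PM (B `\` M) rk) <= r * rn (J2 y).
  rewrite (le_trans (ler_wpM2l (rn_ge0 _) small))// mulrCA ler_wpM2l ?(ltW d0)// lerDl//.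
have J2n : 0 <= r * rn (J2 y) by rewrite mulr_ge0 ?rn_ge0// ltW.
rewrite -(@ler_pXn2r _ 2) ?nnegrE ?rn_ge0// -[leLHS]ger0_norm ?sqr_ge0// -cabs_real.
rewrite -(pm_sqrE hF1 hF2)// (pm_rk hF1 hF2)// /product_form.
rewrite (le_trans (cabs_inner _ _))// exprMn [rn (J2 y) ^+ 2]expr2 mulrA ler_wpM2r ?rn_ge0//.
apply: (sint_le hF2 _ (section_simple hF1.1 _ _ mBM) (ltW r20)) => t.
rewrite /section_fun ysection_preimage.
(* The section at [t] of what remains of [B] is empty or [[set t]]; in the second case [t] is not in
   [s0], so its atom weighs less than [r ^+ 2]. *)
have [[nBt|tt]|nE] := pselect (~ (B `\` M) (t, t) \/ t \in s0).
- rewrite (_ : [set _ | _] = set0) ?(sem0 hF1.1) ?inner0l ?cabs0 ?(ltW r20)//.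
  rewrite -subset0 => u /= Bu; apply: nBt.
  by move: (Bu); have /= -> := diagonalE (BD _ Bu.1).
- rewrite (_ : [set _ | _] = set0) ?(sem0 hF1.1) ?inner0l ?cabs0 ?(ltW r20)//.
  by rewrite -subset0 => u /= [Bu]; apply; split=> //=; rewrite mem_undup.
have -> : [set u | (B `\` M) (u, t)] = [set t].
  apply/seteqP; split=> u /=; first by move=> Bu; exact: (diagonalE (BD _ Bu.1)).
  by move=> ->; apply: contrapT => nB; apply: nE; left.
rewrite (sp_sqr hF1)// cabs_real ger0_norm ?sqr_ge0// leNgt; apply/negP => lt_r.
by apply: nE; right; have : [set` s0] t by rewrite -sE /= ltW.
Qed.

(** Each piece of a simple approximation of [g] meets the diagonal in a measurable subset, to which
    [diagonal_drop] applies; this is why the latter treats all such subsets and not the diagonal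
    alone. *)
Lemma double_integral_diagonal g : simple_approx g -> DI (fun p => g p * cindic R diagonal p) = 0.
Proof.
move=> hg; have mD := measurable_diagonal.
rewrite /DI (sintM hPM)//; last exact: simple_approx_indic.
rewrite (sint_indic hPM)//; apply: eq_rn_small => e e0; rewrite subr0.
have P : 0 < rn liftQ + 1 by rewrite ltr_wpDl// rn_ge0.
have d0 := divr_gt0 e0 P; set r := e / _ in d0.
have [I [q [c [mq gq]]]] := hg r d0.
have := sintP hPM hg (ltW d0) mq gq (PM diagonal liftQ).
have S0 : hs_drop J2 J1s (ssum PM q c (PM diagonal liftQ)) = 0.
  rewrite /ssum (linop_sum drop_lin) big1// => i _; rewrite (linopZ drop_lin) (sp_cap hPM _ (mq i) mD).
  by rewrite diagonal_drop ?scaler0//; exact: measurableI.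
set W := sint _ _ _; set V := ssum _ _ _ _ in S0 * => hW.
have -> : hs_drop J2 J1s W = hs_drop J2 J1s (W - V) by rewrite (linopB drop_lin) S0 subr0.
rewrite (le_trans (coisometry_le (hs_lift_iso dsT dsS hJ1 hJ2) (hs_lift_adj dsT dsS hJ1 hJ2) _))//.
rewrite (le_trans hW)// (@le_trans _ _ (r * rn liftQ))//.
  rewrite ler_wpM2l ?(ltW d0)//; exact: (pm_contr hF1 hF2 _ mD).
have -> : e = r * (rn liftQ + 1) by rewrite /r divfK// gt_eqF.
by rewrite ler_wpM2l ?(ltW d0)// lerDl.
Qed.

(** * Passage from polynomials to the disk algebra *)

Section Limit.
Variables (f : R[i] -> R[i]) (L : R) (q : nat -> {poly R[i]}).
Hypothesis L0 : 0 <= L.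
Hypothesis qf : forall e : R, 0 < e -> exists N, forall n, (N <= n)%N ->
  forall z, cabs z <= 1 -> cabs ((q n).[z] - f z) <= e.
Hypothesis qL : forall n z v, cabs z <= 1 -> cabs v <= 1 ->
  cabs ((q n).[z] - (q n).[v]) <= L * cabs (z - v).
Hypothesis fL : forall z v, cabs z <= 1 -> cabs v <= 1 -> cabs (f z - f v) <= L * cabs (z - v).

(** The quotient of [q n] with the value 0 on the diagonal, as in [divided_difference]; the
    subtracted term integrates to 0 by [double_integral_diagonal]. *)
Let pd n p := poly_difference (q n) p - poly_difference (q n) p * cindic R diagonal p.

Let simple_pd n : simple_approx (pd n).
Proof.
apply: simple_approxB; first exact: simple_poly_difference.
apply: simple_approxM; first exact: simple_poly_difference.
by apply: simple_approx_indic; exact: measurable_diagonal.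
Qed.

Let pdE n p : pd n p = if h p == 0 then 0 else ((q n).[cval p.1] - (q n).[cval p.2]) / h p.
Proof.
rewrite /pd /cindic; case: eqVneq => [h0|h0].
  by rewrite (asboolT (h0 : diagonal p)) mulr1 subrr.
rewrite (_ : `[< diagonal p >] = false); last by apply/asboolP => /eqP; rewrite (negbTE h0).
by rewrite mulr0 subr0 -poly_differenceE mulrC mulKf.
Qed.

Let ddE p : divided_difference f p = if h p == 0 then 0 else (f (cval p.1) - f (cval p.2)) / h p.
Proof. by rewrite /divided_difference /h subr_eq0. Qed.

Let c1 (z : X) : cabs (cval z) <= 1. Proof. by rewrite cabs_cval. Qed.

Let dd_le p : cabs (divided_difference f p) <= L.
Proof.
rewrite ddE; case: eqVneq => [_|h0]; first by rewrite cabs0.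
have ch : 0 < cabs (h p) by rewrite cabs_gt0.
by rewrite cabsM cabsV ler_pdivrMr// fL.
Qed.

Let pd_le n p : cabs (pd n p) <= L.
Proof.
rewrite pdE; case: eqVneq => [_|h0]; first by rewrite cabs0.
have ch : 0 < cabs (h p) by rewrite cabs_gt0.
by rewrite cabsM cabsV ler_pdivrMr// qL.
Qed.

Let pd_cvg (del e : R) : 0 < del -> 0 < e -> exists N, forall n, (N <= n)%N ->
  forall p, ~ (h p != 0 /\ cabs (h p) < del) -> cabs (divided_difference f p - pd n p) <= e.
Proof.
(* Two values of [q n] are each off by at most half of [e * del], and the quotient divides by at
   least [del]. *)
move=> del0 e0; have r0 : 0 < e * del / 2 by rewrite divr_gt0// mulr_gt0.
have [N hN] := qf r0; exists N => n /hN hn p; rewrite ddE pdE.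
case: eqVneq => [_ _|h0 hp]; first by rewrite subrr cabs0 ltW.
have hdel : del <= cabs (h p) by rewrite leNgt; apply/negP => hlt; apply: hp.
have ch := lt_le_trans del0 hdel.
rewrite -mulrBl cabsM cabsV ler_pdivrMr//.
apply: (@le_trans _ _ (e * del)); last by rewrite ler_wpM2l ?(ltW e0).
rewrite (_ : _ - _ = - ((q n).[cval p.1] - f (cval p.1)) + ((q n).[cval p.2] - f (cval p.2))); last by ring.
by rewrite (le_trans (cabsD _ _))// cabsN [leRHS]splitr lerD// hn.
Qed.

(** A bounded pointwise limit of the [pd n]; on the diagonal all of them are 0. *)
Lemma simple_divided_difference : simple_approx (divided_difference f).
Proof.
apply: (@cmeasurable_simple _ _ _ _ L); last exact: dd_le.
apply: (@cmeasurable_cvg _ _ _ pd) => [n|p e e0]; first exact: simple_cmeasurable.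
have [h0|h0] := eqVneq (h p) 0.
  by exists 0%N => n _; rewrite ddE pdE h0 eqxx subrr cabs0 ltW.
have ch : 0 < cabs (h p) by rewrite cabs_gt0.
have [N hN] := pd_cvg ch e0; exists N => n /hN; apply=> -[_].
by rewrite ltxx.
Qed.

Lemma double_integral_pd n y : DI (pd n) y = poly_operator (q n) T y - poly_operator (q n) S y.
Proof.
rewrite double_integralB; first last.
- apply: simple_approxM; first exact: simple_poly_difference.
  by apply: simple_approx_indic; exact: measurable_diagonal.
- exact: simple_poly_difference.
rewrite double_integral_diagonal; last exact: simple_poly_difference.
by rewrite subr0 double_integral_poly.
Qed.

Lemma disk_calculus_difference :
  disk_calculus f T - disk_calculus f S = double_operator_integral ET ES (divided_difference f) Q :> (H -> H).
Proof.
rewrite (double_operator_integralE dsT dsS hJ1 hJ2 _ simple_divided_difference) -/(DI _).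
apply/funext => y; rewrite -[LHS]/(disk_calculus f T y - disk_calculus f S y).
rewrite (disk_calculus_sint dilT hF1 hI1 hJ1 qf) (disk_calculus_sint dilS hF2 hI2 hJ2 qf).
apply: eq_rn_small => e e0.
(* [rn liftQ] pays for the integral off the punctured neighbourhood of the diagonal, [2 * L] for the
   integral on it, and 2 for the two functional calculi. *)
pose C := rn liftQ + 2 * L + 2.
have C0 : 0 < C by rewrite /C ltr_wpDl// addr_ge0 ?rn_ge0 ?mulr_ge0.
have y1 : 0 < rn y + 1 by rewrite ltr_wpDl// rn_ge0.
have d0 := divr_gt0 e0 (mulr_gt0 C0 y1); set r := e / _ in d0.
have [del del0 hdel] := punctured_decr sh liftQ hPM d0.
have [N hN] := pd_cvg del0 d0; have [M hM] := qf d0.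
pose n := maxn N M; have k1 := hN n (leq_maxl _ _); have k2 := hM n (leq_maxr _ _).
have kT := poly_operator_near dilT hF1 hI1 hJ1 qf y (ltW d0) k2.
have kS := poly_operator_near dilS hF2 hI2 hJ2 qf y (ltW d0) k2.
have sB := simple_approxB simple_divided_difference (simple_pd n).
have LL0 : 0 <= 2 * L by rewrite mulr_ge0.
have bd p : cabs (divided_difference f p - pd n p) <= 2 * L.
  by rewrite (le_trans (cabsB _ _))// mulr_natl mulr2n (lerD (dd_le p) (pd_le n p)).
have k3 : rn (DI (fun p => divided_difference f p - pd n p)) <= r * (rn liftQ + 2 * L).
  rewrite (le_trans (coisometry_le (hs_lift_iso dsT dsS hJ1 hJ2) (hs_lift_adj dsT dsS hJ1 hJ2) _))//.
  have mP := measurable_punctured sh del0.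
  have := sint_split hPM liftQ sB mP (ltW d0) LL0 k1 (fun p _ => bd p).
  move=> /le_trans; apply; rewrite mulrDr lerD2l [leRHS]mulrC.
  by rewrite ler_wpM2l.
have k4 : rn (DI (divided_difference f) y - DI (pd n) y) <= r * (rn liftQ + 2 * L) * rn y.
  have -> : DI (divided_difference f) y - DI (pd n) y =
      DI (fun p => divided_difference f p - pd n p) y.
    by rewrite double_integralB//; exact: simple_divided_difference.
  have : rn (DI (fun p => divided_difference f p - pd n p) y) <=
      rn (DI (fun p => divided_difference f p - pd n p)) * rn y.
    exact: hs_rn_apply.
  by move=> /le_trans; apply; rewrite ler_wpM2r ?rn_ge0.
move: k4; rewrite double_integral_pd => k4.
move: kT kS k4; move: (J1s _) (J2s _) (DI _ y) (poly_operator _ T y) (poly_operator _ S y) => a b v u w kT kS k4.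
rewrite (_ : a - b - v = - (u - a) + (w - b) - (v - (u - w))); last first.
  have E : a - u + (w - b) = a - b - (u - w).
    by rewrite opprB addrACA [RHS]addrACA [- u + _]addrC.
  by rewrite !opprB addrA E subrK.
rewrite (le_trans (rnB _ _))// (le_trans (lerD (rnD _ _) (lexx _)))// rnN.
rewrite (le_trans (lerD (lerD kT kS) k4))//.
rewrite [leLHS](_ : _ = r * (C * rn y)); last by rewrite /C; ring.
have -> : e = r * (C * (rn y + 1)) by rewrite /r divfK// gt_eqF// mulr_gt0.
by rewrite ler_wpM2l ?(ltW d0)// ler_wpM2l ?(ltW C0)// lerDl.
Qed.

End Limit.

End Perturbation.

Theorem theorem4p3 (R : realType) (phi : R[i]^o -> R[i]^o)
  (phi_analytic : analytic_on_disk phi) (dphi_Hinfty : Hinfty (derive1 phi))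
  (H : hilbertType R) (T S : H -> H)
  (T_contraction : contraction_operator T)
  (S_contraction : contraction_operator S)
  (TS_hs : hilbert_schmidt (T - S))
  (ET ES : set (borel_circle R) -> H -> H)
  (ET_T : is_semispectral_measure_of T ET)
  (ES_S : is_semispectral_measure_of S ES) :
  let f := closed_disk_extension phi in
  disk_calculus f T - disk_calculus f S =
  double_operator_integral ET ES (divided_difference f) (hs_of TS_hs) :> (H -> H).
Proof.
case: ET_T => K1 [J1 [U1 [F1 [dilT hF1 hI1 hC1]]]].
case: ES_S => K2 [J2 [U2 [F2 [dilS hF2 hI2 hC2]]]].
have [L [q [L0 qf qL fL]]] := closed_disk_polynomials phi_analytic dphi_Hinfty.
have b1 := isometry_bop (dilation_isometry dilT); have b2 := isometry_bop (dilation_isometry dilS).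
have [J1s hJ1] := adjoint_exists b1.1 b1.2; have [J2s hJ2] := adjoint_exists b2.1 b2.2.
by apply: (disk_calculus_difference _ dilT dilS hF1 hF2 hI1 hI2 hC1 hC2 hJ1 hJ2 L0 qf qL fL).
Qed.
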